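(* Consider the continuous-time Markov decision process $\{S,A,A(\cdot,\cdot),q,c,g\}$ over the finite horizon $[0,T]$, $T>0$, described in the context. Suppose that the following two groups of conditions hold. (I) There exist a function $V:S\to[1,\infty)$ and constants $\rho>0$, $M>1$ such that (a) $\sum_{j\in S}q(j|t,i,a)V(j)\le \rho V(i)$ for each $(t,i,a)\in K$; (b) $q^*(i)\le MV(i)$ for all $i\in S$; (c) $e^{2(1+T)|c(t,i,a)|}\le MV(i)$ for each $(t,i,a)\in K$, and $e^{2(1+T)|g(i)|}\le MV(i)$ for each $i\in S$. (II) There exist a function $V_1:S\to[1,\infty)$ and constants $\rho_1>0$, $M_1>0$ such that (a) $\sum_{j\in S}V_1^2(j)q(j|t,i,a)\le\rho_1V_1^2(i)$ for each $(t,i,a)\in K$; (b) $V^2(i)\le M_1V_1(i)$ for all $i\in S$, with $V$ as in (I). Then, for each $i\in S$, $\pi\in\Pi$ and $\varphi\in C^1_{V,V_1}([0,T]\times S)$, $$\mathbb E_i^\pi\left[\int_0^T\Big(\psi'(\omega,t,\xi_t)+\sum_{j\in S}\psi(\omega,t,j)\int_A q(j|t,\xi_t,a)\pi(da|\omega,t)\Big)dt\right]=\mathbb E_i^\pi\left[\psi(\omega,T,\xi_T)\right]-\varphi(0,i),$$ where, outside a $\mathbb P_i^\pi$-null set $\Omega\setminus\Omega'$, one has $T_\infty=\infty$, $$\psi(\omega,t,j)=e^{\int_0^t\int_A c(v,\xi_v,a)\pi(da|\omega,v)dv}\varphi(t,j),\qquad t\in[0,T],\ j\in S,$$ and $\psi(\omega,\cdot,j)$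 is absolutely continuous on $[0,T]$, so that one can take $$\psi'(\omega,t,j)=\int_A c(t,\xi_t,a)\pi(da|\omega,t)\,e^{\int_0^t\int_A c(v,\xi_v,a)\pi(da|\omega,v)dv}\varphi(t,j)+e^{\int_0^t\int_A c(v,\xi_v,a)\pi(da|\omega,v)dv}\varphi'(t,j)$$ for each $\omega\in\Omega'$ and $j\in S$.
   Context: Model. $S$ is a denumerable state space with the discrete topology; $A$ is a nonempty Borel space (action space). For each $(t,i)\in[0,\infty)\times S$, $A(t,i)\in\mathcal B(A)$ is the set of admissible actions; the graph $K:=\{(t,i,a)\in[0,\infty)\times S\times A: a\in A(t,i)\}$ is measurable and contains the graph of some measurable mapping from $[0,\infty)\times S$ to $A$. The transition rate $q$ is a signed kernel on $S$ given $K$ with $q(j|t,i,a)\ge0$ for $j\ne i$, $q(S|t,i,a)\equiv0$, and $q^*(i):=\sup_{t\ge0,a\in A(t,i)}q(t,i,a)<\infty$ for all $i\in S$, where $q(t,i,a):=-q(i|t,i,a)\ge 0$. The running cost rate $c$ is a real-valued measurable function on $K$, and the terminal cost $g$ is a real-valued function on $S$. Measurability is in the Borel sense. Sample space. Let $S_\Delta:=S\cup\{\Delta\}$ with $\Delta\notin S$ an isolated point. $\Omega$ is the union of $(S\times(0,\infty))^\infty$ and the set of all sequences $(i_0,\theta_1,i_1,\dots,\theta_k,i_k,\infty,\Delta,\infty,\Delta,\dots)$, $k\ge0$, with $i_m\in S$, $\theta_m\in(0,\infty)$; $\mathcal F$ is its Borel $\sigma$-algebra. Put $T_0:=0$, $T_{k+1}:=\theta_1+\dots+\theta_{k+1}$,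 $X_k:=i_k$, $T_\infty:=\lim_k T_k$. Let $\{\mathcal F_t\}$ be the internal history of the marked point process $\{T_n,X_n\}$. The controlled process is $\xi_t:=i_k$ if $T_k\le t<T_{k+1}$, and $\xi_t:=\Delta$ if $t\ge T_\infty$. With an isolated point $a_\Delta\notin A$, put $A(t,\Delta):=\{a_\Delta\}$, $q(\cdot|t,\Delta,a_\Delta):\equiv0$, $c(t,\Delta,a_\Delta):\equiv0$, $A_\Delta:=A\cup\{a_\Delta\}$. Policies. A (history-dependent) policy $\pi$ is given by a sequence of stochastic kernels $\{\pi^k,k\ge0\}$ through $$\pi(da|\omega,t)=I_{\{t=0\}}\pi^0(da|i_0,0)+\sum_{k\ge0}I_{\{T_k<t\le T_{k+1}\}}\pi^k(da|i_0,\theta_1,i_1,\dots,\theta_k,i_k,t-T_k)+I_{\{t\ge T_\infty\}}I_{\{a_\Delta\}}(da),$$ where the kernels are concentrated on the admissible actions, i.e. $\pi^k(\cdot|i_0,\theta_1,\dots,i_k,s)$ is concentrated on $A(T_k+s,i_k)$. $\Pi$ is the set of all policies. Probability. For $\pi\in\Pi$ and $i\in S$, $\mathbb P_i^\pi$ is the probability on $(\Omega,\mathcal F)$ with $\mathbb P_i^\pi(\xi_0=i)=1$ under which the random measure $m^\pi(j|\omega,t)dt:=\int_A q(\{j\}\setminus\{\xi_{t-}\}|t,\xi_{t-},a)\pi(da|\omega,t)dt$, with $\xi_{t-}=\lim_{s\uparrow t}\xi_s$, is the dual predictable projection (compensator) of the random measure $\sum_{n\ge1}\delta_{(T_n,X_n)}(dt,dx)$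 on $\mathcal B((0,\infty)\times S)$ of the marked point process. $\mathbb E_i^\pi$ is the corresponding expectation. Function class. A function $\varphi$ on $[0,T]\times S$ is $V$-bounded if $\|\varphi\|_V:=\sup_{(t,i)\in[0,T]\times S}|\varphi(t,i)|/V(i)<\infty$; $V_1$-boundedness is defined likewise. If $\varphi(\cdot,i)$ is absolutely continuous on $[0,T]$ for each $i$, $\varphi'$ denotes a measurable function on $[0,T]\times S$ with $\varphi(t,i)-\varphi(0,i)=\int_0^t\varphi'(s,i)ds$ for all $t\in[0,T]$, $i\in S$; similarly $\psi'(\omega,\cdot,j)$ denotes such a density in $t$ of $\psi(\omega,\cdot,j)$. $C^1_{V,V_1}([0,T]\times S)$ is the collection of $V$-bounded functions $\varphi$ on $[0,T]\times S$ such that $\varphi(\cdot,i)$ is absolutely continuous on $[0,T]$ for each $i\in S$ and which admit some $V_1$-bounded $\varphi'$ (this is the $\varphi'$ used in the formula for $\psi'$). *)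

(* Defs.v *)
From HB Require Import structures.
From mathcomp Require Import all_boot all_order all_algebra.
From mathcomp Require Import all_classical all_reals all_analysis.
From mathcomp Require Import measurable_realfun.

Set Implicit Arguments.
Unset Strict Implicit.
Unset Printing Implicit Defensive.

Import Order.TTheory GRing.Theory Num.Theory.
Import numFieldNormedType.Exports.

Local Open Scope classical_set_scope.
Local Open Scope ring_scope.

Notation borel A := (g_sigma_algebraType (@open A)).

(* A Borel space is a topological space homeomorphic to a Borel subset of a
   complete separable metric space.  The clause on [open U] together with
   continuity and injectivity says that [f] is a homeomorphism onto its
   range. *)
Definition borel_space (R : realType) (A : topologicalType) : Prop :=
  exists (Y : completePseudoMetricType R) (f : A -> Y),
    [/\ hausdorff_space Y,
        exists D : set Y, countable D /\ dense D,
        injective f /\ continuous f,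
        forall U : set A, open U -> exists2 W : set Y, open W & U = f @^-1` W
      & <<s @open Y >> (range f)].

(* [option T] is T with an isolated point None adjoined. *)
Section option_measurable.
Context d (T : measurableType d).

Definition measurable_option (B : set (option T)) : Prop :=
  measurable (Some @^-1` B).

Lemma measurable_option0 : measurable_option set0.
Proof. by rewrite /measurable_option preimage_set0. Qed.

Lemma measurable_optionC B : measurable_option B -> measurable_option (~` B).
Proof. by rewrite /measurable_option preimage_setC => /measurableC. Qed.

Lemma measurable_option_bigcup (F : (set (option T))^nat) :
  (forall k, measurable_option (F k)) -> measurable_option (\bigcup_k F k).
Proof.
by rewrite /measurable_option preimage_bigcup => mF; exact: bigcup_measurable.
Qed.

Definition option_display (d' : measure_display) : measure_display.
Proof. exact. Qed.

HB.instance Definition _ := isPointed.Build (option T) None.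
HB.instance Definition _ := isMeasurable.Build (option_display d) (option T)
  measurable_option0 measurable_optionC measurable_option_bigcup.

Lemma measurable_Some : measurable_fun [set: T] (@Some T).
Proof. by move=> _ B mB; rewrite setTI. Qed.

Definition lift_option (R : realType) (m : {measure set T -> \bar R})
  : set (option T) -> \bar R := pushforward m Some.

HB.instance Definition _ (R : realType) (m : {measure set T -> \bar R}) :=
  Measure.copy (lift_option m)
    (@measure_function_pushforward__canonical__measure_function_Measure
       _ _ T (option T) R m Some measurable_Some).

End option_measurable.

(* Sum over j in S of terms of both signs; [esum] handles nonnegative ones. *)
Definition signed_sum (R : realType) (S : choiceType) (f : S -> \bar R)
    : \bar R :=
  (\esum_(j in [set: S]) f^\+ j - \esum_(j in [set: S]) f^\- j)%E.

(* [graph] is K; only the restrictions of q and c to K, and of the admissible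
   sets to t >= 0, matter. *)
Record ctmdp (R : realType) dS (S : measurableType dS) (A : ptopologicalType)
    := Ctmdp {
  adm : R -> S -> set (borel A);
  rate : R * S * borel A -> {charge set S -> \bar R};
  cost : R * S * borel A -> R;
  terminal : S -> R;
  graph : set (R * S * borel A) :=
    [set x | 0 <= x.1.1 /\ adm x.1.1 x.1.2 x.2];
  adm_measurable : forall (t : R) i, 0 <= t -> measurable (adm t i);
  graph_measurable : measurable graph;
  graph_selector : exists f : R * S -> borel A,
    measurable_fun [set x : R * S | 0 <= x.1] f /\
    forall (t : R) i, 0 <= t -> adm t i (f (t, i));
  rate_measurable : forall B : set S, measurable B ->
    measurable_fun graph (fun x => rate x B);
  rate_ge0 : forall t i a j, graph (t, i, a) -> j != i ->
    (0 <= rate (t, i, a) [set j])%E;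
  rate_setT : forall x, graph x -> rate x [set: S] = 0%E;
  rate_sup_lty : forall i, (ereal_sup
    [set (- rate x [set i])%E | x in graph `&` [set x | x.1.2 = i]]
      < +oo)%E;
  cost_measurable : measurable_fun graph cost
}.

Section model.
Context (R : realType) dS (S : measurableType dS) (A : ptopologicalType).
Variable mdp : ctmdp R S A.

Definition qstar (i : S) : \bar R := ereal_sup
  [set (- rate mdp x [set i])%E | x in graph mdp `&` [set x | x.1.2 = i]].

(* Extensions to S_Delta = option S and A_Delta = option A, where None stands
   for Delta and a_Delta; they vanish wherever q and c are not defined (off K).
   Under an admissible policy this only concerns the jump times, where xi and
   the action law refer to different states. *)
Definition rate_ext (t : R) (x : option S) (a : option (borel A)) (B : set S)
    : \bar R :=
  match x, a with
  | Some i, Some a => ((fun y => rate mdp y B) \_ (graph mdp)) (t, i, a)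
  | _, _ => 0%E
  end.

Definition cost_ext (t : R) (x : option S) (a : option (borel A)) : R :=
  match x, a with
  | Some i, Some a => (cost mdp \_ (graph mdp)) (t, i, a)
  | _, _ => 0
  end.

End model.

Section sample_space.
Context (R : realType) dS (S : measurableType dS).

(* The sequence (i_0, theta_1, i_1, theta_2, i_2, ...) is encoded as
   (i_0, n |-> (theta_{n+1}, i_{n+1})), with None for Delta. *)
Definition trajectory (w : S * (nat -> \bar R * option S)) : Prop :=
  (forall n, exists2 th : R, 0 < th & exists j, w.2 n = (th%:E, Some j)) \/
  (exists k : nat,
    (forall n, (n < k)%N ->
       exists2 th : R, 0 < th & exists j, w.2 n = (th%:E, Some j)) /\
    (forall n, (k <= n)%N -> w.2 n = (+oo%E, None))).

Definition Omega : Type := {w | trajectory w}.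

Definition initial (w : Omega) : S := (sval w).1.

(* theta_{n+1} *)
Definition sojourn (w : Omega) (n : nat) : \bar R := ((sval w).2 n).1.

Definition mark (w : Omega) (k : nat) : option S :=
  if k is n.+1 then ((sval w).2 n).2 else Some (initial w).

Definition jump_time (w : Omega) (k : nat) : \bar R :=
  (\sum_(n < k) sojourn w n)%E.

Definition explosion (w : Omega) : \bar R := limn (jump_time w).

Lemma trajectory_constant (i : S) : trajectory (i, fun=> (+oo%E, None)).
Proof. by right; exists 0%N; split. Qed.

HB.instance Definition _ := gen_eqMixin Omega.
HB.instance Definition _ := gen_choiceMixin Omega.
HB.instance Definition _ := isPointed.Build Omega
  (exist trajectory (point, fun=> (+oo%E, None)) (trajectory_constant point)).

(* The coordinates take values in second countable spaces, so the Borel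
   sigma-algebra of the product topology is generated by them. *)
Definition coordinate_sets : set (set Omega) :=
  preimage_set_system setT initial measurable `|`
  \bigcup_n preimage_set_system setT (fun w : Omega => (sval w).2 n) measurable.

HB.instance Definition _ :=
  Measurable.copy Omega (g_sigma_algebraType coordinate_sets).

(* Delta from the explosion time on, since no k is then available *)
Definition xi (w : Omega) (t : R) : option S :=
  xget None [set mark w k |
    k in [set k | (jump_time w k <= t%:E < jump_time w k.+1)%E]].

(* In the discrete space S_Delta, a left limit is an eventual value; the
   default only plays a role at t equal to the explosion time. *)
Definition xi_left (w : Omega) (t : R) : option S :=
  xget None [set x | \forall s \near t^'-, xi w s = x].

(* Internal history of the marked point process (T_n, X_n), n >= 0. *)
Definition history_events (t : R) : set (set Omega) :=
  <<s [set B | exists n (s : R) (C : set S), [/\ 0 <= s <= t, measurable C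
        & B = [set w | (jump_time w n <= s%:E)%E /\
                       exists2 j, C j & mark w n = Some j]] ] >>.

(* Generators of the predictable sigma-algebra on Omega x ]0, +oo[. *)
Definition predictable_rectangles : set (set (Omega * R)) :=
  [set B | exists (s : R) (G : set Omega),
     [/\ 0 <= s, history_events s G & B = G `*` `]s, +oo[%classic]].

Definition predictable_type : Type := g_sigma_algebraType predictable_rectangles.

HB.instance Definition _ := Measurable.copy predictable_type
  (g_sigma_algebraType predictable_rectangles).

(* integral of W against sum_(n >= 1) delta_(T_n, X_n), the sum being over
   finite T_n *)
Definition mpp_integral (W : Omega * R * S -> \bar R) (w : Omega) : \bar R :=
  (\sum_(1 <= n <oo)
     match jump_time w n, mark w n with
     | t%:E, Some j => W (w, t, j)
     | _, _ => 0
     end)%E.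

(* The random measure m(j|w,t) dt on ]0, +oo[ x S is the dual predictable
   projection of sum_(n >= 1) delta_(T_n, X_n) under P: it is predictable, and
   both measures give the same expected integral to every nonnegative
   predictable W. *)
Definition is_compensator (P : probability Omega R)
    (m : Omega -> R -> S -> \bar R) : Prop :=
  (forall j, measurable_fun [set x : predictable_type | 0 < x.2]
     (fun x => m x.1 x.2 j)) /\
  (forall W : predictable_type * S -> \bar R,
     (forall x, 0 <= W x)%E ->
     measurable_fun [set x : predictable_type * S | 0 < x.1.2] W ->
     (\int[P]_w mpp_integral W w =
      \int[P]_w \int[lebesgue_measure]_(t in `]0%R, +oo[)
        \esum_(j in [set: S]) (W (w, t, j) * m w t j))%E).

End sample_space.

Arguments Omega R {dS} S.

Section policies.
Context (R : realType) dS (S : measurableType dS) (A : ptopologicalType).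
Variable mdp : ctmdp R S A.

(* [policy_kernel k (i_0, ((theta_1, i_1), ..., (theta_k, i_k)), s)]; only
   theta_m > 0 and s > 0 (and also s = 0 when k = 0) matter. *)
Record policy := Policy {
  policy_kernel :
    forall k, R.-pker (S * k.-tuple (R * S) * R)%type ~> borel A;
  policy_admissible : forall k i (h : k.-tuple (R * S)) (s : R),
    all (fun x => 0 < x.1) h -> (0 < s) || ((k == 0) && (s == 0)) ->
    policy_kernel k (i, h, s)
      (adm mdp (\sum_(x <- h) x.1 + s) (last (0, i) h).2) = 1%E }.

Variable pi : policy.

Definition history (w : Omega R S) (k : nat) : S * k.-tuple (R * S) :=
  (initial w,
   [tuple (fine (sojourn w m), odflt (initial w) (mark w m.+1)) | m < k]).

(* pi^k(da|i_0, theta_1, i_1, ..., theta_k, i_k, s) as a measure on A_Delta *)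
Definition policy_kernel_ext (w : Omega R S) (k : nat) (s : R)
    : {measure set (option (borel A)) -> \bar R} :=
  lift_option (policy_kernel pi k (history w k, s)).

(* pi(da|w,t) *)
Definition action_law (w : Omega R S) (t : R)
    : {measure set (option (borel A)) -> \bar R} :=
  measure_add
    (mscale ((t == 0)%:R)%:nng (policy_kernel_ext w 0 0))
    (measure_add
      (mseries (fun k : nat =>
         mscale ((jump_time w k < t%:E <= jump_time w k.+1)%E%:R)%:nng
           (policy_kernel_ext w k (t - fine (jump_time w k)))) 0)
      (mscale ((explosion w <= t%:E)%E%:R)%:nng \d_(None : option (borel A)))).

(* m^pi(j|w,t) *)
Definition jump_intensity (w : Omega R S) (t : R) (j : S) : \bar R :=
  (\int[action_law w t]_a
     rate_ext mdp t (xi_left w t) a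
       ([set j] `\` [set k | xi_left w t = Some k]))%E.

Definition is_controlled_law (i : S) (P : probability (Omega R S) R) : Prop :=
  P [set w | xi w 0 = Some i] = 1%E /\ is_compensator P jump_intensity.

Definition mean_cost (w : Omega R S) (t : R) : R :=
  \int[action_law w t]_a cost_ext mdp t (xi w t) a.

Definition mean_rate (w : Omega R S) (t : R) (j : S) : \bar R :=
  (\int[action_law w t]_a rate_ext mdp t (xi w t) a [set j])%E.

Definition cost_exp (w : Omega R S) (t : R) : R :=
  expR (\int[lebesgue_measure]_(v in `[0, t]) mean_cost w v).

Definition psi (phi : R -> S -> R) (w : Omega R S) (t : R) (j : S) : R :=
  cost_exp w t * phi t j.

(* density in t of [psi phi w ^~ j] when phi' is one of phi *)
Definition psi' (phi phi' : R -> S -> R) (w : Omega R S) (t : R) (j : S) : R :=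
  mean_cost w t * cost_exp w t * phi t j + cost_exp w t * phi' t j.

(* psi and psi' are evaluated as 0 at Delta, which is almost surely never
   reached. *)
Definition drift (phi phi' : R -> S -> R) (w : Omega R S) (t : R) : \bar R :=
  ((oapp (psi' phi phi' w t) 0%R (xi w t))%:E +
   signed_sum (fun j => (psi phi w t j)%:E * mean_rate w t j))%E.

Definition terminal_value (phi : R -> S -> R) (T : R) (w : Omega R S) : R :=
  oapp (psi phi w T) 0 (xi w T).

End policies.

Section function_class.
Context (R : realType) dS (S : measurableType dS).
Implicit Types (T : R) (V : S -> R) (phi : R -> S -> R).

Definition abs_continuous T (f : R -> R) : Prop :=
  forall e : R, 0 < e -> exists2 del : R, 0 < del &
    forall (n : nat) (a b : 'I_n -> R),
      (forall k, 0 <= a k <= b k /\ b k <= T) ->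
      trivIset [set: 'I_n] (fun k => `]a k, b k[%classic) ->
      \sum_(k < n) (b k - a k) < del ->
      \sum_(k < n) `|f (b k) - f (a k)| < e.

Definition is_density T (f f' : R -> R) : Prop :=
  lebesgue_measure.-integrable `[0, T] (EFin \o f') /\
  forall t, t \in `[0, T] ->
    f t - f 0 = \int[lebesgue_measure]_(s in `[0, t]) f' s.

Definition is_time_density T phi (phi' : R -> S -> R) : Prop :=
  measurable_fun (`[0, T]%classic `*` [set: S]) (fun x => phi' x.1 x.2) /\
  forall i, is_density T (phi ^~ i) (phi' ^~ i).

Definition weight_bounded T V phi : Prop :=
  (ereal_sup [set (`|phi x.1 x.2| / V x.2)%:E
    | x in `[0%R, T]%classic `*` [set: S]] < +oo)%E.

Definition C1 T V V1 phi : Prop :=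
  [/\ weight_bounded T V phi,
      forall i, abs_continuous T (phi ^~ i)
    & exists2 phi', is_time_density T phi phi' & weight_bounded T V1 phi'].

End function_class.

(* Main.v *)
Require Import Defs.
From mathcomp Require Import all_boot all_order all_algebra.
From mathcomp Require Import all_classical all_reals all_analysis.
From mathcomp Require Import measurable_realfun ring lra.

(** The identity is Dynkin's formula for a multiplicative functional of the path:
    it is proved trajectory by trajectory, and averaged with the compensator.

    Call a trajectory regular when its explosion time is infinite and the
    integral of V1^2 along it up to T is finite.  On a regular trajectory,
    and for each fixed j, psi(w,t,j) has the density psi'(w,t,j) in t
    ([expR_mul_density]).  Hence psi(w,T,xi_T) - phi(0,i) is the time integral of
    psi' along the path, plus the finitely many jumps
    psi(w,T_n,X_n) - psi(w,T_n,X_(n-1)) ([path_identity]).  The positive and the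
    negative parts of the jumps are values of nonnegative integrands that only
    depend on the past of the trajectory; such integrands are predictable
    ([predictable_of_stop]), so the compensator turns the expected sums over the
    jumps into expected time integrals against the jump rates
    ([compensator_formula]).  As q(S|t,i,a) = 0, the gain rate minus the loss rate
    is the sum over j of psi(w,t,j) times the rate to j
    ([signed_sum_compensated]), which is the second term of the drift.  This gives
    the identity ([dynkin_formula]).

    Integrability comes from the weight U = V1^2, whose drift is at most rho1 U.
    Discounted at rate rho1 + 1, it loses on each stage at least what the path
    accumulates of it there, so its expected discounted occupation is at most its
    initial value ([discounted_occupation]).  The jump rates are at most M V,
    hence at most a multiple of U: the expected number of jumps in a bounded time
    is finite, and almost every trajectory is regular ([explosion_ae],
    [regular_path_ae]).  The running cost is controlled by the convexity of the
    exponential: the square of exp(int_0^t |c|) is at most the mean over [0, T] of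
    exp(2 T |c|), which is at most a multiple of U ([left_cost_exp_le]).  Finally
    V^2 <= M1 V1 bounds each term of the drift by a multiple of
    exp(int_0^t c) V1(xi_t), and a b <= a^2 + b^2 bounds the latter by the
    occupation of U ([path_dominated]).

    The state xi_t and its left limit differ at countably many times only, which
    time integrals do not see.  The proof works with the left limit: it is
    constant on the stages ]T_k, T_(k+1)], on which the policy uses its k-th
    kernel, so that measurability, predictability and all the bounds can be
    checked on one stage at a time ([measurable_by_stages]). *)

Set Implicit Arguments.
Unset Strict Implicit.
Unset Printing Implicit Defensive.

Import Order.TTheory GRing.Theory Num.Theory.
Import numFieldNormedType.Exports.

Local Open Scope classical_set_scope.
Local Open Scope ring_scope.

(** * Sums over a countable set, and gluing of measurable functions *)
Section countable_sums.
Context (R : realType) (S : choiceType) (S_countable : countable [set: S]).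

(** An enumeration that skips the numbers without a preimage turns a sum over S
    into a series over nat; linearity, measurability and countable additivity
    are then read off the corresponding facts about series. *)
Lemma countable_enum : exists e : nat -> option S,
  (forall m n j, e m = Some j -> e n = Some j -> m = n) /\
  (forall j, exists n, e n = Some j) /\
  forall F : S -> \bar R, (forall j, 0 <= F j)%E ->
    \esum_(j in [set: S]) F j = (\sum_(0 <= n <oo) oapp F 0 (e n))%E.
Proof.
have /countable_injP [f finj] := S_countable.
have injf : injective f by move=> x y; apply: finj; rewrite inE.
pose e n : option S := if pselect (exists j, f j = n) is left H
  then Some (projT1 (cid H)) else None.
have eP n j : e n = Some j <-> f j = n.
  rewrite /e; case: pselect => [H|H]; split => //.
  - by case=> <-; case: cid.
  - by move=> fj; congr Some; case: cid => x /= fx; apply: injf; rewrite fx.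
  - by move=> fj; case: H; exists j.
exists e; split; [by move=> m n j /eP <- /eP <-|split=> [j|F F0]].
  by exists (f j); apply/eP.
have G0 n : (0 <= oapp F 0 (e n))%E by case: (e n) => /=.
rewrite nneseries_esumT//.
transitivity (\esum_(n in range f) oapp F 0%E (e n)).
  rewrite (@reindex_esum _ _ _ [set: S] (range f) f); last first.
    by apply: inj_bij => x y _ _; exact: injf.
  by apply: eq_esum => j _; rewrite (proj2 (eP (f j) j) erefl).
rewrite esum_mkcond; apply: eq_esum => n _; case: ifPn => //.
rewrite notin_setE => H; case E: (e n) => [j|]//=.
by case: H; exists j => //; apply/eP.
Qed.

Lemma esumZl (F : S -> \bar R) (c : R) : 0 <= c -> (forall j, 0 <= F j)%E ->
  \esum_(j in [set: S]) (c%:E * F j)%E = (c%:E * \esum_(j in [set: S]) F j)%E.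
Proof.
move=> c0 F0; have [e [_ [_ eE]]] := countable_enum.
rewrite !eE//; last by move=> j; rewrite mule_ge0 ?lee_fin.
rewrite -nneseriesZl//; last by move=> n _; case: (e n) => /=.
by apply: eq_eseriesr => n _; case: (e n) => //=; rewrite mule0.
Qed.

Lemma le_esum_pt (F G : S -> \bar R) :
  (forall j, 0 <= F j)%E -> (forall j, F j <= G j)%E ->
  (\esum_(j in [set: S]) F j <= \esum_(j in [set: S]) G j)%E.
Proof. by move=> F0 FG; apply: le_esum => j _. Qed.

Context d (X : measurableType d).

Lemma measurable_esum (F : X -> S -> \bar R) :
  (forall x j, 0 <= F x j)%E ->
  (forall j, measurable_fun setT (F ^~ j)) ->
  measurable_fun setT (fun x => \esum_(j in [set: S]) F x j).
Proof.
move=> F0 mF; have [e [_ [_ eE]]] := countable_enum.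
under eq_fun do rewrite eE//.
apply: ge0_emeasurable_sum => [n x _ _|n _].
  by case: (e n) => /=.
by case: (e n) => [j|] /=; [exact: mF|exact: measurable_cst].
Qed.

Lemma integral_esum (mu : {measure set X -> \bar R}) D (F : X -> S -> \bar R) :
  measurable D ->
  (forall x j, 0 <= F x j)%E ->
  (forall j, measurable_fun setT (F ^~ j)) ->
  (\int[mu]_(x in D) (\esum_(j in [set: S]) F x j) =
   \esum_(j in [set: S]) \int[mu]_(x in D) F x j)%E.
Proof.
move=> mD F0 mF; have [e [_ [_ eE]]] := countable_enum.
rewrite eE; last by move=> j; exact: integral_ge0.
under eq_integral do rewrite eE//.
rewrite integral_nneseries//.
- apply: eq_eseriesr => n _; case: (e n) => //=.
  by rewrite integral0.
- move=> n; case: (e n) => [j|] /=; last exact: measurable_cst.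
  exact: measurable_funTS.
- by move=> n x _; case: (e n) => /=.
Qed.

Lemma charge_esum d' (S' : measurableType d') (nu : {charge set S' -> \bar R})
   (g : S -> set S') : (forall j, measurable (g j)) ->
   trivIset setT g -> (forall j, 0 <= nu (g j))%E ->
  \esum_(j in [set: S]) nu (g j) = nu (\bigcup_j g j).
Proof.
move=> mg tg nu0; have [e [einj [esurj eE]]] := countable_enum.
pose F n := oapp g set0 (e n).
have -> : \bigcup_j g j = \bigcup_n F n.
  apply/seteqP; split => x.
    move=> [j _ gx].
    have [n en] := esurj j.
    by exists n => //; rewrite /F en.
  by move=> [n _]; rewrite /F; case: (e n) => //= j gx; exists j.
have mF n : measurable (F n) by rewrite /F; case: (e n) => //=.
have tF : trivIset setT F.
  apply/trivIsetP => m n _ _ mn; rewrite /F.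
  case em : (e m) => [j|]/=; last by rewrite set0I.
  case en : (e n) => [k|]/=; last by rewrite setI0.
  move/trivIsetP : tg; apply => //; apply/eqP => jk.
  by move/eqP : mn; apply; apply: (einj m n j) => //; rewrite jk.
rewrite eE//; apply/cvg_lim => //.
have := @charge_semi_sigma_additive _ _ _ nu F mF tF (bigcup_measurable (fun n _ => mF n)).
suff -> : (fun n : nat => \sum_(0 <= i < n) oapp (fun j => nu (g j)) 0%E (e i))%E =
    (fun n : nat => \sum_(0 <= i < n) nu (F i))%E by [].
apply/funext => n; apply: eq_bigr => k _; rewrite /F; case: (e k) => //=.
by rewrite charge0.
Qed.

End countable_sums.

Section gluing.
Context d d' (X : measurableType d) (Y : measurableType d').

(** The pieces of the cover may overlap: only the preimages of measurable sets
    are glued. *)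
Lemma measurable_countable_cover (I : Type) (E : I -> set X) (f : X -> Y) :
  countable [set: I] -> (forall i, measurable (E i)) ->
  (forall x, exists i, E i x) ->
  (forall i, exists2 g : X -> Y, measurable_fun setT g & forall x, E i x -> f x = g x) ->
  measurable_fun setT f.
Proof.
move=> cI mE cov H _ B mB; rewrite setTI.
have -> : f @^-1` B = \bigcup_i (E i `&` f @^-1` B).
  apply/seteqP; split => [x Bx|x [i _ []]//].
  by have [i Ei] := cov x; exists i.
apply: countable_bigcupT_measurable => // i.
have [g mg fg] := H i.
have -> : E i `&` f @^-1` B = E i `&` g @^-1` B.
  by apply/seteqP; split => x [Ex] /=; rewrite fg.
by apply: measurableI => //; rewrite -[X in measurable X]setTI; exact: mg.
Qed.

Lemma measurable_by_value (I : Type) (o : X -> option I) (f : X -> Y) :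
  countable [set: I] -> (forall i, measurable [set x | o x = Some i]) ->
  (forall s, exists2 g : X -> Y, measurable_fun setT g & forall x, o x = s -> f x = g x) ->
  measurable_fun setT f.
Proof.
move=> cI mo H; apply: (measurable_countable_cover (E := fun s => [set x | o x = s])) => //.
- have /countable_injP [h hinj] := cI; apply/countable_injP.
  exists (fun s : option I => if s is Some i then (h i).+1 else 0%N).
  by move=> [i|] [j|] //= _ _ [] /hinj; rewrite !inE => ->.
- case=> [i|]; first exact: mo.
  rewrite (_ : [set x | o x = None] = ~` \bigcup_i [set x | o x = Some i]).
    by apply: measurableC; exact: countable_bigcupT_measurable.
  apply/seteqP; split => x /=; first by move=> H' [i _] /=; rewrite H'.
  move=> H'; case ox : (o x) => [i|] //.
  by exfalso; apply: H'; exists i.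
- by move=> x; exists (o x).
Qed.

End gluing.

Lemma measurable_fun_discrete_snd d d' (X : measurableType d)
  (Y : measurableType d') dS (S : measurableType dS) (f : X * S -> Y) :
  countable [set: S] -> (forall B : set S, measurable B) ->
  (forall j, measurable_fun setT (fun x => f (x, j))) -> measurable_fun setT f.
Proof.
move=> cS mS mf.
apply: (measurable_countable_cover (E := fun j => [set x : X * S | x.2 = j])) => //.
- move=> j; have -> : [set x : X * S | x.2 = j] = setT `*` [set j].
    by apply/seteqP; split => -[x k]//= [].
  exact: measurableX.
- by move=> x; exists x.2.
- move=> j; exists (fun x => f (x.1, j)).
    exact: (measurableT_comp (mf j) measurable_fst).
  by move=> [x k] /= ->.
Qed.

Lemma nneseries_single (R : realType) (f : nat -> \bar R) m k : (m <= k)%N ->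
  (forall n, n != k -> f n = 0%E) -> (0 <= f k)%E ->
  (\sum_(m <= n <oo) f n)%E = f k.
Proof.
move=> mk f0 fk.
have fge0 n : (0 <= f n)%E by case: (eqVneq n k) => [->//|/f0 ->].
rewrite (nneseries_split m (k.+1 - m))// subnKC ?leqW//.
rewrite big_nat_recr//= big_nat big1; last first.
  by move=> i /andP[_ ik]; rewrite f0 // neq_ltn ik.
rewrite add0e eseries0 ?adde0// => n kn _; rewrite f0// neq_ltn orbC.
by move: kn => /= ->.
Qed.

Section off_countable.
Context (R : realType).
Notation mu := (@lebesgue_measure R).

Lemma measurable_off_countable d (Y : measurableType d) (D C : set R) (f g : R -> Y) :
  countable C -> measurable D -> measurable_fun D g ->
  (forall x, D x -> ~ C x -> f x = g x) -> measurable_fun D f.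
Proof.
move=> cC mD mg fg _ B mB.
have mC A : A `<=` C -> measurable A.
  move=> AC; apply: countable_measurable => //.
  exact: (sub_countable (subset_card_le AC)).
have -> : D `&` f @^-1` B = ((D `&` g @^-1` B) `\` C) `|` (D `&` f @^-1` B `&` C).
  apply/seteqP; split => x.
    move=> [Dx Bx]; have [Cx|Cx] := pselect (C x); [by right|left].
    by split => //; split=> //; move: Bx => /=; rewrite fg.
  move=> [[[Dx Bx] Cx]|[[]]//]; split => //=; rewrite fg//.
apply: measurableU; first by apply: measurableD; [exact: mg|exact: mC].
by apply: mC => x [].
Qed.

Lemma ae_off_countable (D C : set R) (Y : Type) (f g : R -> Y) :
  countable C -> (forall x, D x -> ~ C x -> f x = g x) ->
  {ae mu, forall x, D x -> f x = g x}.
Proof.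
move=> cC fg; exists C; split.
- exact: countable_measurable.
- exact: countable_lebesgue_measure0.
- by move=> x /= H; apply: contrapT => Cx; apply: H => Dx; exact: fg.
Qed.

(** Time integrals do not see the jump times, so that a state may be replaced
    by its left limit below them. *)
Lemma integral_off_countable (D C : set R) (f g : R -> \bar R) :
  countable C -> measurable D -> measurable_fun D g ->
  (forall x, D x -> ~ C x -> f x = g x) ->
  (\int[mu]_(x in D) f x = \int[mu]_(x in D) g x)%E.
Proof.
move=> cC mD mg fg; apply: ae_eq_integral => //.
  exact: measurable_off_countable fg.
exact: ae_off_countable fg.
Qed.

End off_countable.

(** * Densities: a chain rule for the exponential of an integral *)
Section absolute_continuity.
Context (R : realType).
Notation mu := (@lebesgue_measure R).

(** Cutting [s, t] at a point where N takes its mean value halves the bound on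
    the increment of D; after n cuts the bound is divided by 2 ^ n.  This settles
    equalities between primitives without differentiation almost everywhere. *)
Lemma eq_of_quadratic_increments (D N : R -> R) (C a b : R) : a <= b ->
  {within `[a, b], continuous N} ->
  (forall s t : R, a <= s -> s <= t -> t <= b ->
     `|D t - D s| <= C * (N t - N s) ^+ 2) ->
  (forall s t : R, a <= s -> s <= t -> t <= b -> N s <= N t) ->
  D a = D b.
Proof.
move=> ab cN DN Nle.
have H n : forall s t : R, a <= s -> s <= t -> t <= b ->
     `|D t - D s| * 2 ^+ n <= C * (N t - N s) ^+ 2.
  elim: n => [|n IH] s t as_ st tb; first by rewrite expr0 mulr1 DN.
  have [m /itvP ms Nm] : exists2 c, c \in `[s, t] & N c = (N s + N t) / 2.
    apply: IVT => //.
      apply: continuous_subspaceW cN; apply: subset_itv; rewrite bnd_simp//.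
    have := Nle s t as_ st tb => Nst.
    by rewrite (min_l Nst) (max_r Nst); lra.
  have sm : s <= m by rewrite ms.
  have mt : m <= t by rewrite ms.
  have H1 := IH s m as_ sm (le_trans mt tb).
  have H2 := IH m t (le_trans as_ sm) mt tb.
  have H3 : `|D t - D s| <= `|D t - D m| + `|D m - D s|.
    by rewrite -[D t - D s](subrKA (D m)) ler_normD.
  have p2 : 0 <= 2 ^+ n.+1 :> R by rewrite exprn_ge0.
  have H4 := ler_wpM2r p2 H3; apply: (le_trans H4); rewrite mulrDl (exprS 2 n).
  rewrite Nm in H1 H2.
  have -> : C * (N t - N s) ^+ 2 = 2 * (C * (N t - (N s + N t) / 2) ^+ 2)
     + 2 * (C * ((N s + N t) / 2 - N s) ^+ 2) by field.
  by apply: lerD; rewrite mulrCA ler_wpM2l.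
apply: contrapT => /eqP; rewrite eq_sym -subr_eq0 -normr_gt0 => D0.
set x := `|_| in D0; set K := C * (N b - N a) ^+ 2.
have Hn n : x * n%:R <= K.
  apply: le_trans (H n a b _ ab _) => //; rewrite ler_wpM2l ?(ltW D0)//.
  by rewrite -(natrX _ 2 n) ler_nat ltnW// ltn_expl.
have K0 : 0 <= K by have := Hn 0%N; rewrite mulr0.
have := Hn (Num.bound (K / x)); rewrite leNgt => /negP; apply.
rewrite mulrC -ltr_pdivrMr//; apply: archi_boundP.
by rewrite divr_ge0// ltW.
Qed.

Lemma expR_lipschitz (a b L : R) : a <= L -> b <= L ->
  `|expR a - expR b| <= expR L * `|a - b|.
Proof.
wlog ba : a b / b <= a => [H aL bL|aL _].
  have [ba|/ltW ab] := leP b a; first exact: H.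
  by rewrite distrC (distrC a); exact: H.
rewrite !ger0_norm ?subr_ge0 ?ler_expR//.
have -> : expR a - expR b = expR a * (1 - expR (b - a)).
  by rewrite mulrBr mulr1 -expRD subrKC.
have := expR_ge1Dx (b - a) => H.
apply: (@le_trans _ _ (expR a * (a - b))).
  by rewrite ler_wpM2l ?expR_ge0//; lra.
by rewrite ler_wpM2r ?subr_ge0// ler_expR.
Qed.

Lemma expR_taylor1 (x : R) : `|expR x - 1 - x| <= x ^+ 2 * expR `|x|.
Proof.
have h1 := expR_ge1Dx x.
have h2 : expR x - 1 <= x * expR x.
  have := expR_ge1Dx (- x) => h.
  have := ler_wpM2l (expR_ge0 x) h; rewrite expRN divff ?gt_eqF ?expR_gt0//; lra.
rewrite ger0_norm; last by lra.
apply: (@le_trans _ _ (x * (expR x - 1))); first by lra.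
apply: le_trans (ler_norm _) _; rewrite normrM expr2 -[x * x](real_normK (num_real _)).
rewrite expr2 -mulrA ler_wpM2l//.
have := @expR_lipschitz x 0 `|x|; rewrite expR0 subr0 mulrC; apply => //.
exact: ler_norm.
Qed.

Lemma Rintegral_increment (g : R -> R) (T s t : R) :
  mu.-integrable `[0, T] (EFin \o g) -> 0 <= s -> s <= t -> t <= T ->
  \int[mu]_(x in `[0, t]) g x - \int[mu]_(x in `[0, s]) g x =
  \int[mu]_(x in `]s, t]) g x.
Proof.
move=> ig s0 st tT; rewrite Rintegral_itvB//.
by apply: integrableS ig => //; apply: subset_itv; rewrite bnd_simp.
Qed.

Lemma integrable_sub_oc (g : R -> R) (T s t : R) :
  mu.-integrable `[0, T] (EFin \o g) -> 0 <= s -> t <= T ->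
  mu.-integrable `]s, t] (EFin \o g).
Proof.
by move=> ig s0 tT; apply: integrableS ig => //; apply: subset_itv; rewrite bnd_simp.
Qed.

Lemma density_continuous (T : R) (f f' : R -> R) : 0 <= T ->
  is_density T f f' -> {within `[0, T], continuous f}.
Proof.
move=> T0 [if' ff'].
have : {within `[0, T], continuous (fun t => f 0 + \int[mu]_(s in `[0, t]) f' s)}.
  move=> x; apply: cvgD; first exact: cvg_cst.
  exact: (parameterized_integral_continuous T0 if').
apply: subspace_eq_continuous => t; rewrite inE /= => tT.
by rewrite /from_subspace -(ff' t tT) subrKC.
Qed.

Lemma density_measurable (T : R) (f f' : R -> R) : 0 <= T ->
  is_density T f f' -> measurable_fun `[0, T] f.
Proof.
move=> T0 H; apply: subspace_continuous_measurable_fun => //.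
exact: density_continuous H.
Qed.

Lemma density_split (c eu fu es fs f' : R) :
  c * (eu * fu - es * fs) + (eu - es) * f' =
  c * eu * fu + eu * f' - (es * fs * c + es * f').
Proof. ring. Qed.

Lemma mulrBB (eu fu es fs : R) :
  eu * fu - es * fs = (eu - es) * fu + es * (fu - fs).
Proof. ring. Qed.

Lemma taylor_split (es dh fs ft D k : R) :
  es * D * ft - es * fs - (es * fs * dh + es * (ft - fs) + k) =
  es * ((D - 1 - dh) * ft + dh * (ft - fs)) - k.
Proof. ring. Qed.

Lemma distribute_bound (E F d : R) :
  E * (d ^+ 2 * E * F + d * d) = (E * E * F + E) * d ^+ 2.
Proof. ring. Qed.

Lemma cross_le (a b y z u v : R) : a * y <= a * u -> z * b <= v * b ->
  0 <= u * b -> 0 <= v * a -> a * y + z * b <= (u + v) * (a + b).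
Proof. lra. Qed.

Section chain_rule.
Variables (T : R) (c f f' : R -> R).
Hypotheses (T0 : 0 <= T) (ic : mu.-integrable `[0, T] (EFin \o c))
  (df : is_density T f f').

Let n (t : R) : R := `|c t| + `|f' t|.
Let N (t : R) : R := \int[mu]_(x in `[0, t]) n x.
Let h (t : R) : R := \int[mu]_(x in `[0, t]) c x.
Let e (t : R) : R := expR (h t).
Let g (t : R) : R := c t * e t * f t + e t * f' t.

Let if' : mu.-integrable `[0, T] (EFin \o f'). Proof. by case: df. Qed.

Let i_n : mu.-integrable `[0, T] (EFin \o n).
Proof. by exact: (integrableD _ (integrable_norm ic) (integrable_norm if')). Qed.

Let N_incr (s t : R) : 0 <= s -> s <= t -> t <= T -> N s <= N t.
Proof.
move=> s0 st tT; rewrite -subr_ge0 (Rintegral_increment i_n)//.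
by apply: Rintegral_ge0 => x _; rewrite addr_ge0.
Qed.

Let N0 : N 0 = 0. Proof. by rewrite /N set_itv1 Rintegral_set1. Qed.

Let increment_le (k : R -> R) (s t : R) : mu.-integrable `[0, T] (EFin \o k) ->
  (forall x, `|k x| <= n x) -> 0 <= s -> s <= t -> t <= T ->
  `|\int[mu]_(x in `]s, t]) k x| <= N t - N s.
Proof.
move=> ik kn s0 st tT; rewrite (Rintegral_increment i_n)//.
apply: le_trans (le_normr_Rintegral _ (integrable_sub_oc ik s0 tT)) _ => //.
apply: le_Rintegral => //.
- exact: integrable_norm (integrable_sub_oc ik s0 tT).
- exact: integrable_sub_oc i_n s0 tT.
Qed.

Let h_incr (s t : R) : 0 <= s -> s <= t -> t <= T -> `|h t - h s| <= N t - N s.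
Proof.
move=> s0 st tT; rewrite (Rintegral_increment ic)// increment_le// => x.
by rewrite lerDl.
Qed.

Let in0T (s : R) : 0 <= s -> s <= T -> s \in `[0, T].
Proof. by rewrite in_itv /= => -> ->. Qed.

Let f_incrE (s t : R) : 0 <= s -> s <= t -> t <= T ->
  f t - f s = \int[mu]_(x in `]s, t]) f' x.
Proof.
move=> s0 st tT; rewrite -(Rintegral_increment if')//; case: df => _ ff'.
rewrite -!ff' ?in0T ?(le_trans s0 st) ?(le_trans st tT)//.
by rewrite opprB addrA subrK.
Qed.

Let f_incr (s t : R) : 0 <= s -> s <= t -> t <= T -> `|f t - f s| <= N t - N s.
Proof.
by move=> s0 st tT; rewrite f_incrE// increment_le// => x; rewrite lerDr.
Qed.

(* F and E bound f and e on [0, T]. *)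
Let F : R := `|f 0| + N T.
Let E : R := expR (N T).

Let F_ge0 : 0 <= F.
Proof. by rewrite addr_ge0// -N0 N_incr. Qed.

Let fF (s : R) : 0 <= s -> s <= T -> `|f s| <= F.
Proof.
move=> s0 sT; have := f_incr (lexx 0) s0 sT; rewrite N0 subr0.
have := N_incr s0 sT (lexx T).
have : `|f s| <= `|f 0| + `|f s - f 0|.
  by rewrite -[f s](subrKC (f 0)); apply: le_trans (ler_normD _ _) _; rewrite subrKC.
rewrite /F; lra.
Qed.

Let hN (s : R) : 0 <= s -> s <= T -> h s <= N T.
Proof.
move=> s0 sT; have := h_incr (lexx 0) s0 sT; rewrite N0 subr0.
rewrite {2}/h set_itv1 Rintegral_set1 subr0 => /(le_trans (ler_norm _)).
by move/le_trans; apply; exact: N_incr.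
Qed.

Let eE (s : R) : 0 <= s -> s <= T -> e s <= E.
Proof. by move=> s0 sT; rewrite ler_expR hN. Qed.

Let mf : measurable_fun `[0, T] f.
Proof. exact: density_measurable df. Qed.

Let me : measurable_fun `[0, T] e.
Proof.
apply: measurableT_comp => //; apply: subspace_continuous_measurable_fun => //.
exact: (parameterized_integral_continuous T0 ic).
Qed.

Let mc : measurable_fun `[0, T] c.
Proof. by apply/measurable_EFinP; exact: (measurable_int mu). Qed.

Let mf' : measurable_fun `[0, T] f'.
Proof. by apply/measurable_EFinP; exact: (measurable_int mu). Qed.

Lemma expR_mul_density_integrable : mu.-integrable `[0, T] (EFin \o g).
Proof.
have mg : measurable_fun `[0, T] g.
  by apply: measurable_funD; apply: measurable_funM => //; exact: measurable_funM.
apply: (@le_integrable _ _ _ mu _ _ _ (EFin \o (fun x => (E * F + E) * n x))) => //.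
- exact/measurable_EFinP.
- move=> x /=; rewrite in_itv /= => /andP[x0 xT]; rewrite lee_fin.
  have n0 : 0 <= n x by rewrite addr_ge0.
  have E0 : 0 <= E by exact: expR_ge0.
  have e0 : 0 <= e x by exact: expR_ge0.
  rewrite [leRHS]ger0_norm ?mulr_ge0 ?addr_ge0 ?mulr_ge0//.
  apply: le_trans (ler_normD _ _) _; rewrite !normrM (ger0_norm e0) mulrDl.
  apply: lerD.
    rewrite -mulrA mulrC; apply: ler_pM => //; first by rewrite mulr_ge0.
      by apply: ler_pM => //; [exact: eE|exact: fF].
    by rewrite lerDl.
  by apply: ler_pM => //; [exact: eE|rewrite lerDr].
- exact: (integrableZl _ (E * F + E) i_n).
Qed.

Let D (t : R) : R := e t * f t - \int[mu]_(x in `[0, t]) g x.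

Let e_incr (s t : R) : 0 <= s -> s <= t -> t <= T -> `|e t - e s| <= E * (N t - N s).
Proof.
move=> s0 st tT; apply: le_trans (expR_lipschitz (hN _ _) (hN _ _)) _ => //.
- exact: le_trans st.
- exact: le_trans tT.
by rewrite ler_wpM2l ?expR_ge0// h_incr.
Qed.

Let D_incr (s t : R) : 0 <= s -> s <= t -> t <= T ->
  `|D t - D s| <= ((E * E * F + E) + ((F + 1) * E + E)) * (N t - N s) ^+ 2.
Proof.
move=> s0 st tT.
have sT := le_trans st tT; have t0 := le_trans s0 st.
have E0 : 0 <= E by exact: expR_ge0.
set dN := N t - N s.
have dN0 : 0 <= dN by rewrite subr_ge0 N_incr.
have gE x : g x = c x * e x * f x + e x * f' x by [].
have eD : e t = e s * expR (h t - h s) by rewrite /e -expRD subrKC.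
have hE : h t - h s = \int[mu]_(x in `]s, t]) c x by exact: Rintegral_increment ic _ _ _.
have NE : dN = \int[mu]_(x in `]s, t]) n x by exact: Rintegral_increment i_n _ _ _.
have DE : D t - D s = e t * f t - e s * f s - \int[mu]_(x in `]s, t]) g x.
  have alg (a b x y z : R) : x - y = z -> (a - x) - (b - y) = a - b - z by move=> <-; clear; ring.
  exact: alg (Rintegral_increment expR_mul_density_integrable s0 st tT).
have ig' := integrable_sub_oc expR_mul_density_integrable s0 tT.
have in' := integrable_sub_oc i_n s0 tT.
have e_ge0 x : 0 <= e x by exact: expR_ge0.
have expN : expR dN <= E by rewrite ler_expR /dN lerBlDr (le_trans (N_incr t0 tT (lexx T)))// lerDl -N0 N_incr.
have nE x : n x = `|c x| + `|f' x| by [].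
clearbody D g e h.
have dNE : dN = N t - N s by [].
clearbody dN E.
pose dh : R := h t - h s; pose dlf : R := f t - f s.
have dhN : `|dh| <= dN by rewrite dNE; exact: h_incr.
have dfN : `|dlf| <= dN by rewrite dNE; exact: f_incr.
pose k (x : R) : R := c x * (e x * f x - e s * f s) + (e x - e s) * f' x.
have intg : \int[mu]_(x in `]s, t]) g x =
  e s * f s * dh + e s * dlf + \int[mu]_(x in `]s, t]) k x.
  have ic' := integrable_sub_oc ic s0 tT.
  have if'' := integrable_sub_oc if' s0 tT.
  have i1 : mu.-integrable `]s, t] (EFin \o (fun x => e s * f s * c x)).
    exact: (integrableZl _ (e s * f s) ic').
  have i2 : mu.-integrable `]s, t] (EFin \o (fun x => e s * f' x)).
    exact: (integrableZl _ (e s) if'').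
  have i12 : mu.-integrable `]s, t] (EFin \o (fun x => e s * f s * c x + e s * f' x)).
    exact: (integrableD _ i1 i2).
  have -> : \int[mu]_(x in `]s, t]) k x =
    \int[mu]_(x in `]s, t]) (g x - (e s * f s * c x + e s * f' x)).
    by apply: eq_Rintegral => x _; rewrite /k gE density_split.
  rewrite (RintegralB _ ig' i12)// (RintegralD _ i1 i2)//.
  rewrite !RintegralZl//.
  by rewrite -f_incrE// -hE [RHS]addrC subrK.
have kle : `|\int[mu]_(x in `]s, t]) k x| <= ((F + 1) * E + E) * dN ^+ 2.
  have ik : mu.-integrable `]s, t] (EFin \o k).
    have i12 : mu.-integrable `]s, t] (EFin \o (fun x => e s * f s * c x + e s * f' x)).
      exact: (integrableD _
        (integrableZl _ (e s * f s) (integrable_sub_oc ic s0 tT))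
        (integrableZl _ (e s) (integrable_sub_oc if' s0 tT))).
    apply: eq_integrable (integrableB _ ig' i12) => // x _.
    by rewrite /= -EFinB; congr EFin; rewrite /k gE density_split.
  apply: le_trans (le_normr_Rintegral _ ik) _ => //.
  apply: (@le_trans _ _ (\int[mu]_(x in `]s, t]) (((F + 1) * E + E) * dN * n x))).
    apply: le_Rintegral => //.
    - exact: integrable_norm ik.
    - exact: (integrableZl _ (((F + 1) * E + E) * dN) (integrable_sub_oc i_n s0 tT)).
    - move=> x; rewrite /= in_itv /= => /andP[sx xt].
      have x0 : 0 <= x by rewrite (le_trans s0)// ltW.
      have xT := le_trans xt tT.
      have exs : `|e x - e s| <= E * dN.
        apply: le_trans (e_incr s0 (ltW sx) xT) _; rewrite ler_wpM2l//.
        by rewrite dNE lerD2r N_incr.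
      have fxs : `|f x - f s| <= dN.
        by apply: le_trans (f_incr s0 (ltW sx) xT) _; rewrite dNE lerD2r N_incr.
      have efxs : `|e x * f x - e s * f s| <= (F + 1) * E * dN.
        rewrite mulrBB.
        apply: le_trans (ler_normD _ _) _; rewrite !normrM (ger0_norm (e_ge0 _)).
        have h2 := ler_pM (normr_ge0 _) (normr_ge0 _) exs (fF x0 xT).
        have h1 := ler_pM (e_ge0 _) (normr_ge0 _) (eE s0 sT) fxs.
        apply: le_trans (lerD h2 h1) _.
        by rewrite mulrDl mul1r mulrDl [F * E]mulrC mulrAC.
      rewrite mulrDl nE; apply: le_trans (ler_normD _ _) _; rewrite !normrM.
      apply: cross_le; first exact: ler_wpM2l.
      - exact: ler_wpM2r.
      - by rewrite !mulr_ge0// addr_ge0.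
      - by rewrite !mulr_ge0.
  by rewrite RintegralZl// -NE expr2 mulrA.
have -> : D t - D s = e s * ((expR dh - 1 - dh) * f t + dh * dlf) - \int[mu]_(x in `]s, t]) k x.
  by rewrite DE intg eD taylor_split.
apply: le_trans (ler_normB _ _) _; rewrite [leRHS]mulrDl; apply: lerD => //.
rewrite normrM (ger0_norm (e_ge0 _)).
have tay : `|expR dh - 1 - dh| <= dN ^+ 2 * E.
  apply: le_trans (expR_taylor1 _) _; apply: ler_pM => //; rewrite ?expR_ge0 ?sqr_ge0//.
    by rewrite -real_normK ?num_real// ler_sqr// nnegrE.
  by rewrite (le_trans _ expN)// ler_expR.
have H1 : `|(expR dh - 1 - dh) * f t| <= dN ^+ 2 * E * F.
  by rewrite normrM; apply: ler_pM => //; exact: fF.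
have H2 : `|dh * dlf| <= dN * dN by rewrite normrM; exact: ler_pM.
apply: (@le_trans _ _ (E * (dN ^+ 2 * E * F + dN * dN))); last by rewrite distribute_bound.
apply: ler_pM => //; first exact: eE.
exact: le_trans (ler_normD _ _) (lerD H1 H2).
Qed.

(** The increment of e f minus the integral of g is of second order in the
    increment of N, the primitive of |c| + |f'|: expand the exponential to first
    order, and replace e and f by their values at the left end in the integral of
    g.  Hence this difference is constant. *)
Lemma expR_mul_density : is_density T (fun t => e t * f t) g.
Proof.
split; first exact: expR_mul_density_integrable.
move=> t; rewrite in_itv /= => /andP[t0 tT].
have : D 0 = D t.
  apply: (@eq_of_quadratic_increments D N _ 0 t) => //.
  - apply: (@continuous_subspaceW _ _ _ `[0, T]).
      by apply: subset_itv; rewrite bnd_simp.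
    exact: (parameterized_integral_continuous T0 i_n).
  - by move=> s r s0 sr rt; apply: D_incr => //; exact: le_trans tT.
  - by move=> s r s0 sr rt; apply: N_incr => //; exact: le_trans tT.
by rewrite /D set_itv1 Rintegral_set1 subr0 => ->; rewrite opprB subrKC.
Qed.

End chain_rule.

End absolute_continuity.

Section integral_abs_continuous.
Context (R : realType).
Notation mu := (@lebesgue_measure R).

(** Continuity of the integral of |f'| with respect to the measure of the domain,
    on a union of disjoint intervals. *)
Lemma density_abs_continuous (T : R) (f f' : R -> R) :
  is_density T f f' -> abs_continuous T f.
Proof.
move=> [if' ff'] eps eps0; pose g x := `|(f' \_ `[0, T]) x|.
have ig : mu.-integrable setT (EFin \o (f' \_ `[0, T])).
  have [+ _] := integrable_mkcond (mu := mu) (EFin \o f') (measurable_itv `[0, T]).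
  by rewrite restrict_EFin; apply.
have mg : measurable_fun setT (EFin \o g).
  by apply/measurable_EFinP; apply: measurableT_comp => //; apply/measurable_EFinP; exact: measurable_int ig.
have [d [d0 Hd]] := integral_normr_continuous ig eps0.
exists d => // n a b ab tab sab; pose I k := `]a k, b k[%classic.
pose A := \big[setU/set0]_(k <- index_enum 'I_n) I k.
have mA : measurable A by apply: bigsetU_measurable => k _; exact: measurable_itv.
have bigE (h : R -> \bar R) : measurable_fun setT h -> (forall x, 0 <= h x)%E ->
    (\int[mu]_(x in A) h x = \sum_(k < n) \int[mu]_(x in I k) h x)%E.
  move=> mh h0; rewrite ge0_integral_bigsetU//.
  - by move=> k; exact: measurable_itv.
  - exact: index_enum_uniq.
  - by apply: sub_trivIset tab => k.
  - exact: measurable_funTS.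
have muI k : mu (I k) = (b k - a k)%:E.
  have [/andP[_]] := ab k; rewrite le_eqVlt lebesgue_measure_itv/= lte_fin.
  by move=> /predU1P[->|->]; rewrite ?ltxx ?subrr.
have muA : mu A = (\sum_(k < n) (b k - a k))%:E.
  rewrite -[mu A]mul1e -(integral_cst mu mA 1%E) bigE// -sumEFin.
  by apply: eq_bigr => k _; rewrite (integral_cst mu (measurable_itv _)) mul1e; exact: muI.
have muAd : (mu A < d%:E)%E by rewrite muA lte_fin.
have := Hd A mA muAd; apply: le_lt_trans.
have iA : mu.-integrable A (EFin \o g).
  apply: integrableS (integrable_norm ig) => //.
rewrite -lee_fin -sumEFin /Rintegral fineK; last exact: (integrable_fin_num _ iA).
rewrite -[leRHS]/(\int[mu]_(x in A) (EFin \o g) x)%E bigE//; last by move=> x; rewrite lee_fin /g.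
apply: lee_sum => k _; have [/andP[a0 akb] bT] := ab k.
have -> : f (b k) - f (a k) = \int[mu]_(x in `]a k, b k]) f' x.
  rewrite -(Rintegral_increment if')// -!ff' ?in_itv/= ?a0 ?bT ?(le_trans a0 akb) ?(le_trans akb bT)//.
  by rewrite opprB addrA subrK.
have iab := integrable_sub_oc if' a0 bT.
apply: (@le_trans _ _ (\int[mu]_(x in `]a k, b k]) `|f' x|)%:E).
  by rewrite lee_fin; exact: le_normr_Rintegral.
rewrite /Rintegral fineK; last exact: (integrable_fin_num _ (integrable_norm iab)).
rewrite /I integral_itv_bndo_bndc; last exact: measurable_funTS.
rewrite le_eqVlt; apply/orP; left; apply/eqP.
apply: eq_integral => x; rewrite inE /= in_itv/= => /andP[ax xb].
rewrite /g patchE mem_set//= in_itv/= (le_trans a0 (ltW ax)).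
by rewrite (le_trans xb).
Qed.

End integral_abs_continuous.

(** * Trajectories and their stages *)
Section trajectories.
Context (R : realType) dS (S : measurableType dS).
Implicit Types (w : Omega R S) (t : R) (k n m : nat).

(** Both kinds of trajectories at once: a coordinate is a genuine jump, or it is
    trivial together with all the later ones. *)
Lemma coord_dichotomy w n :
  (exists2 th : R, 0 < th & exists j, (sval w).2 n = (th%:E, Some j)) \/
  (forall m, (n <= m)%N -> (sval w).2 m = (+oo%E, None)).
Proof.
case: (svalP w) => [H|[k [H1 H2]]]; first by left; exact: H.
have [nk|kn] := ltnP n k; first by left; exact: H1.
by right=> m nm; apply: H2; exact: leq_trans nm.
Qed.

Lemma sojourn_gt0 w n : (0 < sojourn w n)%E.
Proof.
rewrite /sojourn; case: (coord_dichotomy w n) => [[th th0 [j ->]]|/(_ n (leqnn n)) ->] //=.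
Qed.

Lemma jump_time0 w : jump_time w 0 = 0%E.
Proof. by rewrite /jump_time big_ord0. Qed.

Lemma jump_timeS w k : jump_time w k.+1 = (jump_time w k + sojourn w k)%E.
Proof. by rewrite /jump_time big_ord_recr. Qed.

Lemma jump_time_ge0 w k : (0 <= jump_time w k)%E.
Proof. by apply: sume_ge0 => i _; exact/ltW/sojourn_gt0. Qed.

Lemma jump_time_leS w k : (jump_time w k <= jump_time w k.+1)%E.
Proof. by rewrite jump_timeS leeDl// ltW// sojourn_gt0. Qed.

Lemma le_jump_time w m n : (m <= n)%N -> (jump_time w m <= jump_time w n)%E.
Proof.
move=> /subnK <-; elim: (n - m)%N => [|k IH]; first by rewrite add0n.
by rewrite addSn (le_trans IH)// jump_time_leS.
Qed.

Lemma jump_time_finE w k : (jump_time w k < +oo)%E ->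
  jump_time w k = (fine (jump_time w k))%:E.
Proof. by move=> H; rewrite fineK// ge0_fin_numE// jump_time_ge0. Qed.

Lemma jump_time_ltS w k : (jump_time w k < +oo)%E ->
  (jump_time w k < jump_time w k.+1)%E.
Proof.
by move=> H; rewrite jump_timeS (jump_time_finE H) lteDl// sojourn_gt0.
Qed.

Lemma lt_jump_time w m n : (m < n)%N -> (jump_time w m < +oo)%E ->
  (jump_time w m < jump_time w n)%E.
Proof. by move=> mn H; rewrite (lt_le_trans (jump_time_ltS H))// le_jump_time. Qed.

Lemma mark_some w k : (jump_time w k < +oo)%E -> exists i, mark w k = Some i.
Proof.
case: k => [|k]; first by exists (initial w).
rewrite jump_timeS /sojourn /=.
case: (coord_dichotomy w k) => [[th th0 [j ->]]|/(_ k (leqnn k)) ->] /=; first by exists j.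
by rewrite addey// -ltNye (lt_le_trans _ (jump_time_ge0 w k)).
Qed.

Lemma coord_before w k n : (jump_time w k < +oo)%E -> (n < k)%N ->
  exists2 th : R, 0 < th & exists j, (sval w).2 n = (th%:E, Some j).
Proof.
move=> H nk; case: (coord_dichotomy w n) => // /(_ n (leqnn n)) E.
have := le_lt_trans (le_jump_time w nk) H.
rewrite jump_timeS /sojourn E /= addey// -ltNye (lt_le_trans _ (jump_time_ge0 w n))//.
Qed.

Lemma jump_time_le_explosion w k : (jump_time w k <= explosion w)%E.
Proof.
rewrite /explosion (cvg_lim _ (ereal_nondecreasing_cvgn _))//.
  by apply: ereal_sup_ubound; exists k.
by move=> m n; exact: le_jump_time.
Qed.

Lemma explosion_le w (x : \bar R) : (forall k, (jump_time w k <= x)%E) ->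
  (explosion w <= x)%E.
Proof.
move=> H; rewrite /explosion (cvg_lim _ (ereal_nondecreasing_cvgn _))//.
  by apply: ge_ereal_sup => _ [k _ <-].
by move=> m n; exact: le_jump_time.
Qed.

(** The n-th stage is open on the left and closed on the right, as for the
    predictable sigma-algebra: throughout it the left limit of the state is the
    n-th mark, and the policy uses its n-th kernel. *)
Definition stage w k t : bool := (jump_time w k < t%:E <= jump_time w k.+1)%E.

Lemma stage_gt0 w k t : stage w k t -> 0 < t.
Proof.
by move=> /andP[H _]; rewrite -lte_fin (le_lt_trans (jump_time_ge0 w k)).
Qed.

Lemma stage_finite w k t : stage w k t -> (jump_time w k < +oo)%E.
Proof. by move=> /andP[H _]; rewrite (lt_trans H)// ltry. Qed.

Lemma stage_lt_explosion w k t : stage w k t -> (t%:E < explosion w)%E.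
Proof.
move=> /andP[_]; rewrite le_eqVlt => /predU1P[tE|H]; last first.
  by rewrite (lt_le_trans H)// jump_time_le_explosion.
rewrite tE (lt_le_trans (jump_time_ltS _))// ?jump_time_le_explosion// -tE.
by rewrite ltry.
Qed.

Lemma lt_explosion_ex w t : (t%:E < explosion w)%E -> exists k, (t%:E < jump_time w k)%E.
Proof.
move=> H; apply: contrapT => /forallNP H'.
by move: H; rewrite ltNge explosion_le// => k; rewrite leNgt; apply/negP.
Qed.

Lemma stage_exists w t : 0 < t -> (t%:E < explosion w)%E -> exists k, stage w k t.
Proof.
move=> t0 /lt_explosion_ex [k0 tk0].
have ex : exists k, (t%:E <= jump_time w k)%E by exists k0; exact: ltW.
case: (ex_minnP ex) => -[|k] tk kmin.
  by move: tk; rewrite jump_time0 lee_fin leNgt t0.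
exists k; rewrite /stage tk andbT ltNge; apply/negP => /kmin.
by rewrite ltnn.
Qed.

Lemma stage_uniq w k l t : stage w k t -> stage w l t -> k = l.
Proof.
wlog kl : k l / (k <= l)%N => [H sk sl|].
  by have [/H|/ltnW /H H'] := leqP k l; [apply|rewrite H'].
move: kl; rewrite leq_eqVlt => /predU1P[//|kl] /andP[_ tk] /andP[lt _].
have := le_lt_trans (le_jump_time w kl) lt.
by rewrite ltNge tk.
Qed.

Lemma xi_interval w k t : (jump_time w k <= t%:E < jump_time w k.+1)%E ->
  xi w t = mark w k.
Proof.
move=> /andP[kt tk]; rewrite /xi; apply: xget_unique; first by exists k => //=; rewrite kt tk.
move=> x [l /= /andP[lt tl] <-]; congr mark.
apply/eqP; rewrite eqn_leq; apply/andP; split; rewrite leqNgt; apply/negP => H.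
  by have := le_trans (le_jump_time w H) lt; rewrite leNgt tk.
by have := le_trans (le_jump_time w H) kt; rewrite leNgt tl.
Qed.

Lemma xi_explosion w t : (explosion w <= t%:E)%E -> xi w t = None.
Proof.
move=> H; rewrite /xi; case: xgetP => // x _ [k /= /andP[_ tk] _].
by have := lt_le_trans tk (jump_time_le_explosion w k.+1); rewrite ltNge H.
Qed.

Lemma xi_ex w t : 0 <= t -> (t%:E < explosion w)%E ->
  exists k, (jump_time w k <= t%:E < jump_time w k.+1)%E.
Proof.
move=> t0 /lt_explosion_ex [k0 tk0].
have ex : exists k, (t%:E < jump_time w k)%E by exists k0.
case: (ex_minnP ex) => -[|k] tk kmin.
  by move: tk; rewrite jump_time0 lte_fin ltNge t0.
exists k; rewrite tk andbT leNgt; apply/negP => /kmin.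
by rewrite ltnn.
Qed.

(** The left limit is a choice among eventual values on the left; there is only
    one, as the filter of left neighbourhoods is proper. *)
Lemma xi_left_eq w t (a : R) x : a < t -> (forall s, a < s < t -> xi w s = x) ->
  xi_left w t = x.
Proof.
move=> at_ H; rewrite /xi_left.
have Hn : \forall s \near t^'-, xi w s = x.
  near=> s; apply: H; apply/andP; split; last by near: s; exact: nbhs_left_lt.
  by near: s; exact: nbhs_left_gt.
apply: xget_unique => // y Hy.
have Hxy : \forall s \near t^'-, xi w s = y /\ xi w s = x.
  by near do split.
have [s [sy sx]] := @filter_ex _ _ (at_left_proper_filter t) _ Hxy.
by rewrite -sy -sx.
Unshelve. all: by end_near. Qed.

Lemma xi_left_stage w k t : stage w k t -> xi_left w t = mark w k.
Proof.
move=> st; have /andP[kt tk] := st; have F := stage_finite st.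
apply: (@xi_left_eq w t (fine (jump_time w k))).
  by rewrite -lte_fin -jump_time_finE.
move=> s /andP[ks st']; apply: xi_interval; rewrite (jump_time_finE F) lee_fin ltW//=.
by rewrite (lt_le_trans _ tk)// lte_fin.
Qed.

Lemma xi_left_explosion w t : (explosion w < t%:E)%E -> xi_left w t = None.
Proof.
move=> H; have e0 : (0 <= explosion w)%E.
  by have := jump_time_le_explosion w 0; rewrite jump_time0.
have eF : explosion w = (fine (explosion w))%:E.
  by rewrite fineK// ge0_fin_numE// (lt_trans H)// ltry.
apply: (@xi_left_eq w t (fine (explosion w))); first by rewrite -lte_fin -eF.
by move=> s /andP[es _]; apply: xi_explosion; rewrite eF lee_fin ltW.
Qed.

(** The times at which the state may differ from its left limit; None stands for
    the explosion time. *)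
Definition jump_times w : set R :=
  range (fun o : option nat =>
    if o is Some k then fine (jump_time w k) else fine (explosion w)).

Lemma countable_jump_times w : countable (jump_times w).
Proof.
exact: sub_countable (card_image_le _ _) (countableP _).
Qed.

Lemma xi_leftE w t : 0 < t -> ~ jump_times w t -> xi_left w t = xi w t.
Proof.
move=> t0 nt; have [te|et] := ltP t%:E (explosion w).
  have [k st] := stage_exists t0 te; rewrite (xi_left_stage st) (xi_interval (k := k))//.
  have /andP[kt tk] := st; rewrite ltW//= lt_neqAle tk andbT.
  by apply/eqP => tE; apply: nt; exists (Some k.+1) => //=; rewrite -tE.
move: et; rewrite le_eqVlt => /predU1P[tE|et].
  by exfalso; apply: nt; exists None => //=; rewrite tE.
by rewrite xi_left_explosion// xi_explosion// ltW.
Qed.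

End trajectories.

(** * Stopping a trajectory, and measurability in the pair (trajectory, time) *)
Section stopping.
Context (R : realType) dS (S : measurableType dS).
Implicit Types (w : Omega R S) (t : R) (k n m : nat).

(** The trajectory killed after its k-th jump: it carries what is known of w up
    to, and excluding, the next jump. *)
Definition stop_coord k w : S * (nat -> \bar R * option S) :=
  (initial w, fun n => if (n < k)%N then (sval w).2 n else (+oo%E, None)).

Lemma stop_trajectory k w : trajectory (stop_coord k w).
Proof.
right; case: (svalP w) => [H|[l [H1 H2]]].
  exists k; split=> n /=; first by move=> nk; rewrite nk; exact: H.
  by rewrite ltnNge => ->.
exists (minn k l); split=> n /=.
  by rewrite leq_min => /andP[nk nl]; rewrite nk; exact: H1.
rewrite geq_min; case: ltnP => //= nk; first by exact: H2.
Qed.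

Definition stop k w : Omega R S := exist _ _ (stop_trajectory k w).

Lemma sojourn_stop k w n : sojourn (stop k w) n = if (n < k)%N then sojourn w n else +oo%E.
Proof. by rewrite /sojourn /=; case: ifP. Qed.

Lemma jump_time_stop k w n : (n <= k)%N -> jump_time (stop k w) n = jump_time w n.
Proof.
move=> nk; apply: eq_bigr => i _; rewrite sojourn_stop.
by rewrite (leq_trans (ltn_ord i)).
Qed.

Lemma jump_time_stop_after k w n : (k < n)%N -> jump_time (stop k w) n = +oo%E.
Proof.
move=> kn; apply/eqP; rewrite -leye_eq (le_trans _ (le_jump_time _ kn))//.
rewrite jump_timeS sojourn_stop ltnn addey// -ltNye.
by rewrite (lt_le_trans _ (jump_time_ge0 _ k)).
Qed.

Lemma mark_stop k w n : (n <= k)%N -> mark (stop k w) n = mark w n.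
Proof. by case: n => [|n]//= nk; rewrite nk. Qed.

(** Both trajectories have the same first k jumps, and on the stopped one the
    k-th stage lasts forever. *)
Lemma stage_stop k w v n : (v%:E <= jump_time w k.+1)%E -> stage (stop k w) n v = stage w n v.
Proof.
move=> vk; rewrite /stage; case: (ltngtP n k) => nk.
- by rewrite !jump_time_stop// ltnW.
- rewrite (jump_time_stop_after _ nk) ltNge leey/=.
  by apply/esym/negbTE; rewrite negb_and -leNgt (le_trans vk)// le_jump_time.
- by rewrite nk jump_time_stop// jump_time_stop_after// leey vk.
Qed.

Lemma measurable_coord n : measurable_fun setT (fun w : Omega R S => (sval w).2 n).
Proof.
move=> _ B mB; rewrite setTI; apply: sub_sigma_algebra; right; exists n => //.
by exists B => //; rewrite setTI.
Qed.

Lemma measurable_initial : measurable_fun setT (@initial R dS S).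
Proof.
move=> _ B mB; rewrite setTI; apply: sub_sigma_algebra; left.
by exists B => //; rewrite setTI.
Qed.

Lemma measurable_sojourn n : measurable_fun setT (fun w : Omega R S => sojourn w n).
Proof. exact: (measurableT_comp measurable_fst (measurable_coord n)). Qed.

Lemma measurable_jump_time k : measurable_fun setT (fun w : Omega R S => jump_time w k).
Proof. by apply: emeasurable_sum => i; exact: measurable_sojourn. Qed.

Lemma measurable_jump_finite n : measurable_fun setT (fun w : Omega R S => (jump_time w n < +oo)%E).
Proof.
apply: (measurable_fun_bool true); rewrite setTI.
rewrite (_ : _ @^-1` _ = [set w : Omega R S | (jump_time w n < +oo)%E]).
  have := emeasurable_fun_infty_o measurableT (measurable_jump_time n) +oo%E.
  by rewrite setTI.
by apply/seteqP; split.
Qed.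

Hypotheses (S_countable : countable [set: S]) (S_discrete : forall B : set S, measurable B).

Lemma measurable_mark_eq k i : measurable [set w : Omega R S | mark w k = Some i].
Proof.
case: k => [|k].
  have := measurable_initial measurableT (S_discrete [set i]); rewrite setTI.
  by congr measurable; apply/seteqP; split => w /=; [move=> ->|case].
have mm := measurableT_comp measurable_snd (measurable_coord k).
have m1 : measurable [set Some i : option S].
  exact: (S_discrete (Some @^-1` [set Some i])).
by have := mm measurableT _ m1; rewrite setTI.
Qed.

Lemma measurable_by_mark d' (Y : measurableType d') n (f : Omega R S -> Y) :
  (forall o, exists2 g, measurable_fun setT g & forall w, mark w n = o -> f w = g w) ->
  measurable_fun setT f.
Proof.
apply: (measurable_by_value S_countable (o := fun w => mark w n)) => i.
exact: measurable_mark_eq.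
Qed.

Lemma measurable_mark_fun (f : option S -> R) n :
  measurable_fun setT (fun w : Omega R S => f (mark w n)).
Proof.
by apply: (measurable_by_mark (n := n)) => o; exists (cst (f o)) => [|w ->]; [exact: measurable_cst|].
Qed.

Lemma measurable_explosion : measurable_fun setT (@explosion R dS S).
Proof.
have -> : @explosion R dS S = fun w => limn_esup (jump_time w).
  apply/funext => w; rewrite is_cvg_limn_esupE//.
  by apply: ereal_nondecreasing_is_cvgn => m n; exact: le_jump_time.
by apply: measurable_fun_limn_esup => n; exact: measurable_jump_time.
Qed.

Notation process_measurable Y := (measurable_fun [set: Omega R S * R] Y).

Lemma measurable_time : process_measurable (fun x => x.2%:E).
Proof. exact: (measurableT_comp (@EFin_measurable R setT) measurable_snd). Qed.

Lemma measurable_jump_time_fst k : process_measurable (fun x => jump_time x.1 k).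
Proof. exact: (measurableT_comp (measurable_jump_time k) measurable_fst). Qed.

Lemma measurable_stage k : measurable [set x : Omega R S * R | stage x.1 k x.2].
Proof.
have -> : [set x : Omega R S * R | stage x.1 k x.2] =
  ~` [set x | (x.2%:E <= jump_time x.1 k)%E] `&` [set x | (x.2%:E <= jump_time x.1 k.+1)%E].
  apply/seteqP; split => x /=.
    by rewrite /stage => /andP[kt tk]; split => //; apply/negP; rewrite -ltNge.
  by rewrite /stage => -[/negP]; rewrite -ltNge => -> ->.
apply: measurableI; first apply: measurableC.
all: rewrite -[X in measurable X]setTI; apply: measurable_lee => //.
all: try exact: measurable_time.
all: exact: measurable_jump_time_fst.
Qed.

Definition stage_at k i : set (Omega R S * R) :=
  [set x | stage x.1 k x.2 /\ mark x.1 k = Some i].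

Lemma measurable_stage_at k i : measurable (stage_at k i).
Proof.
apply: measurableI; first exact: measurable_stage.
have := @measurable_fst _ _ (Omega R S) R measurableT _ (measurable_mark_eq k i).
by rewrite setTI.
Qed.

(** The times up to 0 and from the explosion on. *)
Definition off_stage : set (Omega R S * R) :=
  [set x | forall k, ~~ stage x.1 k x.2].

Lemma measurable_off_stage : measurable off_stage.
Proof.
have -> : off_stage = \bigcap_k ~` [set x : Omega R S * R | stage x.1 k x.2].
  apply/seteqP; split => x.
    by move=> H k _ /=; apply/negP; exact: H.
  by move=> H k; apply/negP; exact: H.
by apply: bigcap_measurable => // k _; apply: measurableC; exact: measurable_stage.
Qed.

(** Stages and the states on them form a countable measurable partition; all the
    processes below have an explicit formula on each piece. *)
Lemma measurable_by_stages d' (Y : measurableType d') (f : Omega R S * R -> Y) (y : Y) :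
  (forall k i, exists2 g, process_measurable g & forall x, stage_at k i x -> f x = g x) ->
  (forall x, off_stage x -> f x = y) ->
  process_measurable f.
Proof.
move=> H1 H2.
pose E (o : option (nat * S)) := if o is Some ki then stage_at ki.1 ki.2 else off_stage.
apply: (measurable_countable_cover (E := E)) => [||x|[[k i]|]].
- have /countable_injP [h hinj] := S_countable.
  apply/countable_injP; exists (fun o : option (nat * S) =>
    if o is Some ki then (pickle (ki.1, h ki.2)).+1 else 0%N).
  move=> [[k i]|] [[l j]|] //= _ _ [] /(pcan_inj pickleK) [->] /hinj.
  by rewrite !inE => ->.
- by case=> [[k i]|]; [exact: measurable_stage_at|exact: measurable_off_stage].
- have [[k sk]|/forallNP nk] := pselect (exists k, stage x.1 k x.2).
    have [i mi] := mark_some (stage_finite sk).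
    by exists (Some (k, i)).
  by exists None => k; apply/negP.
- exact: H1.
- by exists (cst y) => //; exact: measurable_cst.
Qed.

End stopping.

(** * Predictability of processes that depend on the past *)
Section predictability.
Context (R : realType) dS (S : measurableType dS).
Implicit Types (w : Omega R S) (t : R) (k n m : nat).
Notation HE := (@history_events R dS S).

Lemma history_events_mark (s t : R) n (C : set S) : 0 <= s -> s <= t -> measurable C ->
  HE t [set w | (jump_time w n <= s%:E)%E /\ exists2 j, C j & mark w n = Some j].
Proof.
move=> s0 st mC; apply: sub_sigma_algebra; exists n, s, C; split => //.
by rewrite s0.
Qed.

Lemma history_events_jump (s t : R) n : 0 <= s -> s <= t ->
  HE t [set w | (jump_time w n <= s%:E)%E].
Proof.
move=> s0 st; have := history_events_mark n s0 st measurableT.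
congr HE; apply/seteqP; split => w /=; first by case.
move=> H; split => //; have [|i ->] := @mark_some _ _ _ w n; last by exists i.
by rewrite (le_lt_trans H)// ltry.
Qed.

Lemma history_eventsI t (A B : set (Omega R S)) : HE t A -> HE t B -> HE t (A `&` B).
Proof. exact: (@measurableI _ (g_sigma_algebraType _)). Qed.

(** The events of the k-th jump time T_k, a stopping time of the history: on
    {T_k <= r} they are known at time r. *)
Definition jump_events k : set (set (Omega R S)) :=
  [set H | forall r, 0 <= r -> HE r (H `&` [set w | (jump_time w k <= r%:E)%E])].

Lemma jump_events_sigma k : sigma_algebra setT (jump_events k).
Proof.
split.
- by move=> r r0; rewrite set0I; exact: sigma_algebra0.
- move=> A HA r r0; rewrite setTD.
  have -> : ~` A `&` [set w | (jump_time w k <= r%:E)%E] =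
    ~` (A `&` [set w | (jump_time w k <= r%:E)%E]) `&` [set w | (jump_time w k <= r%:E)%E].
    by rewrite setCI setIUl setICl setU0.
  apply: history_eventsI; last exact: history_events_jump.
  exact: sigma_algebraC (HA r r0).
- move=> A HA r r0; rewrite setI_bigcupl.
  by apply: sigma_algebra_bigcup => n; exact: HA.
Qed.

Notation TT k := (g_sigma_algebraType (jump_events k)).

Lemma jump_events_measurable k (A : set (TT k)) : measurable A -> jump_events k A.
Proof. by move=> mA; rewrite -(sigma_algebra_id (jump_events_sigma k)). Qed.

Lemma measurable_jump_events k (A : set (TT k)) : jump_events k A -> measurable A.
Proof. exact: sub_sigma_algebra. Qed.

Lemma jump_time_jump_measurable k n : (n <= k)%N ->
  measurable_fun setT (fun w : TT k => jump_time w n).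
Proof.
move=> nk; apply: (measurability _ (ErealGenOInfty.measurableE R)) => _ /= [_ [x ->] <-].
rewrite setTI; have -> : (fun w : TT k => jump_time w n) @^-1` `]x%:E, +oo[%classic =
    ~` [set w : TT k | (jump_time w n <= x%:E)%E].
  by apply/seteqP; split => w /=; rewrite in_itv/= andbT ltNge => /negP.
apply: measurableC; apply: measurable_jump_events => r r0.
have [xr|rx] := leP x r; last first.
  have -> : [set w : TT k | (jump_time w n <= x%:E)%E] `&` [set w | (jump_time w k <= r%:E)%E]
     = [set w | (jump_time w k <= r%:E)%E].
    apply/seteqP; split => [w []//|w /= H]; split => //.
    rewrite (le_trans (le_jump_time w nk))// (le_trans H)// lee_fin; exact: ltW.
  exact: history_events_jump.
have [x0|x0] := leP 0 x; last first.
  have -> : [set w : TT k | (jump_time w n <= x%:E)%E] = set0.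
    apply/seteqP; split => w //= H.
    by have := le_trans (jump_time_ge0 w n) H; rewrite lee_fin leNgt x0.
  by rewrite set0I; exact: sigma_algebra0.
by apply: history_eventsI; exact: history_events_jump.
Qed.

Lemma mark_jump_measurable k n : (n <= k)%N ->
  measurable_fun setT (fun w : TT k => mark w n).
Proof.
move=> nk _ B mB; rewrite setTI; apply: measurable_jump_events => r r0.
have -> : (fun w : TT k => mark w n) @^-1` B `&` [set w | (jump_time w k <= r%:E)%E] =
  [set w | (jump_time w n <= r%:E)%E /\ exists2 j, (Some @^-1` B) j & mark w n = Some j] `&`
    [set w | (jump_time w k <= r%:E)%E].
  apply/seteqP; split => w /= [H1 H2]; split => //; last first.
    by case: H1 => _ [j Bj ->].
  have H := le_trans (le_jump_time w nk) H2; split => //.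
  have [|i mi] := @mark_some _ _ _ w n; first by rewrite (le_lt_trans H)// ltry.
  by exists i; rewrite ?mi// -mi.
apply: history_eventsI; last exact: history_events_jump.
by apply: history_events_mark.
Qed.

(** The coordinates of the stopped trajectory are functions of the first k jump
    times and marks, which are known at T_k. *)
Lemma stop_jump_measurable k : measurable_fun setT (stop k : TT k -> Omega R S).
Proof.
apply: (measurability (@coordinate_sets R dS S)) => // _ /= [A [|[n _]] [B mB] <- <-];
  rewrite !setTI.
  have := mark_jump_measurable (leq0n k) measurableT.
  move=> /(_ (Some @` B)); rewrite setTI.
  have -> : (fun w : TT k => mark w 0) @^-1` (Some @` B) = stop k @^-1` (@initial R dS S @^-1` B).
    apply/seteqP; split => w /=; first by case => j + [E]; rewrite E.
    by move=> H; exists (initial w).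
  apply.
  have : measurable (Some @^-1` (Some @` B)).
    have -> : Some @^-1` (Some @` B) = B by apply/seteqP; split => [x [y Cy [<-]]|x Cx] //; exists x.
    exact: mB.
  by [].
have [nk|kn] := ltnP n k; last first.
  have -> : stop k @^-1` ((fun w : Omega R S => (sval w).2 n) @^-1` B) =
     if (+oo%E, None) \in B then setT else set0.
    apply/seteqP; split => w /=; rewrite ltnNge kn/=.
      by move=> H; rewrite mem_set.
    by case: ifPn => // /set_mem.
  by case: ifP => _; [exact: measurableT|exact: measurable0].
have mf : measurable_fun setT (fun w : TT k =>
    ((jump_time w n.+1 - jump_time w n)%E, mark w n.+1)).
  apply: measurable_fun_pair; last exact: mark_jump_measurable.
  by apply: emeasurable_funB; apply: jump_time_jump_measurable => //; exact: ltnW.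
have := mf measurableT B mB; rewrite setTI => /jump_events_measurable H.
apply: measurable_jump_events => r r0; have := H r r0; congr HE.
apply/seteqP; split => w /= [H1 H2]; split => //; move: H1; rewrite nk.
all: have E : (jump_time w n.+1 - jump_time w n)%E = ((sval w).2 n).1.
1,3: have F : (jump_time w n < +oo)%E.
1,3: by rewrite (le_lt_trans (le_jump_time w (ltnW nk)))// (le_lt_trans H2)// ltry.
1,2: by rewrite jump_timeS addeC addeA (jump_time_finE F) -EFinN -EFinD addNr add0e.
all: by rewrite E -surjective_pairing.
Qed.

Notation PT := (predictable_type R S).

Lemma predictable_rectangle (s : R) (G : set (Omega R S)) :
  0 <= s -> HE s G -> measurable (G `*` `]s, +oo[%classic : set PT).
Proof. by move=> s0 HG; apply: sub_sigma_algebra; exists s, G. Qed.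

(** If T_k < t then T_k <= r < t for some rational r: the set is a countable union
    of predictable rectangles. *)
Lemma predictable_after_jump k (H : set (Omega R S)) : jump_events k H ->
  measurable ([set x | H x.1 /\ (jump_time x.1 k < x.2%:E)%E] : set PT).
Proof.
move=> HH.
have -> : ([set x | H x.1 /\ (jump_time x.1 k < x.2%:E)%E] : set PT) =
  \bigcup_(q : rat) (if 0 <= ratr q :> R then
    (H `&` [set w | (jump_time w k <= (ratr q)%:E)%E]) `*` `](ratr q : R), +oo[%classic
    else set0).
  apply/seteqP; split => -[w t] /=.
    move=> [Hw kt]; have F : (jump_time w k < +oo)%E by rewrite (lt_trans kt)// ltry.
    have : fine (jump_time w k) < t by rewrite -lte_fin -jump_time_finE.
    move=> /rat_in_itvoo[q]; rewrite in_itv /= => /andP[kq qt].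
    have kq' : (jump_time w k <= (ratr q)%:E)%E.
      by rewrite (jump_time_finE F) lee_fin ltW.
    exists q => //; rewrite ifT; first by split => //=; rewrite in_itv/= andbT.
    by rewrite -lee_fin (le_trans (jump_time_ge0 w k)).
  move=> [q _]; case: ifP => // q0 [/= [Hw kq]]; rewrite in_itv /= andbT => qt.
  by split => //; rewrite (le_lt_trans kq)// lte_fin.
apply: countable_bigcupT_measurable; first exact: countableP.
move=> q; case: ifP => // q0; apply: predictable_rectangle => //.
exact: HH.
Qed.

Lemma predictable_stage k : measurable ([set x | stage x.1 k x.2] : set PT).
Proof.
have after l : measurable ([set x | (jump_time x.1 l < x.2%:E)%E] : set PT).
  have := @predictable_after_jump l setT; rewrite (_ : [set x | _] =
    [set x : PT | (jump_time x.1 l < x.2%:E)%E]); last first.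
    by apply/seteqP; split => x /=; [case|].
  by apply; apply: jump_events_measurable; exact: measurableT.
have -> : [set x : PT | stage x.1 k x.2] = [set x : PT | (jump_time x.1 k < x.2%:E)%E] `\`
    [set x : PT | (jump_time x.1 k.+1 < x.2%:E)%E].
  apply/seteqP; split => x /=; rewrite /stage.
    by move=> /andP[-> tk]; split => //; apply/negP; rewrite -leNgt.
  by move=> [-> /negP]; rewrite -leNgt.
exact: measurableD.
Qed.

Lemma predictable_off_stage : measurable ([set x | forall k, ~~ stage x.1 k x.2] : set PT).
Proof.
have -> : [set x | forall k, ~~ stage x.1 k x.2] = \bigcap_k ~` [set x : PT | stage x.1 k x.2].
  apply/seteqP; split => x.
    by move=> H k _ /=; apply/negP; exact: H.
  by move=> H k; apply/negP; exact: H.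
by apply: bigcap_measurable => // k _; apply: measurableC; exact: predictable_stage.
Qed.

Lemma predictable_time : measurable_fun setT (fun x : PT => Num.max x.2 0).
Proof.
apply: (measurability _ (RGenOInfty.measurableE R)) => _ /= [_ [y ->] <-]; rewrite setTI.
have [y0|y0] := leP 0 y; last first.
  rewrite (_ : _ @^-1` _ = setT); first exact: measurableT.
  by apply/seteqP; split => x //= _; rewrite in_itv/= andbT lt_max y0 orbT.
have -> : (fun x : PT => Num.max x.2 0) @^-1` `]y, +oo[%classic = setT `*` `]y, +oo[%classic.
  apply/seteqP; split => x /=; rewrite !in_itv/= !andbT lt_max [y < 0]ltNge y0 orbF => //.
  by case.
apply: predictable_rectangle => //; exact: (@measurableT _ (g_sigma_algebraType _)).
Qed.

(** On the k-th stage f is its composition with (w, t) |-> (stop k w, t), which is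
    predictable after T_k because stop k w is known at T_k.  The stages themselves
    are predictable. *)
Lemma predictable_of_stop d' (Y : measurableType d') (f : Omega R S * R -> Y) (y : Y) :
  measurable_fun setT f ->
  (forall k w t, stage w k t -> f (w, t) = f (stop k w, t)) ->
  (forall w t, (forall k, ~~ stage w k t) -> f (w, t) = y) ->
  measurable_fun setT (f : PT -> Y).
Proof.
move=> mf fs f0.
pose E (o : option nat) : set PT := if o is Some k then [set x | stage x.1 k x.2]
  else [set x | forall k, ~~ stage x.1 k x.2].
apply: (measurable_countable_cover (E := E)) => [||x|[k|]].
- exact: countableP.
- by case=> [k|]; [exact: predictable_stage|exact: predictable_off_stage].
- have [[k sk]|/forallNP nk] := pselect (exists k, stage x.1 k x.2); first by exists (Some k).
  by exists None => k; apply/negP.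
- pose a (x : PT) : Omega R S := if (jump_time x.1 k < x.2%:E)%E then stop k x.1 else point.
  pose b (x : PT) : R := Num.max x.2 0.
  exists (f \o (fun x => (a x, b x))).
    apply: measurableT_comp => //; apply: measurable_fun_pair; last exact: predictable_time.
    have mB B : measurable B -> measurable ([set x | (jump_time x.1 k < x.2%:E)%E
        /\ B (stop k x.1)] : set PT).
      move=> mB; have := @predictable_after_jump k (stop k @^-1` B).
      rewrite (_ : [set x | _] = [set x : PT | (jump_time x.1 k < x.2%:E)%E
        /\ B (stop k x.1)]); last by apply/seteqP; split => x /= [].
      apply; apply: jump_events_measurable.
      by have := @stop_jump_measurable k measurableT _ mB; rewrite setTI.
    move=> _ B mB'; rewrite setTI.
    have -> : a @^-1` B = [set x | (jump_time x.1 k < x.2%:E)%E /\ B (stop k x.1)] `|`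
       (if point \in B then ~` [set x | (jump_time x.1 k < x.2%:E)%E /\ setT (stop k x.1)] else set0).
      apply/seteqP; split => x /=; rewrite /a.
        case: ifPn => [kt Bx|kt Bp]; first by left.
        by right; rewrite mem_set//= => -[]; rewrite (negbTE kt).
      move=> [[-> //]|]; case: ifPn => // /set_mem Bp /= H; case: ifPn => // kt.
      by exfalso; apply: H.
    apply: measurableU; first exact: mB.
    by case: ifP => _ //; apply: measurableC; exact: mB.
  move=> [w t] /= st; rewrite /a /b /=.
  have /andP[kt _] := st; rewrite kt (fs _ _ _ st); congr (f (_, _)).
  by apply/esym/max_idPl/ltW; exact: stage_gt0 st.
- by exists (cst y) => [|[w t] /= H]; [exact: measurable_cst|exact: f0].
Qed.

End predictability.

(** * The law of the action on a stage *)
Section action_law.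
Context (R : realType) dS (S : measurableType dS) (A : ptopologicalType).
Variables (mdp : ctmdp R S A) (pi : policy mdp).
Implicit Types (w : Omega R S) (t : R) (k n m : nat).

Lemma measurable_from_option d' (Y : measurableType d') (f : option (borel A) -> Y) :
  measurable_fun setT (f \o Some) -> measurable_fun setT f.
Proof.
move=> mf _ B mB; rewrite setTI.
have := mf measurableT B mB; rewrite setTI => H.
exact: H.
Qed.

(** The action law on the k-th stage, as a measure on A instead of A with the
    isolated action adjoined. *)
Definition stage_law w k t : {measure set (borel A) -> \bar R} :=
  policy_kernel pi k (history w k, t - fine (jump_time w k)).

Lemma stage_law_setT w k t : stage_law w k t setT = 1%E.
Proof. exact: prob_kernel. Qed.

Lemma action_lawE w t (B : set (option (borel A))) : action_law pi w t B =
  (((t == 0)%:R)%:E * policy_kernel_ext pi w 0 0 B +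
   ((\sum_(0 <= k <oo) ((jump_time w k < t%:E <= jump_time w k.+1)%E%:R)%:E *
       policy_kernel_ext pi w k (t - fine (jump_time w k)) B) +
    ((explosion w <= t%:E)%E%:R)%:E * \d_(None : option (borel A)) B))%E.
Proof.
apply: (etrans (measure_addE _ _ _)).
by congr (_ + _)%E; exact: measure_addE.
Qed.

Lemma action_law_stage w k t (B : set (option (borel A))) : stage w k t ->
  action_law pi w t B = lift_option (stage_law w k t) B.
Proof.
move=> st; have t0 := stage_gt0 st; have te := stage_lt_explosion st.
rewrite action_lawE gt_eqF//= mul0e add0e.
rewrite leNgt te /= mul0e adde0.
rewrite (@nneseries_single R _ 0 k)//.
- have -> : (jump_time w k < t%:E <= jump_time w k.+1)%E = true by exact: st.
  by rewrite /= mul1e.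
- move=> n nk; have -> : (jump_time w n < t%:E <= jump_time w n.+1)%E = false.
    by apply: contra_neqF nk => sn; exact: stage_uniq sn st.
  by rewrite /= mul0e.
- by rewrite mule_ge0.
Qed.

Lemma action_law_off_stage w t (B : set (option (borel A))) :
  0 < t -> (forall k, ~~ stage w k t) ->
  action_law pi w t B = \d_(None : option (borel A)) B.
Proof.
move=> t0 ns.
have te : (explosion w <= t%:E)%E.
  by rewrite leNgt; apply/negP => /(stage_exists t0)[k sk]; have := ns k; rewrite sk.
rewrite action_lawE gt_eqF//= mul0e add0e te mul1e.
rewrite eseries0 ?add0e// => n _ _.
have -> : (jump_time w n < t%:E <= jump_time w n.+1)%E = false by apply/negbTE/ns.
by rewrite /= mul0e.
Qed.

Lemma integral_action_law w k t (f : option (borel A) -> \bar R) : stage w k t ->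
  measurable_fun setT (f \o Some) ->
  (\int[action_law pi w t]_a f a = \int[stage_law w k t]_a f (Some a))%E.
Proof.
move=> st mf.
rewrite (eq_measure_integral (lift_option (stage_law w k t) : {measure set _ -> \bar R})); last first.
  by move=> B _ _; exact: action_law_stage.
have ge0 g : measurable_fun setT (g \o Some) -> (forall a, 0 <= g a)%E ->
  (\int[lift_option (stage_law w k t)]_a g a = \int[stage_law w k t]_a g (Some a))%E.
  move=> mg g0.
  have := @ge0_integral_pushforward _ _ _ _ R _ (@measurable_Some _ (borel A))
    (stage_law w k t) setT g measurableT (measurable_from_option mg) (fun y _ => g0 y).
  by rewrite preimage_setT.
rewrite integralE [RHS]integralE; congr (_ - _)%E.
- have E : (f^\+)%E \o Some = ((f \o Some)^\+)%E by apply/funext => a; rewrite /= !funeposE.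
  rewrite ge0//; first by rewrite -E.
  by rewrite E; exact: measurable_funepos.
- have E : (f^\-)%E \o Some = ((f \o Some)^\-)%E by apply/funext => a; rewrite /= !funenegE.
  rewrite ge0//; first by rewrite -E.
  by rewrite E; exact: measurable_funeneg.
Qed.

Lemma integral_action_law_off w t (f : option (borel A) -> \bar R) :
  0 < t -> (forall k, ~~ stage w k t) -> measurable_fun setT (f \o Some) ->
  (\int[action_law pi w t]_a f a = f None)%E.
Proof.
move=> t0 ns mf.
rewrite (eq_measure_integral (\d_(None : option (borel A)))); last first.
  by move=> B _ _; exact: action_law_off_stage.
have mf' := measurable_from_option mf.
by rewrite integral_dirac// diracT mul1e.
Qed.

Hypotheses (S_countable : countable [set: S]) (S_discrete : forall B : set S, measurable B).

Lemma measurable_history k : measurable_fun setT (fun w : Omega R S => history w k).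
Proof.
apply: measurable_fun_pair; first exact: measurable_initial.
apply/measurable_fun_tnthP => m.
rewrite (_ : _ \o _ = fun w : Omega R S =>
    (fine (sojourn w m), odflt (initial w) (mark w m.+1))); last first.
  by apply/funext => w /=; rewrite tnth_mktuple.
apply: measurable_fun_pair.
  by apply: measurableT_comp; [exact: fine_measurable|exact: measurable_sojourn].
apply: (measurable_by_value S_countable (o := fun w => mark w m.+1)) => [i|[i|]].
- exact: measurable_mark_eq.
- by exists (cst i) => [|w]; [exact: measurable_cst|rewrite /mark /= => ->].
- by exists (@initial R dS S) => [|w]; [exact: measurable_initial|rewrite /mark /= => ->].
Qed.

Lemma history_time w k : (jump_time w k < +oo)%E ->
  \sum_(m < k) (tnth (history w k).2 m).1 = fine (jump_time w k).
Proof.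
move=> F; rewrite /jump_time -sum_fine; last first.
  move=> m _; have [th _ [j wm]] := coord_before F (ltn_ord m).
  by rewrite /sojourn wm.
by apply: eq_bigr => m _; rewrite tnth_mktuple.
Qed.

Local Notation X k := (S * k.-tuple (R * S) * R)%type.

(** The kernel has the history and the time elapsed since T_k as arguments; T_k
    is the sum of the sojourn times in the history, so that t is a function of
    these arguments and the integrand can be carried into the kernel. *)
Lemma measurable_stage_integral k (G : R * borel A -> \bar R) :
  measurable_fun setT G ->
  exists2 g : Omega R S * R -> \bar R, measurable_fun setT g &
    forall x, stage x.1 k x.2 -> (\int[stage_law x.1 k x.2]_a G (x.2, a))%E = g x.
Proof.
move=> mG.
pose tau (x : X k) : R := \sum_(m < k) (tnth x.1.2 m).1 + x.2.
have mtau : measurable_fun setT tau.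
  apply: measurable_funD; last exact: measurable_snd.
  apply: measurable_sum => m.
  apply: (measurableT_comp measurable_fst).
  apply: (measurableT_comp (measurable_tnth m)).
  exact: (measurableT_comp measurable_snd measurable_fst).
have ge0 (F : R * borel A -> \bar R) : measurable_fun setT F -> (forall x, 0 <= F x)%E ->
    measurable_fun setT (fun x : X k => \int[policy_kernel pi k x]_a F (tau x, a))%E.
  move=> mF F0.
  apply: (measurable_fun_integral_finite_kernel (fun z : X k * borel A => F (tau z.1, z.2))) => //.
  apply: measurableT_comp => //; apply: measurable_fun_pair; last exact: measurable_snd.
  exact: (measurableT_comp mtau measurable_fst).
pose hist (x : Omega R S * R) : X k := (history x.1 k, x.2 - fine (jump_time x.1 k)).
have mhist : measurable_fun setT hist.
  apply: measurable_fun_pair; first exact: (measurableT_comp (@measurable_history k) measurable_fst).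
  apply: measurable_funB; first exact: measurable_snd.
  apply: measurableT_comp; first exact: fine_measurable.
  exact: measurable_jump_time_fst.
exists ((fun x : X k => \int[policy_kernel pi k x]_a G^\+ (tau x, a) -
    \int[policy_kernel pi k x]_a G^\- (tau x, a))%E \o hist).
  apply: measurableT_comp => //; apply: emeasurable_funB; apply: ge0 => //.
  - exact: measurable_funepos.
  - exact: measurable_funeneg.
move=> [w t] /= st; have tauE : tau (hist (w, t)) = t.
  by rewrite /tau /= history_time ?(stage_finite st)// subrKC.
rewrite tauE integralE; congr (_ - _)%E; apply: eq_integral => a _.
- by rewrite !funeposE.
- by rewrite !funenegE.
Qed.

End action_law.

(** * Jump rates under a fixed action *)
Section rates.
Context (R : realType) dS (S : measurableType dS) (A : ptopologicalType).
Variables (mdp : ctmdp R S A).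
Hypotheses (S_countable : countable [set: S]) (S_discrete : forall B : set S, measurable B).
Implicit Types (t : R) (i j : S) (a : borel A).

(** Zero on the diagonal and off the graph: the result is nonnegative
    everywhere, and on the graph its total mass is the exit rate. *)
Definition jump_rate t i a j : \bar R :=
  if j == i then 0%E else ((fun y => rate mdp y [set j]) \_ (graph mdp)) (t, i, a).

Lemma jump_rate_ge0 t i a j : (0 <= jump_rate t i a j)%E.
Proof.
rewrite /jump_rate; case: ifPn => // ji; rewrite patchE; case: ifPn => // /set_mem g.
exact: rate_ge0.
Qed.

Lemma measurable_restricted_rate i (B : set S) :
  measurable_fun setT (fun x : R * borel A => ((fun y => rate mdp y B) \_ (graph mdp)) (x.1, i, x.2)).
Proof.
have m : measurable_fun setT ((fun y => rate mdp y B) \_ (graph mdp)).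
  apply/(measurable_restrictT _ (graph_measurable mdp)).
  by apply: rate_measurable; exact: S_discrete.
apply: (measurableT_comp m); apply: measurable_fun_pair; last exact: measurable_snd.
by apply: measurable_fun_pair; [exact: measurable_fst|exact: measurable_cst].
Qed.

Lemma measurable_jump_rate i j :
  measurable_fun setT (fun x : R * borel A => jump_rate x.1 i x.2 j).
Proof.
rewrite /jump_rate; case: (j == i); first exact: measurable_cst.
exact: measurable_restricted_rate.
Qed.

Lemma jump_rate_total t i a : graph mdp (t, i, a) ->
  \esum_(j in [set: S]) jump_rate t i a j = (- rate mdp (t, i, a) [set i])%E.
Proof.
move=> g; pose nu := rate mdp (t, i, a); pose F j := if j == i then set0 else [set j].
have E j : jump_rate t i a j = nu (F j).
  rewrite /jump_rate /F; case: ifPn => _; first by rewrite charge0.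
  by rewrite patchE mem_set.
under eq_esum do rewrite E.
rewrite charge_esum//; last 2 first.
- apply/trivIsetP => j k _ _ jk; rewrite /F.
  case: ifPn => _; first by rewrite set0I.
  case: ifPn => _; first by rewrite setI0.
  by apply/seteqP; split => x //= [-> /eqP]; rewrite (negbTE jk).
- by move=> j; rewrite -E jump_rate_ge0.
have -> : \bigcup_j F j = ~` [set i].
  apply/seteqP; split => x /=.
    by move=> [j _]; rewrite /F; case: eqP => // /eqP ji ->; apply/eqP.
  by move=> /eqP xi; exists x => //; rewrite /F (negbTE xi).
have : nu setT = 0%E by exact: rate_setT.
rewrite -(setUv [set i]) chargeU//; last by rewrite setICr.
have f1 : nu [set i] \is a fin_num by exact: fin_num_measure.
have f2 : nu (~` [set i]) \is a fin_num by exact: fin_num_measure.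
rewrite -(fineK f1) -(fineK f2) -EFinD -EFinN => -[] /eqP; rewrite addr_eq0 => /eqP ->.
by rewrite opprK.
Qed.

Lemma jump_rate_off t i a j : ~ graph mdp (t, i, a) -> jump_rate t i a j = 0%E.
Proof. by move=> g; rewrite /jump_rate patchE memNset// if_same. Qed.

Lemma jump_rate_total_fin t i a : \esum_(j in [set: S]) jump_rate t i a j \is a fin_num.
Proof.
have [g|g] := pselect (graph mdp (t, i, a)).
  rewrite jump_rate_total// fin_numN; exact: fin_num_measure.
by rewrite esum1// => j _; exact: jump_rate_off.
Qed.

Lemma jump_rate_total_le t i a (b : R) : 0 <= b -> (qstar mdp i <= b%:E)%E ->
  (\esum_(j in [set: S]) jump_rate t i a j <= b%:E)%E.
Proof.
move=> b0 qb; have [g|g] := pselect (graph mdp (t, i, a)).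
  rewrite jump_rate_total//; apply: le_trans qb; apply: ereal_sup_ubound.
  by exists (t, i, a).
by rewrite esum1// => j _; exact: jump_rate_off.
Qed.

(** The diagonal term of the drift is - U(i) times the exit rate, the only
    one that may be negative; it moves to the right-hand side. *)
Lemma jump_rate_drift (U : S -> R) (rho : R) t i a : (forall j, 0 <= U j) -> 0 <= rho ->
  (graph mdp (t, i, a) ->
   (signed_sum (fun j => (U j)%:E * rate mdp (t, i, a) [set j]) <= (rho * U i)%:E)%E) ->
  (\esum_(j in [set: S]) ((U j)%:E * jump_rate t i a j) <=
    (rho * U i)%:E + (U i)%:E * \esum_(j in [set: S]) jump_rate t i a j)%E.
Proof.
move=> U0 rho0 H; have Ti := jump_rate_total_fin t i a.
have [g|g] := pselect (graph mdp (t, i, a)); last first.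
  rewrite [leLHS]esum1 => [|j _]; last by rewrite jump_rate_off// mule0.
  by rewrite adde_ge0 ?mule_ge0 ?lee_fin ?mulr_ge0// esum_ge0// => j _; exact: jump_rate_ge0.
move: (H g); rewrite /signed_sum; set f := (fun j : S => _).
have ri : (rate mdp (t, i, a) [set i] <= 0)%E.
  rewrite -oppe_ge0 -jump_rate_total// esum_ge0// => j _; exact: jump_rate_ge0.
have fne j : j != i -> f j = ((U j)%:E * jump_rate t i a j)%E.
  by move=> ji; rewrite /f /jump_rate (negbTE ji) patchE mem_set.
have fi : (f i <= 0)%E by rewrite /f mule_ge0_le0// lee_fin.
rewrite (_ : \esum_(j in _) f^\+%E j = \esum_(j in [set: S]) ((U j)%:E * jump_rate t i a j)%E); last first.
  apply: eq_esum => j _; rewrite funeposE; have [->|ji] := eqVneq j i.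
    by rewrite (max_idPr fi) /jump_rate eqxx mule0.
  rewrite fne//; apply/max_idPl; rewrite mule_ge0 ?lee_fin// jump_rate_ge0//.
rewrite (_ : \esum_(j in _) f^\-%E j = ((U i)%:E * \esum_(j in [set: S]) jump_rate t i a j)%E).
  by rewrite leeBlDr// fin_numM.
have fn0 j : (0 <= f^\- j)%E by exact: funeneg_ge0.
rewrite (esumID [set i])// ?setTI ?esum_set1//.
rewrite [X in (_ + X)%E]esum1 ?adde0//; last first.
  move=> j ji; have {}ji : j != i by apply/eqP.
  rewrite funenegE fne//; apply/max_idPr.
  by rewrite oppe_le0 mule_ge0 ?lee_fin// jump_rate_ge0.
rewrite jump_rate_total// funenegE; rewrite (_ : maxe _ _ = (- f i)%E).
  by rewrite /f muleN.
by apply/max_idPl; rewrite oppe_ge0.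
Qed.

End rates.

(** * Cost rate, jump rates and state just before a given time *)
Section left_state.
Context (R : realType) dS (S : measurableType dS).
Implicit Types (w : Omega R S) (t v : R) (k n m : nat).

(** The left limit, with Delta off the stages whatever the default value of the
    left limit at the explosion time. *)
Definition left_state w t : option S :=
  if (0 < t) && (t%:E < explosion w)%E then xi_left w t else None.

Lemma left_state_stage w k t : stage w k t -> left_state w t = mark w k.
Proof.
move=> st; rewrite /left_state (stage_gt0 st) (stage_lt_explosion st).
exact: xi_left_stage.
Qed.

Lemma left_state_off w t : (forall k, ~~ stage w k t) -> left_state w t = None.
Proof.
move=> ns; rewrite /left_state; case: ifPn => // /andP[t0 te].
by have [k sk] := stage_exists t0 te; have := ns k; rewrite sk.
Qed.

Lemma left_stateE w t : 0 < t -> ~ jump_times w t -> left_state w t = xi w t.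
Proof.
move=> t0 nt; rewrite /left_state t0 /=; case: ltP => [_|H]; first exact: xi_leftE.
by rewrite xi_explosion.
Qed.

Lemma stage_below w k t v : stage w k t -> 0 < v -> v <= t ->
  exists2 n, (n <= k)%N & stage w n v.
Proof.
move=> st v0 vt; have [|n sn] := stage_exists (w := w) v0.
  by rewrite (le_lt_trans _ (stage_lt_explosion st))// lee_fin.
exists n => //; rewrite leqNgt; apply/negP => kn.
have /andP[nv _] := sn; have /andP[_ tk] := st.
have := lt_le_trans nv (_ : (v%:E <= t%:E)%E); rewrite lee_fin => /(_ vt) nt.
by have := lt_le_trans nt tk; rewrite ltNge le_jump_time.
Qed.

Lemma le_stage w k t v : stage w k t -> v <= t -> (v%:E <= jump_time w k.+1)%E.
Proof. by move=> /andP[_ tk] vt; rewrite (le_trans _ tk)// lee_fin. Qed.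

Lemma left_state_stop w k t v : stage w k t -> 0 < v -> v <= t ->
  left_state (stop k w) v = left_state w v.
Proof.
move=> st v0 vt; have [n nk sn] := stage_below st v0 vt.
rewrite (left_state_stage sn); have := sn; rewrite -(stage_stop _ (le_stage st vt)).
by move=> /left_state_stage ->; rewrite mark_stop.
Qed.

Hypotheses (S_countable : countable [set: S]) (S_discrete : forall B : set S, measurable B).

Lemma measurable_left_state d' (Y : measurableType d') (F : R -> option S -> Y) (y : Y) :
  (forall t, F t None = y) -> (forall i, measurable_fun setT (F ^~ (Some i))) ->
  measurable_fun setT (fun x : Omega R S * R => F x.2 (left_state x.1 x.2)).
Proof.
move=> FN mF; apply: (measurable_by_stages S_countable S_discrete (y := y)) => [k i|[w t] ns].
  exists (fun x => F x.2 (Some i)); first exact: (measurableT_comp (mF i) measurable_snd).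
  by move=> [w t] [/= st mi]; rewrite (left_state_stage st) mi.
by rewrite /= left_state_off.
Qed.

End left_state.

Section left_processes.
Context (R : realType) dS (S : measurableType dS) (A : ptopologicalType).
Variables (mdp : ctmdp R S A) (pi : policy mdp).
Hypotheses (S_countable : countable [set: S]) (S_discrete : forall B : set S, measurable B).
Implicit Types (w : Omega R S) (t v : R) (k n : nat) (i j : S).

(** The cost rate and the transition rates at the state just before t.  They agree
    with those at the current state off the jump times. *)
Definition left_cost w t : R :=
  \int[action_law pi w t]_a cost_ext mdp t (left_state w t) a.

Definition left_rate w t j : \bar R :=
  (\int[action_law pi w t]_a rate_ext mdp t (left_state w t) a [set j])%E.

Definition intensity w t j : \bar R :=
  (\int[action_law pi w t]_a
     rate_ext mdp t (left_state w t) a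
       ([set j] `\` [set k | left_state w t = Some k]))%E.

Lemma measurable_cost_restrict i :
  measurable_fun setT (fun x : R * borel A => ((cost mdp \_ (graph mdp)) (x.1, i, x.2))%:E).
Proof.
have m : measurable_fun setT (cost mdp \_ (graph mdp)).
  apply/(measurable_restrictT _ (graph_measurable mdp)); exact: cost_measurable.
apply/measurable_EFinP; apply: (measurableT_comp m); apply: measurable_fun_pair; last exact: measurable_snd.
by apply: measurable_fun_pair; [exact: measurable_fst|exact: measurable_cst].
Qed.

Lemma measurable_section_action (G : R * borel A -> \bar R) t :
  measurable_fun setT G -> measurable_fun setT (fun a : borel A => G (t, a)).
Proof. by move=> mG; exact: (measurableT_comp mG (pair1_measurable t)). Qed.

Lemma left_cost_stage w k t i : stage w k t -> mark w k = Some i ->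
  left_cost w t = \int[stage_law pi w k t]_a (cost mdp \_ (graph mdp)) (t, i, a).
Proof.
move=> st mi; rewrite /left_cost /Rintegral (left_state_stage st) mi; congr fine.
rewrite (integral_action_law pi st (f := fun a => (cost_ext mdp t (Some i) a)%:E))//.
exact: (measurable_section_action t (measurable_cost_restrict i)).
Qed.

Lemma left_cost_off w t : (forall k, ~~ stage w k t) -> left_cost w t = 0.
Proof.
move=> ns; rewrite /left_cost left_state_off// /Rintegral /=.
by rewrite integral0.
Qed.

Lemma measurable_left_cost :
  measurable_fun setT (fun x : Omega R S * R => left_cost x.1 x.2).
Proof.
apply: (measurable_by_stages S_countable S_discrete (y := (0:R))) => [k i|[w t] ns].
  have [g mg gE] := measurable_stage_integral pi S_countable S_discrete k (measurable_cost_restrict i).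
  exists (fine \o g); first by apply: measurableT_comp => //; exact: fine_measurable.
  by move=> [w t] [/= st mi]; rewrite (left_cost_stage st mi) /Rintegral -(gE (w, t)).
by rewrite /= left_cost_off.
Qed.

Lemma left_cost_le w k t i (C : R) : stage w k t -> mark w k = Some i -> 0 <= C ->
  (forall a, graph mdp (t, i, a) -> `|cost mdp (t, i, a)| <= C) ->
  `|left_cost w t| <= C.
Proof.
move=> st mi C0 cC; rewrite (left_cost_stage st mi).
have cC' a : `|(cost mdp \_ (graph mdp)) (t, i, a)| <= C.
  by rewrite patchE; case: ifPn => [/set_mem/cC//|_]; rewrite normr0.
have mc := measurable_section_action t (measurable_cost_restrict i).
set mu := stage_law pi w k t.
have H : (\int[mu]_a `|((cost mdp \_ (graph mdp)) (t, i, a))%:E| <= C%:E)%E.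
  apply: (@le_trans _ _ (\int[mu]_a (cst C%:E) a)%E).
    apply: ge0_le_integral => //; first exact: measurableT_comp.
    by move=> a _; rewrite lee_fin.
  by rewrite integral_cst// stage_law_setT mule1.
have ic : mu.-integrable setT (fun a => ((cost mdp \_ (graph mdp)) (t, i, a))%:E).
  by apply/integrableP; split => //; rewrite (le_lt_trans H)// ltry.
apply: (le_trans (le_normr_Rintegral _ ic)) => //.
by rewrite -lee_fin fineK// (integrable_fin_num _ (integrable_norm ic)).
Qed.

Lemma stage_law_stop w k n t : (n <= k)%N -> stage_law pi (stop k w) n t = stage_law pi w n t.
Proof.
move=> nk; rewrite /stage_law jump_time_stop//.
suff -> : history (stop k w) n = history w n by [].
rewrite /history; congr pair; apply: eq_from_tnth => m; rewrite !tnth_mktuple.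
have mk := leq_trans (ltn_ord m) nk.
by rewrite sojourn_stop mk mark_stop.
Qed.

Lemma left_cost_stop w k t v : stage w k t -> 0 < v -> v <= t ->
  left_cost (stop k w) v = left_cost w v.
Proof.
move=> st v0 vt; have [n nk sn] := stage_below st v0 vt.
have [i mi] := mark_some (stage_finite sn).
rewrite (left_cost_stage sn mi); have := sn; rewrite -(stage_stop _ (le_stage st vt)).
move=> sn'; have mi' : mark (stop k w) n = Some i by rewrite mark_stop.
by rewrite (left_cost_stage sn' mi') stage_law_stop.
Qed.

Lemma intensity_stage w k t i j : stage w k t -> mark w k = Some i ->
  intensity w t j = (\int[stage_law pi w k t]_a jump_rate mdp t i a j)%E.
Proof.
move=> st mi; rewrite /intensity (left_state_stage st) mi.
have E a : rate_ext mdp t (Some i) (Some a) ([set j] `\` [set l | Some i = Some l]) =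
    jump_rate mdp t i a j.
  rewrite /jump_rate /=; case: eqVneq => [->|ji].
    rewrite (_ : _ `\` _ = set0); last by apply/seteqP; split => x //= [-> []].
    by rewrite patchE; case: ifP => // _; rewrite charge0.
  rewrite (_ : _ `\` _ = [set j])//; apply/seteqP; split => x /=; first by case.
  by move=> ->; split => // -[] /eqP; rewrite eq_sym (negbTE ji).
rewrite (integral_action_law pi st); first by apply: eq_integral => a _; exact: E.
rewrite (_ : _ \o _ = fun a => jump_rate mdp t i a j); last by apply/funext => a; exact: E.
exact: (measurable_section_action t (measurable_jump_rate mdp S_discrete i j)).
Qed.

Lemma intensity_off w t j : (forall k, ~~ stage w k t) -> intensity w t j = 0%E.
Proof. by move=> ns; rewrite /intensity left_state_off//= integral0. Qed.

Lemma intensity_ge0 w t j : (0 <= intensity w t j)%E.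
Proof.
have [[k st]|/forallNP ns] := pselect (exists k, stage w k t).
  have [i mi] := mark_some (stage_finite st).
  by rewrite (intensity_stage _ st mi) integral_ge0// => a _; exact: jump_rate_ge0.
by rewrite intensity_off// => k; apply/negP.
Qed.

Lemma measurable_intensity j :
  measurable_fun setT (fun x : Omega R S * R => intensity x.1 x.2 j).
Proof.
apply: (measurable_by_stages S_countable S_discrete (y := 0%E)) => [k i|[w t] ns].
  have [g mg gE] := measurable_stage_integral pi S_countable S_discrete k
    (measurable_jump_rate mdp S_discrete i j).
  by exists g => // -[w t] [/= st mi]; rewrite (intensity_stage _ st mi) -(gE (w, t)).
by rewrite /= intensity_off.
Qed.

(** From the explosion time on, the action law is concentrated on the action with
    zero rates. *)
Lemma jump_intensityE w t j : 0 < t -> jump_intensity pi w t j = intensity w t j.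
Proof.
move=> t0; have [[k st]|/forallNP ns] := pselect (exists k, stage w k t).
  by rewrite /jump_intensity /intensity (left_state_stage st) (xi_left_stage st).
have {}ns k : ~~ stage w k t by apply/negP.
rewrite intensity_off// /jump_intensity (integral_action_law_off pi t0 ns).
  by rewrite /rate_ext; case: (xi_left w t).
rewrite /comp /=; case: (xi_left w t) => [i|]; last exact: measurable_cst.
exact: (measurable_section_action t (measurable_restricted_rate mdp S_discrete i _)).
Qed.

Lemma intensity_sum w k t i : stage w k t -> mark w k = Some i ->
  \esum_(j in [set: S]) intensity w t j =
  (\int[stage_law pi w k t]_a \esum_(j in [set: S]) jump_rate mdp t i a j)%E.
Proof.
move=> st mi; rewrite integral_esum//.
- by apply: eq_esum => j _; exact: intensity_stage.
- by move=> a j; exact: jump_rate_ge0.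
- by move=> j; exact: (measurable_section_action t (measurable_jump_rate mdp S_discrete i j)).
Qed.

Lemma measurable_jump_rate_total t i (U : S -> R) : (forall j, 0 <= U j) ->
  measurable_fun setT (fun a => \esum_(j in [set: S]) ((U j)%:E * jump_rate mdp t i a j)%E).
Proof.
move=> U0; apply: measurable_esum => //.
  by move=> a j; rewrite mule_ge0 ?lee_fin// jump_rate_ge0.
move=> j; apply: emeasurable_funM; first exact: measurable_cst.
exact: (measurable_section_action t (measurable_jump_rate mdp S_discrete i j)).
Qed.

Lemma intensity_sum_le w k t i (b : R) : stage w k t -> mark w k = Some i ->
  0 <= b -> (qstar mdp i <= b%:E)%E ->
  (\esum_(j in [set: S]) intensity w t j <= b%:E)%E.
Proof.
move=> st mi b0 qb; rewrite (intensity_sum st mi).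
apply: (@le_trans _ _ (\int[stage_law pi w k t]_a (cst b%:E) a)%E).
  apply: ge0_le_integral => //.
  - by move=> a _; apply: esum_ge0 => j _; exact: jump_rate_ge0.
  - have := @measurable_jump_rate_total t i (fun=> 1) (fun=> ler01).
    by under eq_fun do under eq_esum do rewrite mul1e.
  - by move=> a _; exact: jump_rate_total_le.
by rewrite integral_cst// stage_law_setT mule1.
Qed.

Lemma intensity_drift (U : S -> R) (rho : R) w k t i : stage w k t -> mark w k = Some i ->
  (forall j, 0 <= U j) -> 0 <= rho ->
  (forall a, graph mdp (t, i, a) ->
   (signed_sum (fun j => (U j)%:E * rate mdp (t, i, a) [set j]) <= (rho * U i)%:E)%E) ->
  (\esum_(j in [set: S]) ((U j)%:E * intensity w t j) <=
    (rho * U i)%:E + (U i)%:E * \esum_(j in [set: S]) intensity w t j)%E.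
Proof.
move=> st mi U0 rho0 H; set mu := stage_law pi w k t.
have mj j := measurable_section_action t (measurable_jump_rate mdp S_discrete i j).
have -> : \esum_(j in [set: S]) ((U j)%:E * intensity w t j)%E =
    (\int[mu]_a \esum_(j in [set: S]) ((U j)%:E * jump_rate mdp t i a j))%E.
  rewrite integral_esum//.
  - apply: eq_esum => j _; rewrite (intensity_stage _ st mi) ge0_integralZl_EFin//.
    by move=> a _; exact: jump_rate_ge0.
  - by move=> a j; rewrite mule_ge0 ?lee_fin// jump_rate_ge0.
  - by move=> j; apply: emeasurable_funM => //; exact: measurable_cst.
have mT : measurable_fun setT (fun a => \esum_(j in [set: S]) jump_rate mdp t i a j).
  have := @measurable_jump_rate_total t i (fun=> 1) (fun=> ler01).
  by under eq_fun do under eq_esum do rewrite mul1e.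
have T0 a : (0 <= \esum_(j in [set: S]) jump_rate mdp t i a j)%E.
  by apply: esum_ge0 => j _; exact: jump_rate_ge0.
rewrite (intensity_sum st mi) -ge0_integralZl_EFin//.
apply: (@le_trans _ _ (\int[mu]_a ((rho * U i)%:E + (U i)%:E * \esum_(j in [set: S]) jump_rate mdp t i a j))%E).
  apply: ge0_le_integral => //.
  - by move=> a _; apply: esum_ge0 => j _; rewrite mule_ge0 ?lee_fin// jump_rate_ge0.
  - exact: measurable_jump_rate_total.
  - by apply: emeasurable_funD => //; apply: emeasurable_funM => //; exact: measurable_cst.
  - by move=> a _; apply: jump_rate_drift => //; exact: H.
rewrite ge0_integralD//.
- by rewrite integral_cst// stage_law_setT mule1.
- by move=> a _; rewrite lee_fin mulr_ge0.
- by move=> a _; rewrite mule_ge0 ?lee_fin.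
- by apply: emeasurable_funM => //; exact: measurable_cst.
Qed.

(** The rates sum to zero, which determines the diagonal one. *)
Lemma left_rateE w k t i j : stage w k t -> mark w k = Some i ->
  left_rate w t j =
    (if j == i then - \esum_(l in [set: S]) intensity w t l else intensity w t j)%E.
Proof.
move=> st mi; rewrite /left_rate (left_state_stage st) mi (integral_action_law pi st); last first.
  exact: (measurable_section_action t (measurable_restricted_rate mdp S_discrete i [set j])).
case: eqVneq => [->|ji]; last first.
  rewrite (intensity_stage _ st mi); apply: eq_integral => a _.
  by rewrite /jump_rate (negbTE ji).
rewrite (intensity_sum st mi) -integral_ge0N; last first.
  by move=> a _; apply: esum_ge0 => l _; exact: jump_rate_ge0.
apply: eq_integral => a _; rewrite /= patchE; case: ifPn => [/set_mem g|g].
  by rewrite jump_rate_total// oppeK.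
by rewrite esum1 ?oppe0// => l _; rewrite jump_rate_off// => g'; move: g; rewrite mem_set.
Qed.

End left_processes.

(** * Integrals over time *)
Section exponential_integrals.
Context (R : realType).
Notation mu := (@lebesgue_measure R).
Variable beta : R.

Let F (x : R) := - expR (- beta * x).
Let f (x : R) := beta * expR (- beta * x).

Let continuous_exp : continuous (fun z : R^o => expR (- beta * z)).
Proof.
move=> z; apply: continuous_comp; last exact: continuous_expR.
by apply: continuousM => //; apply: (@continuousN _ R^o); exact: cst_continuous.
Qed.

Let continuous_f : continuous (f : R^o -> R).
Proof.
move=> z; apply: (@continuousM _ R^o (fun=> beta) (fun x => expR (- beta * x))).
  exact: cst_continuous.
exact: continuous_exp.
Qed.

Let derivF z : F^`()%classic z = f z.
Proof.
rewrite derive1_comp// derive1N// derive1_id mulN1r derive1_comp// derive1E.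
have /funeqP -> := @derive_expR R.
by rewrite derive1Ml// derive1_id mulr1 mulrN opprK mulrC.
Qed.

Lemma integral_exp_itv (a b : R) : a < b ->
  (\int[mu]_(x in `]a, b]) (beta * expR (- beta * x))%:E =
   (expR (- beta * a) - expR (- beta * b))%:E)%E.
Proof.
move=> ab; rewrite integral_itv_obnd_cbnd; last first.
  apply/measurable_EFinP; apply: measurable_funTS.
  exact: (continuous_measurable_fun continuous_f).
rewrite (@continuous_FTC2 _ f F)//.
- by rewrite /F -EFinD opprK addrC.
- exact: continuous_subspaceT.
- split.
  + by move=> z _; exact: ex_derive.
  + by apply/cvg_at_right_filter; apply: cvgN; exact: continuous_exp.
  + by apply/cvg_at_left_filter; apply: cvgN; exact: continuous_exp.
Qed.

Lemma integral_exp_itvy (a : R) : 0 < beta ->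
  (\int[mu]_(x in `]a, +oo[) (beta * expR (- beta * x))%:E =
   (expR (- beta * a))%:E)%E.
Proof.
move=> b0; rewrite integral_itv_obnd_cbnd; last first.
  apply/measurable_EFinP; apply: measurable_funTS.
  exact: (continuous_measurable_fun continuous_f).
rewrite (@ge0_continuous_FTC2y _ f F _ 0)//.
- by rewrite add0e -EFinN opprK.
- by move=> x _; rewrite mulr_ge0 ?expR_ge0// ltW.
- exact: continuous_subspaceT.
- rewrite -oppr0; apply: cvgN.
  rewrite (_ : (fun x => expR (- beta * x)) =
               (fun z => expR (- z)) \o (fun z => beta * z)); last first.
    by apply: eq_fun => x; rewrite mulNr.
  apply: (@cvg_comp _ _ _ _ _ _ (pinfty_nbhs R)); last exact: cvgr_expR.
  exact: gt0_cvgMry.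
- by apply: cvgN; apply/cvg_at_right_filter; exact: continuous_exp.
Qed.

End exponential_integrals.

Section time_integral.
Context (R : realType) d (X : measurableType d).
Notation mu := (@lebesgue_measure R).

Lemma measurable_time_integral (D : set R) (f : X * R -> \bar R) :
  measurable D -> measurable_fun setT f -> (forall x, 0 <= f x)%E ->
  measurable_fun setT (fun w => \int[mu]_(t in D) f (w, t))%E.
Proof.
move=> mD mf f0.
pose g (x : X * R) : \bar R := if x.2 \in D then f x else 0%E.
have mg : measurable_fun setT g.
  apply: measurable_fun_ifT => //.
  apply: (measurable_fun_bool true); rewrite setTI.
  rewrite (_ : _ @^-1` _ = setT `*` D); first exact: measurableX.
  by apply/seteqP; split => x /=; [move=> /set_mem|move=> [_ /mem_set]].
have := @measurable_fun_fubini_tonelli_F _ _ X (measurableTypeR R) R mu g mg.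
rewrite (_ : fubini_F mu g = fun w => \int[mu]_(t in D) f (w, t))%E.
  by apply => x; rewrite /g; case: ifP.
by apply/funext => w; rewrite [RHS]integral_mkcond.
Qed.

Lemma measurable_section_time d' (Z : measurableType d') (f : X * R -> Z) w :
  measurable_fun setT f -> measurable_fun setT (fun t => f (w, t)).
Proof. by move=> mf; exact: (measurableT_comp mf (pair1_measurable w)). Qed.

End time_integral.

Section stage_discount.
Context (R : realType) dS (S : measurableType dS).
Notation mu := (@lebesgue_measure R).
Implicit Types (w : Omega R S) (n : nat).

Lemma integral_stage w n (f : R -> \bar R) : (jump_time w n < +oo)%E ->
  (\int[mu]_(t in `]0%R, +oo[) (if stage w n t then f t else 0) =
   if (jump_time w n.+1 < +oo)%E then
     \int[mu]_(t in `](fine (jump_time w n)), (fine (jump_time w n.+1))]) f t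
   else \int[mu]_(t in `](fine (jump_time w n)), +oo[) f t)%E.
Proof.
move=> F; have a0 : 0 <= fine (jump_time w n) by rewrite fine_ge0// jump_time_ge0.
case: ifPn => [F1|F1]; rewrite integral_mkcond [RHS]integral_mkcond.
  apply: eq_integral => t _; rewrite !patchE !mem_setE !in_itv/= andbT.
  rewrite /stage (jump_time_finE F) (jump_time_finE F1) lte_fin lee_fin.
  case: ifPn => t0 //; case: ifPn => // /andP[at_ _]; move: t0.
  by rewrite (le_lt_trans a0 at_).
apply: eq_integral => t _; rewrite !patchE !mem_setE !in_itv/= !andbT.
rewrite /stage (jump_time_finE F) lte_fin.
have -> : jump_time w n.+1 = +oo%E by apply/eqP; rewrite -leye_eq leNgt.
rewrite leey andbT; case: ifPn => t0 //; case: ifPn => // at_; move: t0.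
by rewrite (le_lt_trans a0 at_).
Qed.

Lemma discount_stage (beta : R) w n : 0 < beta -> (jump_time w n < +oo)%E ->
  (\int[mu]_(t in `]0%R, +oo[)
      (if stage w n t then (beta * expR (- beta * t))%:E else 0) =
   (expR (- beta * fine (jump_time w n)) -
     (if (jump_time w n.+1 < +oo)%E then expR (- beta * fine (jump_time w n.+1)) else 0))%:E)%E.
Proof.
move=> b0 F; rewrite integral_stage//; case: ifPn => F1.
  rewrite integral_exp_itv// -lte_fin -!jump_time_finE//.
  exact: jump_time_ltS.
by rewrite integral_exp_itvy// subr0.
Qed.

End stage_discount.

(** * The compensator on processes that depend on the past *)
Section compensation.
Context (R : realType) dS (S : measurableType dS) (A : ptopologicalType).
Variables (mdp : ctmdp R S A) (pi : policy mdp) (P : probability (Omega R S) R).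
Hypotheses (S_countable : countable [set: S]) (S_discrete : forall B : set S, measurable B).
Hypothesis comp : is_compensator P (jump_intensity pi).
Notation mu := (@lebesgue_measure R).
Implicit Types (w : Omega R S) (t : R) (k n : nat) (i j : S).

(** The defining identity of the compensator, for integrands that are given by
    joint measurability and dependence on the past instead of predictability. *)
Lemma compensator_formula (W : Omega R S * R * S -> \bar R) :
  (forall x, 0 <= W x)%E ->
  (forall j, measurable_fun setT (fun x : Omega R S * R => W (x, j))) ->
  (forall k w t j, stage w k t -> W (w, t, j) = W (stop k w, t, j)) ->
  (forall w t j, (forall k, ~~ stage w k t) -> W (w, t, j) = 0%E) ->
  (\int[P]_w mpp_integral W w =
   \int[P]_w \int[mu]_(t in `]0%R, +oo[)
      \esum_(j in [set: S]) (W (w, t, j) * intensity pi w t j))%E.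
Proof.
move=> W0 mW Wstop Woff; have [_ cW] := comp.
have mWp : measurable_fun setT (W : predictable_type R S * S -> \bar R).
  apply: measurable_fun_discrete_snd => // j.
  apply: (@predictable_of_stop _ _ _ _ _ (fun x => W (x, j)) 0%E) => //.
  - by move=> k w t; exact: Wstop.
  - by move=> w t; exact: Woff.
rewrite (cW W W0); last exact: measurable_funTS mWp.
apply: eq_integral => w _; apply: eq_integral => t; rewrite inE/= in_itv/= andbT => t0.
by apply: eq_esum => j _; rewrite jump_intensityE.
Qed.

Section stage_weight.
Variables (beta : R) (G : option S -> S -> R).
Hypothesis G0 : forall x j, 0 <= G x j.

(** Discounted weight of a jump to the state x.2, counted on the n-th stage only:
    along a trajectory it picks out the (n+1)-st jump. *)
Definition stage_weight n (x : Omega R S * R * S) : \bar R :=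
  if stage x.1.1 n x.1.2 then (expR (- beta * x.1.2) * G (mark x.1.1 n) x.2)%:E else 0%E.

Definition jump_weight n w : \bar R :=
  match jump_time w n.+1, mark w n.+1 with
  | t%:E, Some j => (expR (- beta * t) * G (mark w n) j)%:E
  | _, _ => 0%E
  end.

Lemma stage_weight_ge0 n x : (0 <= stage_weight n x)%E.
Proof. by rewrite /stage_weight; case: ifP => // _; rewrite lee_fin mulr_ge0// expR_ge0. Qed.

Lemma measurable_expM : measurable_fun setT (fun t : R => expR (- beta * t)).
Proof. by apply: measurableT_comp => //; exact: measurable_funM. Qed.

Lemma measurable_stage_weight n j :
  measurable_fun setT (fun x : Omega R S * R => stage_weight n (x, j)).
Proof.
apply: (measurable_by_stages S_countable S_discrete (y := 0%E)) => [k i|[w t] ns]; last first.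
  by rewrite /stage_weight /= (negbTE (ns n)).
have [->|kn] := eqVneq k n; last first.
  exists (cst 0%E) => [|[w t] [/= st mi]]; first exact: measurable_cst.
  rewrite /stage_weight /=; case: ifP => // sn.
  by move: kn; rewrite (stage_uniq st sn) eqxx.
exists (fun x => (expR (- beta * x.2) * G (Some i) j)%:E).
  apply/measurable_EFinP; apply: measurable_funM; last exact: measurable_cst.
  exact: (measurableT_comp measurable_expM measurable_snd).
by move=> [w t] [/= st mi]; rewrite /stage_weight /= st mi.
Qed.

Lemma mpp_stage_weight n w : mpp_integral (stage_weight n) w = jump_weight n w.
Proof.
rewrite /mpp_integral (@nneseries_single R _ 1 n.+1)//.
- rewrite /jump_weight; case E : (jump_time w n.+1) => [t| |] //.
  case: (mark w n.+1) => // j; rewrite /stage_weight /= ifT//.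
  rewrite /stage -E lexx andbT; apply: jump_time_ltS.
  by rewrite (le_lt_trans (jump_time_leS w n))// E ltry.
- move=> m mn; case E : (jump_time w m) => [t| |] //.
  case: (mark w m) => // j; rewrite /stage_weight /= ifF//.
  apply/negbTE; rewrite /stage -E; apply/negP => /andP[nm mn1].
  have mF : (jump_time w m < +oo)%E by rewrite E ltry.
  have [nm'|mn'] := ltnP n m; last first.
    by have := le_jump_time w mn'; rewrite leNgt nm.
  have mn2 : (n.+1 < m)%N by rewrite ltn_neqAle eq_sym mn.
  have := lt_jump_time mn2 (le_lt_trans (le_jump_time w nm') mF).
  by rewrite ltNge mn1.
- by case: (jump_time w n.+1) => // t; case: (mark w n.+1) => // j; exact: stage_weight_ge0.
Qed.

Lemma stage_weight_formula n :
  (\int[P]_w jump_weight n w =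
   \int[P]_w \int[mu]_(t in `]0%R, +oo[)
      \esum_(j in [set: S]) (stage_weight n (w, t, j) * intensity pi w t j))%E.
Proof.
rewrite -compensator_formula//.
- by apply: eq_integral => w _; rewrite mpp_stage_weight.
- exact: stage_weight_ge0.
- exact: measurable_stage_weight.
- move=> k w t j st; rewrite /stage_weight /= stage_stop; last by case/andP: st.
  case: ifPn => // sn; rewrite mark_stop//.
  by rewrite (stage_uniq sn st).
- by move=> w t j ns; rewrite /stage_weight /= (negbTE (ns n)).
Qed.

Lemma measurable_stage_intensity n :
  measurable_fun setT (fun x : Omega R S * R =>
    \esum_(j in [set: S]) (stage_weight n (x, j) * intensity pi x.1 x.2 j)%E).
Proof.
apply: measurable_esum => //.
  by move=> x j; rewrite mule_ge0 ?stage_weight_ge0// intensity_ge0.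
move=> j; apply: emeasurable_funM; first exact: measurable_stage_weight.
exact: measurable_intensity.
Qed.

Lemma stage_intensity_ge0 n (x : Omega R S * R) :
  (0 <= \esum_(j in [set: S]) (stage_weight n (x, j) * intensity pi x.1 x.2 j))%E.
Proof.
apply: esum_ge0 => j _.
by rewrite mule_ge0 ?stage_weight_ge0// intensity_ge0.
Qed.

End stage_weight.

End compensation.

(** * Discounted occupation of a weight with bounded drift *)
Section occupation.
Context (R : realType) dS (S : measurableType dS) (A : ptopologicalType).
Variables (mdp : ctmdp R S A) (pi : policy mdp) (P : probability (Omega R S) R).
Hypotheses (S_countable : countable [set: S]) (S_discrete : forall B : set S, measurable B).
Hypothesis comp : is_compensator P (jump_intensity pi).
Notation mu := (@lebesgue_measure R).
Implicit Types (w : Omega R S) (t : R) (k n : nat) (i j : S).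

Variables (U : S -> R) (rho : R).
Hypotheses (U0 : forall j, 0 <= U j) (rho0 : 0 <= rho).
Hypothesis U_drift : forall t i a, graph mdp (t, i, a) ->
  (signed_sum (fun j => (U j)%:E * rate mdp (t, i, a) [set j]) <= (rho * U i)%:E)%E.

Let beta := rho + 1.
Let beta0 : 0 < beta. Proof. by rewrite ltr_wpDl. Qed.
Let Uo (x : option S) := oapp U 0 x.
Let Uo0 x : 0 <= Uo x. Proof. by case: x => /=. Qed.

(* With T_n the jump times: a n is the expected value of exp (- beta T_n) U(X_n),
   old n that of exp (- beta T_(n+1)) U(X_n), and o n the expected discounted
   occupation of U on the n-th stage. *)

Let O n := stage_weight beta (fun x _ => Uo x) n.
Let o n : \bar R := (\int[P]_w \int[mu]_(t in `]0%R, +oo[) O n (w, t, point))%E.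
Let old n : \bar R := (\int[P]_w jump_weight beta (fun x _ => Uo x) n w)%E.
Let new n : \bar R := (\int[P]_w jump_weight beta (fun _ j => U j) n w)%E.
Let a n : \bar R := if n is m.+1 then new m else (\int[P]_w (Uo (mark w 0))%:E)%E.

Let mO n : measurable_fun setT (fun x : Omega R S * R => O n (x, point)).
Proof. exact: measurable_stage_weight. Qed.

Let O0 n x : (0 <= O n x)%E. Proof. exact: stage_weight_ge0. Qed.

Let moint n : measurable_fun setT (fun w : Omega R S => \int[mu]_(t in `]0%R, +oo[) O n (w, t, point))%E.
Proof. by apply: (measurable_time_integral (f := fun x => O n (x, point))). Qed.

(* The drift condition on U, through the compensator. *)
Let new_le n : (new n <= rho%:E * o n + old n)%E.
Proof.
rewrite /new /old !(stage_weight_formula S_countable S_discrete comp)//.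
pose f (w : Omega R S) t := (\esum_(j in [set: S])
  (stage_weight beta (fun x _ => Uo x) n (w, t, j) * intensity pi w t j))%E.
have f0 (w : Omega R S) t : (0 <= f w t)%E by exact: stage_intensity_ge0.
have mf : measurable_fun setT (fun x : Omega R S * R => f x.1 x.2).
  have := measurable_stage_intensity pi S_countable S_discrete beta (fun x _ => Uo0 x) n.
  by congr (measurable_fun setT); apply/funext => -[].
have mfw : measurable_fun setT (fun w : Omega R S => \int[mu]_(t in `]0%R, +oo[) f w t)%E.
  exact: (measurable_time_integral (f := fun x => f x.1 x.2)).
rewrite -[X in (_ <= _ + X)%E]/(\int[P]_w \int[mu]_(t in `]0%R, +oo[) f w t)%E.
have fge0 (w : Omega R S) : (0 <= \int[mu]_(t in `]0%R, +oo[) f w t)%E by exact: integral_ge0.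
have oge0 (w : Omega R S) : (0 <= \int[mu]_(t in `]0%R, +oo[) O n (w, t, point))%E by exact: integral_ge0.
rewrite /o -ge0_integralZl_EFin// -ge0_integralD//; last 2 first.
- by move=> w _; rewrite mule_ge0// lee_fin.
- by apply: emeasurable_funM => //; exact: measurable_cst.
apply: (ge0_le_integral _ measurableT).
- by move=> w _; apply: integral_ge0 => t _; exact: stage_intensity_ge0.
- apply: (measurable_time_integral (f := fun x : Omega R S * R => \esum_(j in [set: S])
    (stage_weight beta (fun _ j => U j) n (x, j) * intensity pi x.1 x.2 j)%E)) => //.
    exact: measurable_stage_intensity.
  by move=> x; exact: stage_intensity_ge0.
- by apply: emeasurable_funD => //; apply: emeasurable_funM => //; exact: measurable_cst.
move=> w _.
have mfs : measurable_fun setT (f w).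
  exact: (measurable_section_time (f := fun x => f x.1 x.2) w mf).
have mOs : measurable_fun setT (fun t => O n (w, t, point)).
  exact: (measurable_section_time w (mO n)).
have mOD : measurable_fun (`]0%R, +oo[%classic : set R) (fun t => O n (w, t, point)) by exact: measurable_funTS.
have mfD : measurable_fun (`]0%R, +oo[%classic : set R) (f w) by exact: measurable_funTS.
rewrite -ge0_integralZl_EFin//.
rewrite -ge0_integralD//; last 2 first.
- by move=> t _; rewrite mule_ge0// lee_fin.
- by apply: emeasurable_funM => //; exact: measurable_cst.
apply: ge0_le_integral => //.
- by move=> t _; exact: stage_intensity_ge0.
- apply: measurable_funTS.
  have m := measurable_stage_intensity pi S_countable S_discrete beta (fun (_ : option S) j => U0 j) n.
  exact: (measurable_section_time w m).
- apply: measurable_funTS; apply: emeasurable_funD => //.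
  by apply: emeasurable_funM => //; exact: measurable_cst.
move=> t _; rewrite /f /O /stage_weight /=; case: ifPn => st; last first.
  by rewrite !mule0 add0e !esum1// => j _; rewrite mul0e.
have [i mi] := mark_some (stage_finite st); rewrite mi /=.
have e0 : 0 <= expR (- beta * t) by exact: expR_ge0.
have I0 j : (0 <= intensity pi w t j)%E by exact: intensity_ge0.
under eq_esum do rewrite EFinM -muleA.
under [X in (_ <= _ + X)%E]eq_esum do rewrite EFinM -muleA.
rewrite !esumZl//; last 2 first.
- by move=> j; rewrite mule_ge0 ?lee_fin.
- by move=> j; rewrite mule_ge0 ?lee_fin.
have := intensity_drift pi S_countable S_discrete st mi U0 rho0 (@U_drift t i).
move=> /(lee_wpmul2l (_ : (0 <= (expR (- beta * t))%:E)%E)) H.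
apply: (le_trans (H _)); first by rewrite lee_fin.
rewrite ge0_muleDr ?lee_fin ?mulr_ge0//; last by rewrite mule_ge0 ?lee_fin// esum_ge0.
by rewrite -!EFinM mulrCA.
Qed.

Let disc m n w : \bar R := if (jump_time w m < +oo)%E
  then (expR (- beta * fine (jump_time w m)) * Uo (mark w n))%:E else 0%E.

Let mdisc m n : measurable_fun setT (disc m n).
Proof.
apply: measurable_fun_ifT => //.
- exact: measurable_jump_finite.
- apply/measurable_EFinP; apply: measurable_funM.
    apply: (measurableT_comp (measurable_expM beta) (g := fun w : Omega R S => fine (jump_time w m))).
    apply: (measurableT_comp _ (@measurable_jump_time R dS S m)).
    exact: fine_measurable.
  exact: (measurable_mark_fun S_countable S_discrete Uo n).
Qed.

Let disc0 m n w : (0 <= disc m n w)%E.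
Proof. by rewrite /disc; case: ifP => // _; rewrite lee_fin mulr_ge0// expR_ge0. Qed.

Let newE n w : jump_weight beta (fun _ j => U j) n w = disc n.+1 n.+1 w.
Proof.
rewrite /jump_weight /disc; case E : (jump_time w n.+1) => [t| |].
- have [|j mj] := @mark_some _ _ _ w n.+1; first by rewrite E ltry.
  by rewrite mj ltry.
- by rewrite ltxx.
- by have := jump_time_ge0 w n.+1; rewrite E.
Qed.

Let oldE n w : jump_weight beta (fun x _ => Uo x) n w = disc n.+1 n w.
Proof.
rewrite /jump_weight /disc; case E : (jump_time w n.+1) => [t| |].
- have [|j mj] := @mark_some _ _ _ w n.+1; first by rewrite E ltry.
  by rewrite mj ltry.
- by rewrite ltxx.
- by have := jump_time_ge0 w n.+1; rewrite E.
Qed.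

Let disc_split n w : disc n n w =
  (beta%:E * \int[mu]_(t in `]0%R, +oo[) O n (w, t, point) + disc n.+1 n w)%E.
Proof.
rewrite /disc; case: ifPn => F; last first.
  have E : jump_time w n = +oo%E by apply/eqP; rewrite -leye_eq leNgt.
  have E1 : jump_time w n.+1 = +oo%E.
    by apply/eqP; rewrite -leye_eq -E jump_time_leS.
  rewrite E1 ltxx adde0 integral0_eq ?mule0// => t _.
  by rewrite /O /stage_weight /= /stage E ltNge leey.
have mS (c : R) : measurable_fun (`]0%R, +oo[%classic : set R)
    (fun t => if stage w n t then (c * expR (- beta * t))%:E else 0%E).
  apply: measurable_funTS; apply: measurable_fun_ifT.
  - apply: (measurable_fun_bool true); rewrite setTI.
    have := @pair1_measurable _ _ (Omega R S) R w measurableT _ (@measurable_stage R dS S n).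
    by rewrite setTI.
  - apply/measurable_EFinP; apply: measurable_funM; first exact: measurable_cst.
    exact: measurable_expM.
  - exact: measurable_cst.
have -> : (\int[mu]_(t in `]0%R, +oo[) O n (w, t, point) =
   (Uo (mark w n) / beta)%:E * \int[mu]_(t in `]0%R, +oo[)
      (if stage w n t then (beta * expR (- beta * t))%:E else 0))%E.
  rewrite -ge0_integralZl_EFin//.
  - apply: eq_integral => t _; rewrite /O /stage_weight /=; case: ifPn => _.
      by rewrite -EFinM mulrA divfK ?gt_eqF// mulrC.
    by rewrite mule0.
  - move=> t _; case: ifPn => // _; rewrite lee_fin mulr_ge0 ?expR_ge0//; exact: ltW.
  - exact: mS.
  - by rewrite divr_ge0// ltW.
rewrite discount_stage//.
set ea := expR (- beta * fine (jump_time w n)); set eb := (if _ then expR _ else _).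
have -> : (if (jump_time w n.+1 < +oo)%E
    then (expR (- beta * fine (jump_time w n.+1)) * Uo (mark w n))%:E else 0%E) = (eb * Uo (mark w n))%:E.
  by rewrite /eb; case: ifPn => _ //; rewrite mul0r.
rewrite -!EFinM -EFinD; congr EFin.
by rewrite mulrA mulrCA divff ?gt_eqF// mulr1 mulrBr mulrC [Uo _ * eb]mulrC subrK.
Qed.

Let aE n : a n = (\int[P]_w disc n n w)%E.
Proof.
case: n => [|n]; apply: eq_integral => w _; last exact: newE.
by rewrite /disc jump_time0 ltry /= mulr0 expR0 mul1r.
Qed.

Let o_ge0 n : (0 <= o n)%E.
Proof. by apply: integral_ge0 => w _; apply: integral_ge0 => t _; exact: O0. Qed.

Let a_ge0 n : (0 <= a n)%E.
Proof. by rewrite aE; apply: integral_ge0 => w _. Qed.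

(* Integration by parts of the discount factor on the n-th stage. *)
Let a_split n : a n = (beta%:E * o n + old n)%E.
Proof.
rewrite aE /o /old.
have ooge0 (w : Omega R S) : (0 <= \int[mu]_(t in `]0%R, +oo[) O n (w, t, point))%E by exact: integral_ge0.
rewrite -(ge0_integralZl_EFin _ measurableT _ (moint n) (ltW beta0))//.
have mbo : measurable_fun setT (fun w : Omega R S => beta%:E * \int[mu]_(t in `]0%R, +oo[) O n (w, t, point))%E.
  by apply: emeasurable_funM => //; exact: measurable_cst.
have b0 (w : Omega R S) : (0 <= beta%:E * \int[mu]_(t in `]0%R, +oo[) O n (w, t, point))%E.
  by rewrite mule_ge0// lee_fin ltW.
under [X in (_ + X)%E]eq_integral do rewrite oldE.
rewrite -(ge0_integralD _ measurableT _ mbo _ (mdisc n.+1 n))//.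
by apply: eq_integral => w _; exact: disc_split.
Qed.

(* beta exceeds the drift constant by one, and this unit leaves o n over. *)
Let a_decr n : (a n.+1 + o n <= a n)%E.
Proof.
have anE : a n.+1 = new n by [].
have := a_split n; have := new_le n; have := o_ge0 n.
move: (a n.+1) (a n) (new n) (o n) (old n) anE => u v x y z -> y0 H ->.
rewrite /beta EFinD ge0_muleDl ?lee_fin// mul1e addeAC.
exact: leeD H (lexx _).
Qed.

Let partial_occupation N : (\sum_(0 <= n < N) o n + a N <= a 0)%E.
Proof.
elim: N => [|N IH]; first by rewrite big_nil add0e.
rewrite big_nat_recr//; have := a_decr N.
move: (\sum_(0 <= n < N) o n)%E (o N) (a N.+1) (a N) IH => x y z u IH H.
by rewrite -addeA (le_trans _ IH)// [(y + z)%E]addeC; exact: leeD.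
Qed.

Let total_stage_weight w t : (\sum_(0 <= n <oo) O n (w, t, point) =
   (expR (- beta * t) * Uo (left_state w t))%:E)%E.
Proof.
have [[k st]|/forallNP ns] := pselect (exists k, stage w k t).
  rewrite (@nneseries_single _ _ 0 k)//.
    by rewrite (left_state_stage st) /O /stage_weight /= st.
  move=> n nk; rewrite /O /stage_weight /= ifF//.
  by apply/negbTE; apply: contraNN nk => sn; apply/eqP; exact: stage_uniq sn st.
have {}ns k : ~~ stage w k t by apply/negP.
rewrite left_state_off//= mulr0 eseries0// => n _ _.
by rewrite /O /stage_weight /= (negbTE (ns n)).
Qed.

(** Sum [a_decr] over the stages: the terms a n telescope. *)
Lemma discounted_occupation :
  (\int[P]_w \int[mu]_(t in `]0%R, +oo[)
      (expR (- beta * t) * oapp U 0 (left_state w t))%:E <=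
   \int[P]_w (oapp U 0 (mark w 0))%:E)%E.
Proof.
under eq_integral do under eq_integral do rewrite -total_stage_weight.
under eq_integral => w _.
  rewrite integral_nneseries//; last first.
    move=> n; apply: measurable_funTS.
    exact: (measurable_section_time (f := fun x => O n (x, point)) w (mO n)).
  over.
rewrite integral_nneseries//; last first.
  by move=> n w _; apply: integral_ge0.
apply: lime_le; first by apply: is_cvg_nneseries => n _ _; exact: o_ge0.
by apply: nearW => N; rewrite (le_trans _ (partial_occupation N))// leeDl.
Qed.

End occupation.

(** * Occupation up to the horizon, and absence of explosion *)
Section nonexplosion.
Context (R : realType) dS (S : measurableType dS) (A : ptopologicalType).
Variables (mdp : ctmdp R S A) (pi : policy mdp) (P : probability (Omega R S) R).
Hypotheses (S_countable : countable [set: S]) (S_discrete : forall B : set S, measurable B).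
Notation mu := (@lebesgue_measure R).
Implicit Types (w : Omega R S) (t : R) (k n : nat) (i j : S).

Lemma measurable_at_jump n (f : Omega R S * R -> \bar R) : measurable_fun setT f ->
  measurable_fun setT (fun w => f (w, fine (jump_time w n))).
Proof.
move=> mf; apply: (measurableT_comp mf); apply: measurable_fun_pair => //.
apply: (measurableT_comp _ (@measurable_jump_time R dS S n)).
exact: fine_measurable.
Qed.

Lemma mpp_termE (W : Omega R S * R * S -> \bar R) n w :
  match jump_time w n, mark w n with t%:E, Some j => W (w, t, j) | _, _ => 0%E end =
  if (jump_time w n < +oo)%E then oapp (fun j => W (w, fine (jump_time w n), j)) 0%E (mark w n) else 0%E.
Proof.
have := jump_time_ge0 w n.
case: (jump_time w n) => [t| |] //= _; first by rewrite ltry; case: (mark w n).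
Qed.

Lemma measurable_mpp (W : Omega R S * R * S -> \bar R) :
  (forall x, 0 <= W x)%E ->
  (forall j, measurable_fun setT (fun x : Omega R S * R => W (x, j))) ->
  measurable_fun setT (mpp_integral W).
Proof.
move=> W0 mW; pose f n w : \bar R :=
  match jump_time w n, mark w n with t%:E, Some j => W (w, t, j) | _, _ => 0%E end.
rewrite (_ : mpp_integral W = fun w => (\sum_(0 <= n <oo | n \in leq 1) f n w)%E); last first.
  by apply/funext => w; rewrite /mpp_integral ereal_series.
apply: ge0_emeasurable_sum => [n w _ _|n _]; rewrite /f.
  by rewrite mpp_termE; case: ifP => // _; case: (mark w n) => /=.
under eq_fun do rewrite mpp_termE.
apply: measurable_fun_ifT; [exact: measurable_jump_finite| |exact: measurable_cst].
apply: (measurable_by_mark S_countable S_discrete (n := n)) => -[j|]; last first.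
  by exists (cst 0%E) => [|w ->]; [exact: measurable_cst|].
exists (fun w => W (w, fine (jump_time w n), j)) => [|w ->//].
exact: (measurable_at_jump n (mW j)).
Qed.

Hypothesis comp : is_compensator P (jump_intensity pi).
Variables (U : S -> R) (rho : R).
Hypotheses (U0 : forall j, 0 <= U j) (rho0 : 0 <= rho).
Hypothesis U_drift : forall t i a, graph mdp (t, i, a) ->
  (signed_sum (fun j => (U j)%:E * rate mdp (t, i, a) [set j]) <= (rho * U i)%:E)%E.
Hypothesis U_initial : (\int[P]_w (oapp U 0 (mark w 0))%:E < +oo)%E.

Definition occupation (T : R) w : \bar R :=
  (\int[mu]_(t in `]0%R, T]) (oapp U 0 (left_state w t))%:E)%E.

Lemma measurable_left_weight :
  measurable_fun setT (fun x : Omega R S * R => (oapp U 0 (left_state x.1 x.2))%:E).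
Proof.
apply: (measurable_left_state S_countable S_discrete (F := fun _ x => (oapp U 0 x)%:E)
  (y := 0%E)) => // i; exact: measurable_cst.
Qed.

Lemma left_weight_ge0 (x : option S) : (0 <= (oapp U 0 x)%:E)%E.
Proof. by case: x => [j|] /=; rewrite lee_fin. Qed.

Lemma measurable_occupation T : measurable_fun setT (occupation T).
Proof.
apply: (measurable_time_integral (f := fun x => (oapp U 0 (left_state x.1 x.2))%:E)) => //.
- exact: measurable_left_weight.
- by move=> x; exact: left_weight_ge0.
Qed.

Lemma occupation_ge0 T w : (0 <= occupation T w)%E.
Proof. by apply: integral_ge0 => t _; exact: left_weight_ge0. Qed.

(** On [0, T] the discount factor is bounded below. *)
Lemma expected_occupation T : 0 <= T -> (\int[P]_w occupation T w < +oo)%E.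
Proof.
move=> T0; pose beta := rho + 1.
have beta0 : 0 <= beta by rewrite addr_ge0.
pose f (w : Omega R S) t := (expR (- beta * t) * oapp U 0 (left_state w t))%:E.
have f0 (w : Omega R S) t : (0 <= f w t)%E.
  by rewrite lee_fin mulr_ge0 ?expR_ge0// -lee_fin left_weight_ge0.
have mf : measurable_fun setT (fun x : Omega R S * R => f x.1 x.2).
  apply/measurable_EFinP; apply: measurable_funM.
    exact: (measurableT_comp (measurable_expM beta) measurable_snd).
  by apply/measurable_EFinP; exact: measurable_left_weight.
have mw (w : Omega R S) : measurable_fun setT (f w).
  exact: (measurable_section_time (f := fun x => f x.1 x.2) w mf).
have mF : measurable_fun setT (fun w : Omega R S => \int[mu]_(t in `]0%R, +oo[) f w t)%E.
  exact: (measurable_time_integral (f := fun x => f x.1 x.2)).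
have F0 (w : Omega R S) : (0 <= \int[mu]_(t in `]0%R, +oo[) f w t)%E by exact: integral_ge0.
apply: (@le_lt_trans _ _ ((expR (beta * T))%:E * \int[P]_w \int[mu]_(t in `]0%R, +oo[) f w t)%E).
  rewrite -ge0_integralZl_EFin//.
  apply: (ge0_le_integral _ measurableT).
  - by move=> w _; exact: occupation_ge0.
  - exact: measurable_occupation.
  - by apply: emeasurable_funM => //; exact: measurable_cst.
  move=> w _.
  have mwD : measurable_fun (`]0%R, +oo[%classic : set R) (f w) by exact: measurable_funTS.
  rewrite -ge0_integralZl_EFin//.
  apply: (@le_trans _ _ (\int[mu]_(t in `]0%R, T]) ((expR (beta * T))%:E * f w t))%E).
    apply: ge0_le_integral => //.
    - by move=> t _; exact: left_weight_ge0.
    - apply: measurable_funTS.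
      exact: (measurable_section_time (f := fun x => (oapp U 0 (left_state x.1 x.2))%:E) w measurable_left_weight).
    - by apply: emeasurable_funM; [exact: measurable_cst|exact: (measurable_funTS (mw w))].
    - move=> t; rewrite /= in_itv/= => /andP[t0 tT]; rewrite /f -EFinM lee_fin mulrA -expRD.
      rewrite ler_peMl//; first by have := left_weight_ge0 (left_state w t); rewrite lee_fin.
      by rewrite -expR0 ler_expR mulNr -mulrBr mulr_ge0// subr_ge0.
  apply: ge0_subset_integral => //.
  - by apply: emeasurable_funM; [exact: measurable_cst|exact: (measurable_funTS (mw w))].
  - by move=> t _; rewrite mule_ge0// lee_fin expR_ge0.
  - by apply: subset_itv; rewrite bnd_simp.
have H := discounted_occupation S_countable S_discrete comp U0 rho0 U_drift.
rewrite lte_mul_pinfty ?lee_fin ?expR_ge0//.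
exact: le_lt_trans H U_initial.
Qed.

Variable C : R.
Hypotheses (C0 : 0 <= C) (rate_le : forall i, (qstar mdp i <= (C * U i)%:E)%E).

(* Its sum over the jumps is the number of jumps up to time T. *)
Let W (T : R) (x : Omega R S * R * S) : \bar R :=
  if (x.1.2 <= T) && (left_state x.1.1 x.1.2 != None) then 1%E else 0%E.

Let W0 T x : (0 <= W T x)%E. Proof. by rewrite /W; case: ifP. Qed.

Let mW T j : measurable_fun setT (fun x : Omega R S * R => W T (x, j)).
Proof.
apply: (measurable_left_state S_countable S_discrete
  (F := fun t x => if (t <= T) && (x != None) then 1%E else 0%E) (y := 0%E)) => [t|i].
  by rewrite andbF.
apply: measurable_fun_ifT; [|exact: measurable_cst|exact: measurable_cst].
under eq_fun do rewrite andbT.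
by apply: measurable_fun_ler => //; exact: measurable_cst.
Qed.

Let mpp_finite (T : R) : 0 <= T -> (\int[P]_w mpp_integral (W T) w < +oo)%E.
Proof.
move=> T0; rewrite (compensator_formula S_countable S_discrete comp)//; last 2 first.
- by move=> k w t j st; rewrite /W /= (left_state_stop st)// (stage_gt0 st).
- by move=> w t j ns; rewrite /W /= left_state_off// andbF.
have CU0 j : 0 <= C * U j by rewrite mulr_ge0.
have mleft : measurable_fun setT (fun x : Omega R S * R => C%:E * (oapp U 0 (left_state x.1 x.2))%:E)%E.
  by apply: emeasurable_funM; [exact: measurable_cst|exact: measurable_left_weight].
pose f (x : Omega R S * R) := \esum_(j in [set: S]) (W T (x, j) * intensity pi x.1 x.2 j)%E.
have f0 x : (0 <= f x)%E.
  by apply: esum_ge0 => j _; rewrite mule_ge0// intensity_ge0.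
have mf : measurable_fun setT f.
  apply: measurable_esum => // [x j|j]; first by rewrite mule_ge0// intensity_ge0.
  by apply: emeasurable_funM; [exact: mW|exact: measurable_intensity].
apply: (@le_lt_trans _ _ (C%:E * \int[P]_w occupation T w)%E); last first.
  by rewrite lte_mul_pinfty ?lee_fin//; exact: expected_occupation.
rewrite -ge0_integralZl_EFin//; last 2 first.
- by move=> w _; exact: occupation_ge0.
- exact: measurable_occupation.
apply: (ge0_le_integral _ measurableT).
- by move=> w _; apply: integral_ge0 => t _; exact: (f0 (w, t)).
- exact: (measurable_time_integral (f := f)).
- by apply: emeasurable_funM; [exact: measurable_cst|exact: measurable_occupation].
move=> w _; rewrite /occupation.
have mls : measurable_fun setT (fun t : R => (oapp U 0 (left_state w t))%:E).
  exact: (measurable_section_time (f := fun x => (oapp U 0 (left_state x.1 x.2))%:E) w measurable_left_weight).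
rewrite -ge0_integralZl_EFin//; last 2 first.
- by move=> t _; exact: left_weight_ge0.
- exact: measurable_funTS.
rewrite [leLHS]integral_mkcond [leRHS]integral_mkcond.
apply: (ge0_le_integral _ measurableT).
- by move=> t _; rewrite patchE; case: ifP => // _; exact: (f0 (w, t)).
- apply/(measurable_restrictT _ (measurable_itv _)); apply: measurable_funTS.
  exact: (measurable_section_time (f := f) w mf).
- apply/(measurable_restrictT _ (measurable_itv _)); apply: measurable_funTS.
  by apply: emeasurable_funM; [exact: measurable_cst|].
move=> t _; rewrite !patchE !mem_setE !in_itv/= andbT.
case: ifPn => //= t0.
have [tT|tT] := leP t T; last first.
  by rewrite esum1// => j _; rewrite /W /= leNgt tT /= mul0e.
have [[k st]|/forallNP ns] := pselect (exists k, stage w k t); last first.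
  rewrite esum1; first by rewrite mule_ge0 ?left_weight_ge0// lee_fin.
  by move=> j _; rewrite intensity_off ?mule0// => k; apply/negP.
have [i mi] := mark_some (stage_finite st).
rewrite (left_state_stage st) mi /=; under eq_esum.
  move=> j _; rewrite /W /= tT (left_state_stage st) mi /= mul1e; over.
exact: (intensity_sum_le pi S_countable S_discrete st mi).
Qed.

(** On an explosion before N infinitely many jumps occur before N, while their
    expected number is at most a multiple of the occupation of U. *)
Lemma explosion_ae : {ae P, forall w, explosion w = +oo%E}.
Proof.
have H (N : nat) : P.-negligible [set w | (explosion w <= N%:R%:E)%E].
  have mE : measurable [set w : Omega R S | (explosion w <= N%:R%:E)%E].
    have := emeasurable_fun_infty_c measurableT (@measurable_explosion R dS S) N%:R%:E.
    by rewrite setTI.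
  exists [set w | (explosion w <= N%:R%:E)%E]; split => //.
  have mm := measurable_mpp (@W0 N%:R) (@mW N%:R).
  have := mpp_finite (ler0n R N); rewrite ltNge => /negP; apply: contra_notP => /eqP PN.
  have PN0 : (0 < P [set w : Omega R S | (explosion w <= N%:R%:E)%E])%E.
    by rewrite lt_neqAle eq_sym PN measure_ge0.
  have -> : +oo%E = (\int[P]_w (+oo * (\1_[set w : Omega R S | (explosion w <= N%:R%:E)%E] w)%:E))%E.
    rewrite ge0_integralZl//; last exact/measurable_EFinP/measurable_indic.
    by rewrite integral_indic// setIT gt0_mulye.
  apply: (ge0_le_integral _ measurableT).
  - by move=> w _; rewrite mule_ge0// lee_fin.
  - apply: emeasurable_funM; first exact: measurable_cst.
    exact/measurable_EFinP/measurable_indic.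
  - exact: mm.
  move=> w _; rewrite indicE; case: (boolP (w \in _)) => [/set_mem/= eN|_]; last first.
    rewrite mule0; apply: nneseries_ge0 => n _ _; rewrite mpp_termE; case: ifP => // _.
    by case: (mark w n) => [j|] //=; exact: W0.
  rewrite mule1 leye_eq; apply/eqP.
  have tF n : (jump_time w n < +oo)%E.
    by rewrite (le_lt_trans (jump_time_le_explosion w n))// (le_lt_trans eN)// ltry.
  have tN n : fine (jump_time w n) <= N%:R.
    by rewrite -lee_fin -jump_time_finE// (le_trans (jump_time_le_explosion w n)).
  have -> : mpp_integral (W N%:R) w = (\sum_(1 <= n <oo) 1)%E.
    rewrite /mpp_integral [RHS]ereal_series ereal_series.
    apply: eq_eseriesr => n n1; rewrite mpp_termE tF.
    have [j ->] := mark_some (tF n) => /=; rewrite /W /= tN /=.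
    rewrite (@left_state_stage _ _ _ w n.-1).
      have [i ->] := mark_some (tF n.-1); first by [].
    by rewrite /stage -jump_time_finE// prednK// lexx andbT -[X in (_ < jump_time _ X)%E](prednK n1) jump_time_ltS.
  apply/cvg_lim => //; apply/cvgeyPge => x.
  near=> m; rewrite sumEFin big_const_nat iter_addr_0 lee_fin.
  apply: (@le_trans _ _ (Num.bound `|x|)%:R).
    by rewrite (le_trans (ler_norm _))// ltW// archi_boundP.
  rewrite ler_nat; near: m; exists (Num.bound `|x|).+1 => // m /=.
  by case: m => // m; rewrite subn1.
have : P.-negligible (\bigcup_N [set w : Omega R S | (explosion w <= N%:R%:E)%E]).
  exact: negligible_bigcup.
apply: negligibleS => w /= ne.
have e0 : (0 <= explosion w)%E.
  by have := jump_time_le_explosion w 0; rewrite jump_time0.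
have eF : explosion w \is a fin_num.
  by rewrite ge0_fin_numE// lt_neqAle leey andbT; apply/eqP.
exists (Num.bound (fine (explosion w))) => //=.
by rewrite -(fineK eF) lee_fin ltW// archi_boundP// fine_ge0.
Unshelve. all: by end_near. Qed.

End nonexplosion.

(** * The exponential of the running cost *)
(** Jensen's inequality, by integrating the tangent line of the exponential at the
    mean: e^m (1 + T y - m) <= e^(T y). *)
Lemma expR_mean_le (R : realType) (T : R) (y g : R -> R) : 0 < T ->
  (@lebesgue_measure R).-integrable `]0, T] (EFin \o y) ->
  (@lebesgue_measure R).-integrable `]0, T] (EFin \o g) ->
  (forall v, 0 < v <= T -> expR (T * y v) <= g v) ->
  T * expR (\int[lebesgue_measure]_(v in `]0, T]) y v) <=
    \int[lebesgue_measure]_(v in `]0, T]) g v.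
Proof.
move=> T0 iy ig yg; set m := Rintegral _ _ _.
pose h v := expR m * ((1 - m) + T * y v).
have ic (c : R) : (@lebesgue_measure R).-integrable `]0, T] (EFin \o (fun=> c)).
  apply/integrableP; split; first exact: measurable_cst.
  rewrite (_ : (fun v => _) = cst `|c|%:E)// integral_cst//=.
  by rewrite lebesgue_measure_itv/= lte_fin T0 -EFinB -EFinM ltry.
have iTy : (@lebesgue_measure R).-integrable `]0, T] (EFin \o (fun v => T * y v)).
  exact: (integrableZl _ T iy).
have ih0 : (@lebesgue_measure R).-integrable `]0, T] (EFin \o (fun v => (1 - m) + T * y v)).
  exact: (integrableD _ (ic (1 - m)) iTy).
have ih : (@lebesgue_measure R).-integrable `]0, T] (EFin \o h).
  exact: (integrableZl _ (expR m) ih0).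
have -> : T * expR m = \int[lebesgue_measure]_(v in `]0, T]) h v.
  rewrite /h RintegralZl// (RintegralD _ (ic (1 - m)) iTy)// RintegralZl// -/m.
  rewrite Rintegral_cst//= lebesgue_measure_itv/= lte_fin T0 -EFinB/= subr0.
  by rewrite mulrBl mul1r [T * m]mulrC subrK mulrC.
apply: le_Rintegral => // v; rewrite /= in_itv/= => vT.
apply: le_trans (yg v vT); rewrite /h.
rewrite -[X in _ <= X](_ : expR m * expR (T * y v - m) = _); last first.
  by rewrite -expRD subrKC.
rewrite ler_wpM2l ?expR_ge0// addrAC -addrA; exact: expR_ge1Dx.
Qed.

Section cost_exponential.
Context (R : realType) dS (S : measurableType dS) (A : ptopologicalType).
Variables (mdp : ctmdp R S A) (pi : policy mdp).
Hypotheses (S_countable : countable [set: S]) (S_discrete : forall B : set S, measurable B).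
Notation mu := (@lebesgue_measure R).
Implicit Types (w : Omega R S) (t v : R) (k n : nat) (i j : S).

Lemma jump_times0 w : jump_times w 0.
Proof. by exists (Some 0%N) => //=; rewrite jump_time0. Qed.

Lemma not_jump_time_gt0 w v : 0 <= v -> ~ jump_times w v -> 0 < v.
Proof.
move=> v0 nv; rewrite lt_neqAle v0 andbT; apply/eqP => E; apply: nv.
by rewrite -E; exact: jump_times0.
Qed.

Lemma mean_costE w v : 0 <= v -> ~ jump_times w v -> mean_cost pi w v = left_cost pi w v.
Proof.
by move=> v0 nv; rewrite /left_cost left_stateE//; exact: not_jump_time_gt0 nv.
Qed.

Lemma measurable_left_cost_path w : measurable_fun setT (left_cost pi w).
Proof.
exact: (measurable_section_time (f := fun x => left_cost pi x.1 x.2) w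
  (measurable_left_cost pi S_countable S_discrete)).
Qed.

Lemma mean_cost_integrable (T : R) w :
  mu.-integrable `[0, T] (EFin \o left_cost pi w) ->
  mu.-integrable `[0, T] (EFin \o mean_cost pi w).
Proof.
move=> /integrableP[ml il].
have E v : `[0, T]%classic v -> ~ jump_times w v -> mean_cost pi w v = left_cost pi w v.
  by rewrite /= in_itv /= => /andP[v0 _] nv; exact: mean_costE.
apply/integrableP; split.
  apply: (measurable_off_countable (countable_jump_times w) _ ml) => // v vT nv.
  by rewrite /= E.
rewrite (integral_off_countable (C := jump_times w)
  (g := fun v => `|(left_cost pi w v)%:E|%E)) => //.
- exact: countable_jump_times.
- exact: measurableT_comp.
- by move=> v vT nv /=; rewrite E.
Qed.

Definition left_cost_exp w t : R :=
  expR (\int[mu]_(v in `[0, t]) left_cost pi w v).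

Lemma cost_expE w t : cost_exp pi w t = left_cost_exp w t.
Proof.
rewrite /cost_exp /left_cost_exp /Rintegral.
rewrite (integral_off_countable (C := jump_times w)
  (g := fun v => (left_cost pi w v)%:E))//.
- exact: countable_jump_times.
- apply/measurable_EFinP; apply: measurable_funTS; exact: measurable_left_cost_path.
- by move=> v; rewrite /= in_itv/= => /andP[v0 _] nv; rewrite mean_costE.
Qed.

Lemma left_cost0 w v : v <= 0 -> left_cost pi w v = 0.
Proof.
by move=> v0; apply: left_cost_off => k; apply/negP => /stage_gt0; rewrite ltNge v0.
Qed.

Lemma left_cost_exp_stop w k t : stage w k t ->
  left_cost_exp (stop k w) t = left_cost_exp w t.
Proof.
move=> st.
have E : \int[mu]_(v in `[0, t]) left_cost pi (stop k w) v =
    \int[mu]_(v in `[0, t]) left_cost pi w v.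
  apply: eq_Rintegral => v; rewrite inE/= in_itv/= => /andP[v0 vt].
  have [v00|vgt0] := leP v 0; first by rewrite !left_cost0.
  exact: left_cost_stop st vgt0 vt.
exact (f_equal expR E).
Qed.

Lemma measurable_running_integral (f : Omega R S * R -> \bar R) :
  measurable_fun setT f -> (forall x, 0 <= f x)%E ->
  measurable_fun setT (fun x : Omega R S * R => \int[mu]_(v in `[0%R, x.2]) f (x.1, v))%E.
Proof.
move=> mf f0.
pose g (z : (Omega R S * R) * R) : \bar R :=
  if (0 <= z.2) && (z.2 <= z.1.2) then f (z.1.1, z.2) else 0%E.
have mg : measurable_fun setT g.
  apply: measurable_fun_ifT; last exact: measurable_cst.
    apply: measurable_and.
      by apply: measurable_fun_ler; [exact: measurable_cst|exact: measurable_snd].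
    apply: measurable_fun_ler; first exact: measurable_snd.
    exact: (measurableT_comp measurable_snd measurable_fst).
  apply: (measurableT_comp mf); apply: measurable_fun_pair; last exact: measurable_snd.
  exact: (measurableT_comp measurable_fst measurable_fst).
have g0 z : (0 <= g z)%E by rewrite /g; case: ifP.
have := measurable_time_integral measurableT mg g0.
congr measurable_fun; apply/funext => x; rewrite [RHS]integral_mkcond.
by apply: eq_integral => v _; rewrite patchE mem_setE in_itv.
Qed.

Lemma measurable_left_cost_exp :
  measurable_fun setT (fun x : Omega R S * R => left_cost_exp x.1 x.2).
Proof.
pose f (x : Omega R S * R) := (left_cost pi x.1 x.2)%:E.
have mf : measurable_fun setT f.
  by apply/measurable_EFinP; exact: measurable_left_cost.
apply: measurableT_comp => //.
rewrite (_ : (fun x => _) = fun x : Omega R S * R => fine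
  (\int[mu]_(v in `[0%R, x.2]) f^\+ (x.1, v) - \int[mu]_(v in `[0%R, x.2]) f^\- (x.1, v))%E); last first.
  apply/funext => x; rewrite /Rintegral integralE; congr (fine (_ - _)%E);
    by apply: eq_integral => v _; rewrite ?funeposE ?funenegE.
apply: measurableT_comp; first exact: fine_measurable.
apply: emeasurable_funB; apply: measurable_running_integral => //.
- exact: measurable_funepos.
- exact: measurable_funeneg.
Qed.

Variables (T : R) (U B : S -> R) (C : R).
Hypotheses (T0 : 0 < T) (U0 : forall j, 0 <= U j) (B1 : forall j, 1 <= B j)
  (BU : forall j, B j <= C * U j).
Hypothesis cost_le : forall t i a, graph mdp (t, i, a) ->
  expR (2 * (1 + T) * `|cost mdp (t, i, a)|) <= B i.

Let T1 : 0 < 2 * (1 + T). Proof. by rewrite mulr_gt0// addr_gt0. Qed.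

Lemma left_cost_expR_le w k t i : stage w k t -> mark w k = Some i ->
  expR (2 * (1 + T) * `|left_cost pi w t|) <= B i.
Proof.
move=> st mi; have B0 : 0 < B i by rewrite (lt_le_trans ltr01).
have H : `|left_cost pi w t| <= ln (B i) / (2 * (1 + T)).
  apply: (left_cost_le pi st mi).
    by rewrite divr_ge0 ?ln_ge0// ltW.
  move=> a g; rewrite ler_pdivlMr// mulrC -ler_expR lnK ?posrE//.
  exact: cost_le.
have : 2 * (1 + T) * `|left_cost pi w t| <= ln (B i) by rewrite mulrC -ler_pdivlMr.
by rewrite -ler_expR lnK ?posrE.
Qed.

Section path.
Variable w : Omega R S.
Hypotheses (noexpl : explosion w = +oo%E) (occ : (occupation U T w < +oo)%E).

Let Uo (x : option S) := oapp U 0 x.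

Lemma nonexploding_stage t : 0 < t -> exists k i, [/\ stage w k t, mark w k = Some i & left_state w t = Some i].
Proof.
move=> t0; have [|k st] := @stage_exists _ _ _ w t t0; first by rewrite noexpl ltry.
have [i mi] := mark_some (stage_finite st).
by exists k, i; split => //; rewrite (left_state_stage st).
Qed.

Lemma left_cost_expR_state t : 0 < t ->
  expR (2 * (1 + T) * `|left_cost pi w t|) <= C * Uo (left_state w t).
Proof.
move=> /nonexploding_stage[k [i [st mi ->]]].
exact: le_trans (left_cost_expR_le st mi) (BU i).
Qed.

Lemma left_weight_integrable : mu.-integrable `]0, T] (EFin \o (fun v => Uo (left_state w v))).
Proof.
apply/integrableP; split.
  apply: measurable_funTS.
  exact: (measurable_section_time (f := fun x => (oapp U 0 (left_state x.1 x.2))%:E) w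
    (measurable_left_weight S_countable S_discrete U)).
rewrite (_ : (\int[mu]_(x in _) _)%E = occupation U T w)//.
apply: eq_integral => v _ /=; rewrite ger0_norm// /Uo.
by case: (left_state w v) => /=.
Qed.

Lemma left_cost_integrable : mu.-integrable `[0, T] (EFin \o left_cost pi w).
Proof.
have i0 : mu.-integrable `]0, T] (EFin \o left_cost pi w).
  apply: (le_integrable _ _ _ (integrableZl _ C left_weight_integrable)) => //.
    by apply/measurable_EFinP; apply: measurable_funTS; exact: measurable_left_cost_path.
  move=> v; rewrite /= in_itv/= => /andP[v0 _]; rewrite lee_fin.
  apply: le_trans (ler_norm _); apply: le_trans (left_cost_expR_state v0).
  apply: (@le_trans _ _ (2 * (1 + T) * `|left_cost pi w v|)).
    by rewrite ler_peMl//; have := T0; lra.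
  by have := expR_ge1Dx (2 * (1 + T) * `|left_cost pi w v|); lra.
have /integrableP[m0 i00] := i0.
apply/integrableP; split.
  by apply/measurable_EFinP; apply: measurable_funTS; exact: measurable_left_cost_path.
rewrite -integral_itv_obnd_cbnd//.
exact: measurableT_comp.
Qed.

(** Jensen's inequality for 2 |c|, whose exponential, with the factor T, is
    bounded by the weight. *)
Lemma left_cost_exp_le t : 0 <= t <= T ->
  left_cost_exp w t ^+ 2 <= C / T * fine (occupation U T w).
Proof.
move=> /andP[t0 tT]; pose y v := 2 * `|left_cost pi w v|.
have il := left_cost_integrable.
have iy : mu.-integrable `[0, T] (EFin \o y).
  exact: (integrableZl _ 2 (integrable_norm il)).
have iy0 : mu.-integrable `]0, T] (EFin \o y).
  by apply: integrableS iy => //; apply: subset_itv; rewrite bnd_simp.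
apply: (@le_trans _ _ (expR (\int[mu]_(v in `]0, T]) y v))).
  rewrite /left_cost_exp -expRM_natl ler_expR Rintegral_itv_obnd_cbnd//.
  have sub : `[0, t] `<=` `[0, T] by apply: subset_itv; rewrite bnd_simp.
  have ilt : mu.-integrable `[0, t] (EFin \o left_cost pi w) by apply: integrableS il.
  have iyt : mu.-integrable `[0, t] (EFin \o y) by apply: integrableS iy.
  rewrite -RintegralZl//.
  apply: (@le_trans _ _ (\int[mu]_(v in `[0, t]) y v)).
    apply: le_Rintegral => //; first exact: (integrableZl _ 2 ilt).
    by move=> v _; rewrite /y ler_pM2l// ler_norm.
  rewrite -subr_ge0 (Rintegral_increment iy)//.
  by apply: Rintegral_ge0 => v _; rewrite mulr_ge0.
have iU := left_weight_integrable.
have -> : fine (occupation U T w) = \int[mu]_(v in `]0, T]) Uo (left_state w v) by [].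
rewrite mulrAC ler_pdivlMr// mulrC -RintegralZl//.
apply: expR_mean_le => //; first exact: (integrableZl _ C iU).
move=> v /andP[v0 vT]; apply: le_trans (left_cost_expR_state v0).
rewrite ler_expR /y mulrA ler_wpM2r// mulrC; have := T0; lra.
Qed.

Lemma psi_density (phi phi' : R -> S -> R) j :
  is_density T (phi ^~ j) (phi' ^~ j) ->
  is_density T (psi pi phi w ^~ j) (psi' pi phi phi' w ^~ j).
Proof.
move=> dphi; have ic := mean_cost_integrable left_cost_integrable.
exact: (expR_mul_density (ltW T0) ic dphi).
Qed.

Lemma psi_abs_continuous (phi phi' : R -> S -> R) j :
  is_density T (phi ^~ j) (phi' ^~ j) -> abs_continuous T (psi pi phi w ^~ j).
Proof. by move/psi_density/density_abs_continuous. Qed.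

End path.

End cost_exponential.

(** * Gains and losses in a sum weighted by rates of total mass zero *)
Section signed_sums.
Context (R : realType) (S : choiceType).
Hypothesis S_countable : countable [set: S].

Lemma max0_mul (a r : R) : 0 <= r -> Num.max a 0 * r = Num.max (a * r) 0.
Proof. by move=> r0; rewrite maxr_pMl// mul0r. Qed.

Lemma max0B (a : R) : Num.max a 0 - Num.max (- a) 0 = a.
Proof.
have [a0|a0] := leP 0 a.
  by rewrite (max_idPr _) ?oppr_le0// subr0.
by rewrite (max_idPl _) ?oppr_ge0 ?ltW// sub0r opprK.
Qed.

Lemma max0_le_norm (a : R) : Num.max a 0 <= `|a|.
Proof. by rewrite ge_max ler_norm normr_ge0. Qed.

(** The signs of p - q, p and q are independent of each other; the identity avoids
    the case analysis by x^+ - x^- = x. *)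
Lemma compensation_pointwise (p q r : R) : 0 <= r ->
  Num.max (p - q) 0 * r + Num.max (- (p * r)) 0 + Num.max q 0 * r =
  Num.max (q - p) 0 * r + Num.max (p * r) 0 + Num.max (- q) 0 * r.
Proof.
move=> r0; have := max0B (p - q); rewrite opprB.
have := max0B (p * r); have := max0B q.
move: (Num.max (p - q) 0) (Num.max (q - p) 0) (Num.max (p * r) 0) (Num.max (- (p * r)) 0)
  (Num.max q 0) (Num.max (- q) 0) => a b c d e f h1 h2 h3.
have -> : d = c - p * r by rewrite -h2; ring.
have -> : a = b + (p - q) by rewrite -h3; ring.
have -> : e = f + q by rewrite -h1; ring.
by ring.
Qed.

Variables (psi : S -> R) (m lr : S -> \bar R) (x : S).
Hypotheses (m0 : forall j, (0 <= m j)%E) (mx : m x = 0%E)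
  (m_fin : (\esum_(j in [set: S]) m j < +oo)%E)
  (pm_fin : (\esum_(j in [set: S]) (`|psi j|%:E * m j) < +oo)%E)
  (lrE : forall j, lr j = if j == x then (- \esum_(l in [set: S]) m l)%E else m j).

Let r j := fine (m j).
Let r0 j : 0 <= r j. Proof. exact: fine_ge0. Qed.

Let mE j : m j = (r j)%:E.
Proof.
rewrite /r fineK// ge0_fin_numE// (le_lt_trans _ m_fin)//.
rewrite -(@esum_set1 R S j m)//; apply: le_trans (_ : _ <= \esum_(l in [set j]) m l)%E _ => //.
by rewrite [leRHS](esumID [set j])// setTI leeDl// esum_ge0.
Qed.

Let total := \esum_(j in [set: S]) m j.
Let total_fin : total \is a fin_num.
Proof. by rewrite ge0_fin_numE// esum_ge0. Qed.
Let t := fine total.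
Let totalE : total = t%:E. Proof. by rewrite fineK. Qed.
Let t0 : 0 <= t. Proof. by apply: fine_ge0; exact: esum_ge0. Qed.

Definition gain_sum : \bar R := \esum_(j in [set: S]) ((Num.max (psi j - psi x) 0)%:E * m j)%E.
Definition loss_sum : \bar R := \esum_(j in [set: S]) ((Num.max (psi x - psi j) 0)%:E * m j)%E.

Let hp := \esum_(j in [set: S]) (Num.max (psi j * r j) 0)%:E.
Let hn := \esum_(j in [set: S]) (Num.max (- (psi j * r j)) 0)%:E.

Let max0_ge0 (a : R) : (0 <= (Num.max a 0)%:E)%E.
Proof. by rewrite lee_fin le_max lexx orbT. Qed.

Let hp_fin : hp \is a fin_num.
Proof.
rewrite ge0_fin_numE ?esum_ge0// (le_lt_trans _ pm_fin)//.
apply: le_esum_pt => // j; rewrite mE -EFinM lee_fin.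
by rewrite (le_trans (max0_le_norm _))// normrM (ger0_norm (r0 j)).
Qed.

Let hn_fin : hn \is a fin_num.
Proof.
rewrite ge0_fin_numE ?esum_ge0// (le_lt_trans _ pm_fin)//.
apply: le_esum_pt => // j; rewrite mE -EFinM lee_fin.
by rewrite (le_trans (max0_le_norm _))// normrN normrM (ger0_norm (r0 j)).
Qed.

Let sum_fin (a : S -> R) : (forall j, 0 <= a j) -> (forall j, a j <= `|psi j| + `|psi x|) ->
  \esum_(j in [set: S]) ((a j)%:E * m j)%E \is a fin_num.
Proof.
move=> a0 ale; rewrite ge0_fin_numE; last first.
  by apply: esum_ge0 => j _; rewrite mule_ge0// lee_fin.
apply: (@le_lt_trans _ _ (\esum_(j in [set: S]) (`|psi j|%:E * m j + `|psi x|%:E * m j))%E).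
  apply: le_esum_pt => j; first by rewrite mule_ge0// lee_fin.
  by rewrite !mE -!EFinM -EFinD lee_fin -mulrDl ler_wpM2r.
rewrite esumD; [|by move=> j _; rewrite mule_ge0..].
rewrite esumZl// lte_add_pinfty// lte_mul_pinfty//.
Qed.

Lemma gain_sum_fin : gain_sum \is a fin_num.
Proof.
apply: sum_fin => j; first by rewrite le_max lexx orbT.
by rewrite (le_trans (max0_le_norm _))// ler_normB.
Qed.

Lemma loss_sum_fin : loss_sum \is a fin_num.
Proof.
apply: sum_fin => j; first by rewrite le_max lexx orbT.
by rewrite (le_trans (max0_le_norm _))// (le_trans (ler_normB _ _))// addrC.
Qed.

Let balance : (gain_sum + hn + (Num.max (psi x) 0)%:E * total =
  loss_sum + hp + (Num.max (- psi x) 0)%:E * total)%E.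
Proof.
rewrite /total -!esumZl// ?le_max ?lexx ?orbT// /gain_sum /loss_sum /hn /hp.
have mm j (a : R) : (0 <= (Num.max a 0)%:E * m j)%E by rewrite mule_ge0.
rewrite -!esumD//; last 2 first.
- by move=> j _; rewrite adde_ge0.
- by move=> j _; rewrite adde_ge0.
apply: eq_esum => j _; rewrite mE -!EFinM -!EFinD; congr EFin.
exact: compensation_pointwise.
Qed.

Let split_at_x (f : S -> \bar R) (a : S -> R) (b : R) : (forall j, j != x -> f j = (Num.max (a j) 0)%:E) ->
  a x = 0 -> f x = (Num.max b 0)%:E ->
  \esum_(j in [set: S]) f j = (\esum_(j in [set: S]) (Num.max (a j) 0)%:E + (Num.max b 0)%:E)%E.
Proof.
move=> fa ax fx.
have f0 j : (0 <= f j)%E by have [->|/fa ->] := eqVneq j x; rewrite ?fx.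
rewrite (esumID [set x])// [in RHS](esumID [set x])// !setTI !esum_set1// fx ax maxxx add0e addeC.
by congr (_ + _)%E; apply: eq_esum => j /eqP; exact: fa.
Qed.

(** With lr x = - sum of the rates, the sum of psi j times lr j is that of
    (psi j - psi x) m j.  Positive and negative parts are summed separately, so
    that the rearrangement is an identity between convergent sums of nonnegative
    terms. *)
Lemma signed_sum_compensated :
  signed_sum (fun j => (psi j)%:E * lr j)%E = (gain_sum - loss_sum)%E.
Proof.
have ax : psi x * r x = 0 by rewrite /r mx mulr0.
pose f j : \bar R := ((psi j)%:E * lr j)%E; rewrite /signed_sum -/f.
have -> : \esum_(j in [set: S]) f^\+%E j = (hp + (Num.max (- (psi x * t)) 0)%:E)%E.
  apply: split_at_x => //.
  - by move=> j jx; rewrite funeposE /f lrE (negbTE jx) mE -EFinM -EFin_max.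
  - by rewrite funeposE /f lrE eqxx -/total totalE -EFinN -EFinM -EFin_max mulrN.
have -> : \esum_(j in [set: S]) f^\-%E j = (hn + (Num.max (psi x * t) 0)%:E)%E.
  apply: split_at_x.
  - by move=> j jx; rewrite funenegE /f lrE (negbTE jx) mE -EFinM -EFinN -EFin_max.
  - by rewrite ax oppr0.
  - by rewrite funenegE /f lrE eqxx -/total totalE muleN oppeK -EFinM -EFin_max.
have := balance; rewrite totalE.
rewrite -(fineK gain_sum_fin) -(fineK loss_sum_fin) -(fineK hp_fin) -(fineK hn_fin).
rewrite -!EFinM -!EFinD !max0_mul// => -[H].
congr EFin; move: H; rewrite mulNr.
move: (fine gain_sum) (fine loss_sum) (fine hp) (fine hn) (Num.max (psi x * t) 0) (Num.max (- (psi x * t)) 0).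
move=> a b c d e h H; have -> : a = b + c + h - d - e by rewrite -H; ring.
by rewrite /=; ring.
Qed.

End signed_sums.

(** * Drift and jumps of psi along a path *)
Section drift.
Context (R : realType) dS (S : measurableType dS) (A : ptopologicalType).
Variables (mdp : ctmdp R S A) (pi : policy mdp).
Hypotheses (S_countable : countable [set: S]) (S_discrete : forall B : set S, measurable B).
Notation mu := (@lebesgue_measure R).
Implicit Types (w : Omega R S) (t v : R) (k n : nat) (i j : S).

Variables (T : R) (V V1 : S -> R) (rho M M1 C0 C1 : R) (phi phi' : R -> S -> R).
Hypotheses (T_gt0 : 0 < T) (V_ge1 : forall i, 1 <= V i) (V1_ge1 : forall i, 1 <= V1 i)
  (rho_ge0 : 0 <= rho) (M_gt1 : 1 < M) (M1_gt0 : 0 < M1) (C0_ge0 : 0 <= C0) (C1_ge0 : 0 <= C1).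
Hypothesis V_drift : forall t i a, graph mdp (t, i, a) ->
  (signed_sum (fun j => (V j)%:E * rate mdp (t, i, a) [set j]) <= (rho * V i)%:E)%E.
Hypothesis rate_le : forall i, (qstar mdp i <= (M * V i)%:E)%E.
Hypothesis cost_le : forall t i a, graph mdp (t, i, a) ->
  expR (2 * (1 + T) * `|cost mdp (t, i, a)|) <= M * V i.
Hypothesis V_V1 : forall i, V i ^+ 2 <= M1 * V1 i.
Hypotheses (phi_le : forall t j, 0 <= t <= T -> `|phi t j| <= C0 * V j)
  (phi'_le : forall t j, 0 <= t <= T -> `|phi' t j| <= C1 * V1 j)
  (dphi : forall j, is_density T (phi ^~ j) (phi' ^~ j)).

(** phi and its density are only controlled on [0, T]; cut to zero outside, they
    give jump integrands that ignore the jumps after T. *)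
Definition clip (f : R -> S -> R) t j : R := if 0 <= t <= T then f t j else 0.

Lemma clipE f t j : 0 <= t <= T -> clip f t j = f t j.
Proof. by rewrite /clip => ->. Qed.

Lemma measurable_clip (f : R -> S -> R) j : measurable_fun `[0, T] (f ^~ j) ->
  measurable_fun setT (fun t => clip f t j).
Proof.
move=> mf; have := (measurable_restrictT (f ^~ j) (measurable_itv `[0, T])).1 mf.
by congr measurable_fun; apply/funext => t; rewrite patchE mem_setE in_itv.
Qed.

Let mphi j : measurable_fun setT (fun t => clip phi t j).
Proof. by apply: measurable_clip; exact: density_measurable (ltW T_gt0) (dphi j). Qed.

Let mphi' j : measurable_fun setT (fun t => clip phi' t j).
Proof.
apply: measurable_clip; apply/measurable_EFinP; have [+ _] := dphi j.
exact: measurable_int.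
Qed.

Notation lce := (left_cost_exp pi).

Definition left_psi w t j : R := lce w t * clip phi t j.

Definition left_psi' w t : R :=
  oapp (fun x => left_cost pi w t * lce w t * clip phi t x + lce w t * clip phi' t x) 0
    (left_state w t).

Definition left_drift w t : \bar R :=
  ((left_psi' w t)%:E + signed_sum (fun j => (left_psi w t j)%:E * left_rate pi w t j))%E.

Lemma driftE w t : 0 <= t <= T -> ~ jump_times w t ->
  drift pi phi phi' w t = left_drift w t.
Proof.
move=> tT nt; have t0 : 0 <= t by case/andP: tT.
have xE : left_state w t = xi w t by rewrite left_stateE//; exact: not_jump_time_gt0 nt.
rewrite /drift /left_drift; congr (_%:E + _)%E.
  rewrite /left_psi' xE; case: (xi w t) => //= x.
  by rewrite /psi' mean_costE// cost_expE// !clipE.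
congr signed_sum; apply/funext => j.
rewrite /psi /left_psi cost_expE// clipE//; congr (_ * _)%E.
by rewrite /left_rate xE.
Qed.

Lemma left_psi'E w v j : 0 <= v <= T -> ~ jump_times w v -> left_state w v = Some j ->
  psi' pi phi phi' w v j = left_psi' w v.
Proof.
move=> vT nv ls; have v0 : 0 <= v by case/andP: vT.
by rewrite /left_psi' ls /psi' mean_costE// cost_expE//= !clipE.
Qed.

Lemma measurable_lce : measurable_fun setT (fun x : Omega R S * R => lce x.1 x.2).
Proof. exact: measurable_left_cost_exp. Qed.

Lemma measurable_left_psi j : measurable_fun setT (fun x : Omega R S * R => left_psi x.1 x.2 j).
Proof.
apply: measurable_funM; first exact: measurable_lce.
exact: (measurableT_comp (mphi j) measurable_snd).
Qed.

Lemma measurable_left_psi' : measurable_fun setT (fun x : Omega R S * R => left_psi' x.1 x.2).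
Proof.
apply: (measurable_by_stages S_countable S_discrete (y := (0 : R))) => [k i|[w t] ns]; last first.
  by rewrite /left_psi' /= left_state_off.
exists (fun x => left_cost pi x.1 x.2 * lce x.1 x.2 * clip phi x.2 i + lce x.1 x.2 * clip phi' x.2 i).
  apply: measurable_funD; apply: measurable_funM.
  - apply: measurable_funM; last exact: measurable_lce.
    exact: measurable_left_cost.
  - exact: (measurableT_comp (mphi i) measurable_snd).
  - exact: measurable_lce.
  - exact: (measurableT_comp (mphi' i) measurable_snd).
by move=> [w t] [/= st mi]; rewrite /left_psi' (left_state_stage st) mi.
Qed.

Lemma measurable_left_rate j : measurable_fun setT (fun x : Omega R S * R => left_rate pi x.1 x.2 j).
Proof.
apply: (measurable_by_stages S_countable S_discrete (y := 0%E)) => [k i|[w t] ns]; last first.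
  by rewrite /left_rate /= left_state_off//= integral0.
exists (fun x => if j == i then - \esum_(l in [set: S]) intensity pi x.1 x.2 l
   else intensity pi x.1 x.2 j)%E.
  case: (j == i); last exact: measurable_intensity.
  apply: measurableT_comp => //; apply: measurable_esum => // [x l|l].
    exact: intensity_ge0.
  exact: measurable_intensity.
by move=> [w t] [/= st mi]; rewrite (left_rateE pi S_countable S_discrete j st mi).
Qed.

Lemma measurable_left_drift : measurable_fun setT (fun x : Omega R S * R => left_drift x.1 x.2).
Proof.
have mf j : measurable_fun setT (fun x : Omega R S * R =>
    (left_psi x.1 x.2 j)%:E * left_rate pi x.1 x.2 j)%E.
  apply: emeasurable_funM; last exact: measurable_left_rate.
  by apply/measurable_EFinP; exact: measurable_left_psi.
apply: emeasurable_funD.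
  by apply/measurable_EFinP; exact: measurable_left_psi'.
apply: emeasurable_funB; apply: measurable_esum => //.
- move=> j; have := measurable_funepos (mf j).
  by congr measurable_fun; apply/funext => x; rewrite !funeposE.
- move=> j; have := measurable_funeneg (mf j).
  by congr measurable_fun; apply/funext => x; rewrite !funenegE.
Qed.

Definition orient (b : bool) (a : R) : R := if b then a else - a.

(** Positive ([b = true]) or negative part of the increment of psi under a jump to
    z.2 at time z.1.2; the compensator deals with nonnegative integrands. *)
Definition jump_part (b : bool) (z : Omega R S * R * S) : \bar R :=
  oapp (fun x => (Num.max (orient b (left_psi z.1.1 z.1.2 z.2 - left_psi z.1.1 z.1.2 x)) 0)%:E)
    0%E (left_state z.1.1 z.1.2).

Lemma jump_part_ge0 b z : (0 <= jump_part b z)%E.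
Proof. by rewrite /jump_part; case: (left_state _ _) => //= x; rewrite lee_fin le_max lexx orbT. Qed.

Lemma measurable_jump_part b j :
  measurable_fun setT (fun x : Omega R S * R => jump_part b (x, j)).
Proof.
apply: (measurable_by_stages S_countable S_discrete (y := 0%E)) => [k i|[w t] ns]; last first.
  by rewrite /jump_part /= left_state_off.
exists (fun x => (Num.max (orient b (left_psi x.1 x.2 j - left_psi x.1 x.2 i)) 0)%:E).
  apply/measurable_EFinP; apply: measurable_maxr; last exact: measurable_cst.
  case: b => /=; last under eq_fun do rewrite opprB.
    by apply: measurable_funB; exact: measurable_left_psi.
  by apply: measurable_funB; exact: measurable_left_psi.
by move=> [w t] [/= st mi]; rewrite /jump_part /= (left_state_stage st) mi.
Qed.

Lemma left_psi_stop k w t j : stage w k t -> left_psi (stop k w) t j = left_psi w t j.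
Proof. by move=> st; rewrite /left_psi (left_cost_exp_stop pi st). Qed.

Lemma left_psi_stop_fun k w t : stage w k t -> left_psi w t = left_psi (stop k w) t.
Proof. by move=> st; apply/funext => j; rewrite (left_psi_stop j st). Qed.

Lemma jump_part_stop b k w t j : stage w k t ->
  jump_part b (w, t, j) = jump_part b (stop k w, t, j).
Proof.
move=> st; have ls := esym (left_state_stop st (stage_gt0 st) (lexx t)).
exact (f_equal2 (fun (l : option S) (p : S -> R) =>
  oapp (fun x => (Num.max (orient b (p j - p x)) 0)%:E) 0%E l) ls (left_psi_stop_fun st)).
Qed.

Lemma jump_part_off b w t j : (forall k, ~~ stage w k t) -> jump_part b (w, t, j) = 0%E.
Proof. by move=> ns; rewrite /jump_part /= left_state_off. Qed.

Definition part_rate b (x : Omega R S * R) : \bar R :=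
  \esum_(j in [set: S]) (jump_part b (x, j) * intensity pi x.1 x.2 j)%E.

Lemma part_rate_ge0 b x : (0 <= part_rate b x)%E.
Proof. by apply: esum_ge0 => j _; rewrite mule_ge0 ?jump_part_ge0// intensity_ge0. Qed.

Lemma measurable_part_rate b : measurable_fun setT (part_rate b).
Proof.
apply: measurable_esum => // [x j|j].
  by rewrite mule_ge0 ?jump_part_ge0// intensity_ge0.
by apply: emeasurable_funM; [exact: measurable_jump_part|exact: measurable_intensity].
Qed.

(** The weight whose occupation dominates everything, with a constant that bounds
    the exit rate and one that bounds the drift in terms of
    exp(int_0^t c) V1. *)
Definition sqr_weight j : R := V1 j ^+ 2.
Definition rate_const : R := M * M1.
Definition drift_const : R := C0 * M * M1 + C1 + C0 * (rho + 2 * M) * M1.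
Local Notation U := sqr_weight.
Local Notation C := rate_const.
Local Notation D := drift_const.

Let M_gt0 : 0 < M. Proof. exact: lt_trans M_gt1. Qed.

Lemma rate_const_ge0 : 0 <= C. Proof. by rewrite mulr_ge0// ltW// M_gt0. Qed.

Lemma sqr_weight_ge0 j : 0 <= U j. Proof. exact: sqr_ge0. Qed.

Let V_ge0 j : 0 <= V j. Proof. exact: le_trans (V_ge1 j). Qed.

Let V1_ge0 j : 0 <= V1 j. Proof. exact: le_trans (V1_ge1 j). Qed.

Lemma V_le_sqr j : V j <= V j ^+ 2.
Proof. by rewrite expr2 ler_peMl// V_ge0. Qed.

Lemma V_le_sqr_weight j : V j <= M1 * U j.
Proof.
rewrite (le_trans (V_le_sqr j))// (le_trans (V_V1 j))// ler_wpM2l ?(ltW M1_gt0)//.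
by rewrite /sqr_weight expr2 ler_peMl// V1_ge0.
Qed.

Lemma MV_le_sqr_weight j : M * V j <= C * U j.
Proof. by rewrite /rate_const -mulrA ler_wpM2l ?(ltW M_gt0)// V_le_sqr_weight. Qed.

Lemma MV_ge1 j : 1 <= M * V j.
Proof. by rewrite (le_trans (V_ge1 j))// ler_peMl ?V_ge0// ltW. Qed.

Lemma qstar_le_sqr_weight i : (qstar mdp i <= (C * U i)%:E)%E.
Proof. by rewrite (le_trans (rate_le i))// lee_fin MV_le_sqr_weight. Qed.

Lemma drift_const_ge0 : 0 <= D.
Proof.
have M0 := ltW M_gt0; have M10 := ltW M1_gt0.
by rewrite /drift_const !addr_ge0// !mulr_ge0// addr_ge0// mulr_ge0.
Qed.

Lemma mul_le_sum_sqr (a b : R) : 0 <= a -> 0 <= b -> a * b <= a ^+ 2 + b ^+ 2.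
Proof. move=> a0 b0; nra. Qed.

Section path.
Variable w : Omega R S.
Hypotheses (noexpl : explosion w = +oo%E) (occ : (occupation U T w < +oo)%E).

Let K := fine (occupation U T w).

(** A multiple of the sum of squares of exp(int_0^t c) and V1: the square of the
    first is at most C / T * K uniformly in t, the square of the second is U. *)
Definition path_bound v : R := D * (C / T * K + oapp U 0 (left_state w v)).

Let lce0 t : 0 <= lce w t. Proof. exact: expR_ge0. Qed.

Lemma path_bound_ge k t x (a : R) : 0 <= t <= T -> stage w k t -> mark w k = Some x -> 0 <= a ->
  a <= D -> a * (lce w t * V1 x) <= path_bound t.
Proof.
move=> tT st mx a0 aD; rewrite /path_bound (left_state_stage st) mx /=.
apply: ler_pM => //; first by rewrite mulr_ge0// V1_ge0.
apply: le_trans (mul_le_sum_sqr (lce0 t) (V1_ge0 x)) _; apply: lerD => //.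
exact: (left_cost_exp_le pi S_countable S_discrete T_gt0 sqr_weight_ge0 MV_ge1 MV_le_sqr_weight cost_le noexpl occ tT).
Qed.

Lemma left_cost_le_V k t x : stage w k t -> mark w k = Some x -> `|left_cost pi w t| <= M * V x.
Proof.
move=> st mx.
have := left_cost_expR_le pi T_gt0 MV_ge1 cost_le st mx.
apply: le_trans; apply: (@le_trans _ _ (2 * (1 + T) * `|left_cost pi w t|)).
  by rewrite ler_peMl//; have := T_gt0; lra.
by have := expR_ge1Dx (2 * (1 + T) * `|left_cost pi w t|); lra.
Qed.

Lemma left_psi'_le t : 0 < t <= T -> `|left_psi' w t| <= path_bound t.
Proof.
move=> /andP[t0 tT]; have tI : 0 <= t <= T by rewrite ltW.
have [k [x [st mx lx]]] := nonexploding_stage noexpl t0.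
rewrite /left_psi' lx /= !clipE//.
have M0 := ltW M_gt0; have M10 := ltW M1_gt0.
apply: (@le_trans _ _ ((C0 * M * M1 + C1) * (lce w t * V1 x))); last first.
  apply: (path_bound_ge tI st mx); first by rewrite addr_ge0// !mulr_ge0.
  by rewrite /drift_const lerDl !mulr_ge0// addr_ge0// mulr_ge0.
apply: le_trans (ler_normD _ _) _; rewrite mulrDl; apply: lerD; last first.
  by rewrite normrM (ger0_norm (lce0 t)) [leRHS]mulrCA ler_wpM2l// phi'_le.
rewrite !normrM (ger0_norm (lce0 t)).
have h1 := left_cost_le_V st mx; have h2 := phi_le x tI; have h3 := V_V1 x.
apply: (@le_trans _ _ (M * V x * lce w t * (C0 * V x))).
  by apply: ler_pM => //; [rewrite mulr_ge0|apply: ler_pM].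
have -> : M * V x * lce w t * (C0 * V x) = C0 * M * lce w t * V x ^+ 2 by ring.
have -> : C0 * M * M1 * (lce w t * V1 x) = C0 * M * lce w t * (M1 * V1 x) by ring.
by rewrite ler_wpM2l// !mulr_ge0.
Qed.

Let total k t x : stage w k t -> mark w k = Some x ->
  (\esum_(j in [set: S]) intensity pi w t j <= (M * V x)%:E)%E.
Proof.
move=> st mx; apply: (intensity_sum_le pi S_countable S_discrete st mx).
  by rewrite mulr_ge0 ?V_ge0// ltW// M_gt0.
exact: rate_le.
Qed.

Let weighted k t x : stage w k t -> mark w k = Some x ->
  (\esum_(j in [set: S]) ((V j)%:E * intensity pi w t j) <= ((rho + M) * V x ^+ 2)%:E)%E.
Proof.
move=> st mx.
apply: le_trans (intensity_drift pi S_countable S_discrete st mx V_ge0 rho_ge0 (@V_drift t x)) _.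
apply: (@le_trans _ _ ((rho * V x)%:E + (V x)%:E * (M * V x)%:E)%E).
  by apply: leeD => //; apply: lee_wpmul2l; [rewrite lee_fin V_ge0|exact: total st mx].
rewrite -EFinM -EFinD lee_fin mulrDl; apply: lerD; first by rewrite ler_wpM2l// V_le_sqr.
by rewrite mulrCA expr2.
Qed.

Let two_sided k t x : 0 <= t <= T -> stage w k t -> mark w k = Some x ->
  (\esum_(j in [set: S]) ((lce w t * C0 * (V j + V x))%:E * intensity pi w t j) <= (path_bound t)%:E)%E.
Proof.
move=> tI st mx; have M0 := ltW M_gt0; have M10 := ltW M1_gt0.
have i0 j : (0 <= intensity pi w t j)%E by exact: intensity_ge0.
have lC : 0 <= lce w t * C0 by rewrite mulr_ge0.
have -> : \esum_(j in [set: S]) ((lce w t * C0 * (V j + V x))%:E * intensity pi w t j)%E =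
  ((lce w t * C0)%:E * (\esum_(j in [set: S]) ((V j)%:E * intensity pi w t j) +
     (V x)%:E * \esum_(j in [set: S]) intensity pi w t j))%E.
  rewrite -esumZl ?V_ge0// -esumD; last 2 first.
  - by move=> j _; rewrite mule_ge0 ?lee_fin ?V_ge0.
  - by move=> j _; rewrite mule_ge0 ?lee_fin ?V_ge0.
  rewrite -esumZl//; last by move=> j; rewrite adde_ge0// mule_ge0 ?lee_fin ?V_ge0.
  apply: eq_esum => j _; rewrite EFinM -muleA; congr (_ * _)%E.
  by rewrite EFinD ge0_muleDl ?lee_fin ?V_ge0.
apply: (@le_trans _ _ ((C0 * (rho + 2 * M) * M1) * (lce w t * V1 x))%:E); last first.
  rewrite lee_fin; apply: (path_bound_ge tI st mx).
    by rewrite !mulr_ge0// addr_ge0// mulr_ge0.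
  by rewrite /drift_const lerDr addr_ge0// !mulr_ge0.
apply: (@le_trans _ _ ((lce w t * C0)%:E * (((rho + M) * V x ^+ 2)%:E + (V x)%:E * (M * V x)%:E))%E).
  apply: lee_wpmul2l; first by rewrite lee_fin.
  apply: leeD; first exact: weighted st mx.
  by apply: lee_wpmul2l; [rewrite lee_fin V_ge0|exact: total st mx].
rewrite -[leLHS]/((lce w t * C0 * ((rho + M) * V x ^+ 2 + V x * (M * V x)))%:E) lee_fin.
have -> : lce w t * C0 * ((rho + M) * V x ^+ 2 + V x * (M * V x)) =
   C0 * (rho + 2 * M) * lce w t * V x ^+ 2 by ring.
have -> : C0 * (rho + 2 * M) * M1 * (lce w t * V1 x) = C0 * (rho + 2 * M) * lce w t * (M1 * V1 x) by ring.
by rewrite ler_wpM2l// !mulr_ge0// addr_ge0// mulr_ge0.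
Qed.

Let left_psi_le t j : 0 <= t <= T -> `|left_psi w t j| <= lce w t * C0 * V j.
Proof.
by move=> tI; rewrite /left_psi clipE// normrM (ger0_norm (lce0 t)) -mulrA ler_wpM2l// phi_le.
Qed.

Let left_psi_diff t j x : 0 <= t <= T ->
  `|left_psi w t j - left_psi w t x| <= lce w t * C0 * (V j + V x).
Proof.
by move=> tI; rewrite mulrDr (le_trans (ler_normB _ _))// lerD// left_psi_le.
Qed.

Lemma part_rate_le b t : 0 < t <= T -> (part_rate b (w, t) <= (path_bound t)%:E)%E.
Proof.
move=> /andP[t0 tT]; have tI : 0 <= t <= T by rewrite ltW.
have [k [x [st mx lx]]] := nonexploding_stage noexpl t0.
rewrite /part_rate; apply: le_trans (two_sided tI st mx); apply: le_esum_pt => j.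
  by rewrite mule_ge0 ?jump_part_ge0// intensity_ge0.
apply: lee_wpmul2r; first exact: intensity_ge0.
rewrite /jump_part /= lx /= lee_fin (le_trans (max0_le_norm _))//.
by case: b => /=; rewrite ?normrN left_psi_diff.
Qed.

(** The rate to the present state compensates the jumps, so that only increments
    of psi appear. *)
Lemma left_driftE t : 0 < t <= T ->
  left_drift w t = ((left_psi' w t)%:E + (part_rate true (w, t) - part_rate false (w, t)))%E.
Proof.
move=> /andP[t0 tT]; have tI : 0 <= t <= T by rewrite ltW.
have [k [x [st mx lx]]] := nonexploding_stage noexpl t0.
rewrite /left_drift; congr (_ + _)%E.
rewrite (@signed_sum_compensated _ _ S_countable (left_psi w t) (intensity pi w t) _ x).
- rewrite /part_rate /jump_part /= lx /gain_sum /loss_sum /=; congr (_ - _)%E.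
  by apply: eq_esum => j _; rewrite opprB.
- by move=> j; exact: intensity_ge0.
- rewrite (intensity_stage pi S_discrete x st mx) integral0_eq// => a _.
  by rewrite /jump_rate eqxx.
- by rewrite (le_lt_trans (total st mx))// ltry.
- apply: (@le_lt_trans _ _ (path_bound t)%:E); last exact: ltry.
  apply: le_trans (two_sided tI st mx); apply: le_esum_pt => j.
    by rewrite mule_ge0 ?lee_fin// intensity_ge0.
  apply: lee_wpmul2r; first exact: intensity_ge0.
  rewrite lee_fin (le_trans (left_psi_le j tI))// ler_wpM2l ?mulr_ge0//.
  by rewrite lerDl V_ge0.
- by move=> j; rewrite (left_rateE pi S_countable S_discrete j st mx).
Qed.

Lemma occupationK : occupation U T w = K%:E.
Proof.
rewrite /K fineK// ge0_fin_numE//; exact: occupation_ge0 sqr_weight_ge0 _ _.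
Qed.

Lemma K_ge0 : 0 <= K.
Proof. by rewrite -lee_fin -occupationK occupation_ge0//; exact: sqr_weight_ge0. Qed.

Lemma path_bound_integral :
  (\int[mu]_(v in `]0%R, T]) (path_bound v)%:E = (D * (C + 1) * K)%:E)%E.
Proof.
have oU v : 0 <= oapp U 0 (left_state w v) by case: (left_state w v) => //= x; exact: sqr_weight_ge0.
have CK : 0 <= C / T * K by rewrite mulr_ge0 ?K_ge0// divr_ge0 ?rate_const_ge0// ltW.
have mU : measurable_fun `]0, T] (fun v => (oapp U 0 (left_state w v))%:E).
  by have /measurable_int := left_weight_integrable S_countable S_discrete sqr_weight_ge0 occ.
under eq_integral => v _.
  rewrite (_ : (path_bound v)%:E =
    (D%:E * ((C / T * K)%:E + (oapp U 0 (left_state w v))%:E))%E) //.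
  over.
rewrite ge0_integralZl//=; last 3 first.
- by apply: emeasurable_funD => //; exact: measurable_cst.
- by move=> v _; rewrite lee_fin addr_ge0.
- by rewrite lee_fin drift_const_ge0.
rewrite ge0_integralD//; last first.
- by move=> v _; rewrite lee_fin.
rewrite integral_cst//= lebesgue_measure_itv/= lte_fin T_gt0 sube0.
rewrite -/(occupation U T w) occupationK.
rewrite -[LHS]/((D * (C / T * K * T + K))%:E); congr EFin.
by field; rewrite gt_eqF.
Qed.

Let left_psi'_meas : measurable_fun setT (left_psi' w).
Proof.
exact: (measurable_section_time (f := fun x => left_psi' x.1 x.2) w measurable_left_psi').
Qed.

Lemma path_bound_integrable : mu.-integrable `]0, T] (EFin \o path_bound).
Proof.
have iU := left_weight_integrable S_countable S_discrete sqr_weight_ge0 occ.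
have ic : mu.-integrable `]0, T] (EFin \o (fun=> C / T * K)).
  apply/integrableP; split; first exact: measurable_cst.
  rewrite (_ : (fun v => _) = cst `|C / T * K|%:E)// integral_cst//=.
  by rewrite lebesgue_measure_itv/= lte_fin T_gt0 -EFinB -EFinM ltry.
exact: (integrableZl _ D (integrableD _ ic iU)).
Qed.

Lemma left_psi'_integrable : mu.-integrable `]0, T] (EFin \o left_psi' w).
Proof.
apply: (le_integrable _ _ _ path_bound_integrable) => //.
  by apply/measurable_EFinP; exact: measurable_funTS.
move=> v; rewrite /= in_itv/= => vT; rewrite lee_fin (le_trans (left_psi'_le vT))//.
exact: ler_norm.
Qed.

Let left_psiE t j : 0 <= t <= T -> left_psi w t j = psi pi phi w t j.
Proof. by move=> tT; rewrite /left_psi /psi cost_expE// clipE. Qed.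

(** On a stage the state is constant, and psi at this state has density psi'. *)
Lemma left_psi_stage k s t j : (jump_time w k <= s%:E)%E -> s <= t -> t <= T ->
  (t%:E <= jump_time w k.+1)%E -> mark w k = Some j ->
  left_psi w t j - left_psi w s j = \int[mu]_(v in `]s, t]) left_psi' w v.
Proof.
move=> ks st tT tk mj.
have s0 : 0 <= s by rewrite -lee_fin (le_trans (jump_time_ge0 w k)).
have [ipsi dpsi] := psi_density pi S_countable S_discrete T_gt0 sqr_weight_ge0 MV_ge1 MV_le_sqr_weight cost_le noexpl occ (dphi j).
have t0 := le_trans s0 st; have sT := le_trans st tT.
rewrite !left_psiE ?t0 ?s0 //.
have -> : psi pi phi w t j - psi pi phi w s j =
   (psi pi phi w t j - psi pi phi w 0 j) - (psi pi phi w s j - psi pi phi w 0 j) by ring.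
rewrite !dpsi ?in_itv/= ?t0 ?s0// (Rintegral_increment ipsi)// /Rintegral; congr fine.
apply: (integral_off_countable (C := jump_times w)) => //.
- exact: countable_jump_times.
- by apply/measurable_EFinP; exact: measurable_funTS.
move=> v; rewrite /= in_itv/= => /andP[sv vt] nv; congr EFin.
have v0 : 0 <= v by rewrite (le_trans s0)// ltW.
have vI : 0 <= v <= T by rewrite v0 (le_trans vt).
have stv : stage w k v.
  apply/andP; split; first by rewrite (le_lt_trans ks)// lte_fin.
  by rewrite (le_trans _ tk)// lee_fin.
apply: (left_psi'E vI nv); rewrite (left_state_stage stv); exact: mj.
Qed.

(** Increment of psi at the n-th jump, in the form in which the jump integrands
    produce it. *)
Definition jump_at n : R :=
  fine (oapp (fun j => jump_part true (w, fine (jump_time w n), j)) 0%E (mark w n)) -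
  fine (oapp (fun j => jump_part false (w, fine (jump_time w n), j)) 0%E (mark w n)).

Lemma jump_atE n x j : (jump_time w n.+1 < +oo)%E -> mark w n = Some x -> mark w n.+1 = Some j ->
  jump_at n.+1 = left_psi w (fine (jump_time w n.+1)) j - left_psi w (fine (jump_time w n.+1)) x.
Proof.
move=> tn mx mj; rewrite /jump_at mj /= /jump_part /=.
rewrite (@left_state_stage _ _ _ w n) ?mx /=; last first.
  rewrite /stage -jump_time_finE// lexx andbT; apply: jump_time_ltS.
  exact: le_lt_trans (jump_time_leS _ _) tn.
by rewrite max0B.
Qed.

Let left_psi'_split s t : 0 <= s -> s <= t -> t <= T ->
  \int[mu]_(v in `]0, t]) left_psi' w v =
  \int[mu]_(v in `]0, s]) left_psi' w v + \int[mu]_(v in `]s, t]) left_psi' w v.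
Proof.
move=> s0 st tT; apply/eqP; rewrite addrC -subr_eq; apply/eqP; apply: Rintegral_itvB.
- by apply: integrableS left_psi'_integrable => //; apply: subset_itv; rewrite bnd_simp.
- by rewrite bnd_simp.
- by rewrite bnd_simp.
Qed.

(** Induction over the stages: [left_psi_stage] between two jumps, and
    [jump_atE] at a jump. *)
Lemma left_psi_jump n x : (jump_time w n <= T%:E)%E -> mark w n = Some x ->
  left_psi w (fine (jump_time w n)) x = phi 0 (initial w) +
    \int[mu]_(v in `]0, fine (jump_time w n)]) left_psi' w v + \sum_(1 <= m < n.+1) jump_at m.
Proof.
elim: n x => [|n IH] x nT mx.
  rewrite jump_time0 /= set_itvoc0 Rintegral_set0 big_geq// !addr0.
  move: mx => /= [<-]; rewrite /left_psi clipE ?lexx ?(ltW T_gt0)//.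
  by rewrite /left_cost_exp set_itv1 Rintegral_set1 expR0 mul1r.
have nT' := le_trans (jump_time_leS w n) nT.
have nF : (jump_time w n < +oo)%E by rewrite (le_lt_trans nT')// ltry.
have nF' : (jump_time w n.+1 < +oo)%E by rewrite (le_lt_trans nT)// ltry.
have [y my] := mark_some nF.
have E1 := jump_time_finE nF; have E2 := jump_time_finE nF'.
have le12 : fine (jump_time w n) <= fine (jump_time w n.+1).
  by rewrite -lee_fin -E1 -E2 jump_time_leS.
have t0 : 0 <= fine (jump_time w n) by rewrite fine_ge0 ?jump_time_ge0.
have t2T : fine (jump_time w n.+1) <= T by rewrite -lee_fin -E2.
have := jump_atE nF' my mx.
have := left_psi_stage (k := n) (s := fine (jump_time w n)) (t := fine (jump_time w n.+1)) (j := y).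
rewrite -E1 -E2 => /(_ (lexx _) le12 t2T (lexx _) my) H1 H2.
rewrite big_nat_recr//= H2 (left_psi'_split t0 le12 t2T) -H1 IH//; ring.
Qed.

Lemma jump_part_after b t j : T < t -> jump_part b (w, t, j) = 0%E.
Proof.
move=> Tt; rewrite /jump_part /=; case: (left_state w t) => //= x.
rewrite /left_psi /clip [t <= T]leNgt Tt andbF !mulr0 subrr.
by rewrite (_ : orient b 0 = 0) ?maxxx//; case: b; rewrite /= ?oppr0.
Qed.

(** The jumps after T have weight zero, and finitely many jumps occur before T. *)
Lemma mpp_finite_sum (W : Omega R S * R * S -> \bar R) N :
  (forall x, (0 <= W x)%E) -> (forall x, W x \is a fin_num) ->
  (forall t j, T < t -> W (w, t, j) = 0%E) ->
  (T%:E < jump_time w N.+1)%E -> (jump_time w N <= T%:E)%E ->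
  mpp_integral W w = (\sum_(1 <= n < N.+1)
    fine (oapp (fun j => W (w, fine (jump_time w n), j)) 0%E (mark w n)))%:E.
Proof.
move=> W0 Wf Wafter TN NT; rewrite /mpp_integral (@nneseries_split _ _ 1 N) => [|k _]; last first.
  by rewrite mpp_termE; case: ifP => // _; case: (mark w k) => /=.
rewrite add1n [X in (_ + X)%E]eseries0 ?adde0 => [|n Nn _]; last first.
  rewrite mpp_termE; case: ifP => // nF; case: (mark w n) => //= j; apply: Wafter.
  by rewrite -lte_fin -jump_time_finE// (lt_le_trans TN)// le_jump_time.
rewrite -sumEFin; apply: eq_big_nat => n /andP[_ nN]; rewrite mpp_termE.
rewrite ifT; last by rewrite (le_lt_trans (le_jump_time w (nN : (n <= N)%N)))// (le_lt_trans NT)// ltry.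
by rewrite fineK//; case: (mark w n) => [j|] /=; [exact: Wf|].
Qed.

(** [left_psi_jump] at the last jump before T, then [left_psi_stage] up to T. *)
Lemma path_identity :
  [/\ mpp_integral (jump_part true) w \is a fin_num,
      mpp_integral (jump_part false) w \is a fin_num &
  terminal_value pi phi T w = phi 0 (initial w) + \int[mu]_(v in `]0, T]) left_psi' w v +
    fine (mpp_integral (jump_part true) w) - fine (mpp_integral (jump_part false) w)].
Proof.
have T0 := ltW T_gt0.
have [|N /andP[NT TN]] := xi_ex (w := w) T0; first by rewrite noexpl ltry.
have jf b x : jump_part b x \is a fin_num by rewrite /jump_part; case: (left_state _ _).
rewrite !(mpp_finite_sum (@jump_part_ge0 _) (jf _) (@jump_part_after _) TN NT).
split=> //=; have NF : (jump_time w N < +oo)%E by rewrite (le_lt_trans NT)// ltry.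
have [x mx] := mark_some NF; have E := jump_time_finE NF.
have tT : fine (jump_time w N) <= T by rewrite -lee_fin -E.
rewrite /terminal_value (@xi_interval _ _ _ w N) ?NT// mx /=.
rewrite -left_psiE ?T0 ?lexx//.
have := left_psi_stage (k := N) (s := fine (jump_time w N)) (t := T) (j := x).
rewrite -E => /(_ (lexx _) tT (lexx _) (ltW TN) mx) H1.
have := left_psi_jump NT mx => H2.
have t0 : 0 <= fine (jump_time w N) by rewrite fine_ge0 ?jump_time_ge0.
have -> : left_psi w T x = left_psi w T x - left_psi w (fine (jump_time w N)) x + left_psi w (fine (jump_time w N)) x by rewrite subrK.
rewrite H1 H2 (left_psi'_split t0 tT (lexx _)) /jump_at sumrB; ring.
Qed.

(** Every path-wise bound below is an instance, with the same constant. *)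
Lemma path_dominated (f : R -> \bar R) : measurable_fun setT f ->
  (forall v, 0 < v <= T -> (`|f v| <= (path_bound v)%:E)%E) ->
  mu.-integrable `]0, T] f /\
  (\int[mu]_(v in `]0%R, T]) `|f v| <= (D * (C + 1) * K)%:E)%E.
Proof.
move=> mf fb; have mfT : measurable_fun `]0, T] f by exact: measurable_funTS.
have mb : measurable_fun `]0, T] (fun v => (path_bound v)%:E).
  by have /measurable_int := path_bound_integrable.
have H : (\int[mu]_(v in `]0%R, T]) `|f v| <= (D * (C + 1) * K)%:E)%E.
  rewrite -path_bound_integral; apply: ge0_le_integral => //; exact: measurableT_comp.
split; last exact: H.
by apply/integrableP; split; [exact: mfT|rewrite (le_lt_trans H)// ltry].
Qed.

Lemma part_rate_dominated b : mu.-integrable `]0, T] (fun v => part_rate b (w, v)) /\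
  (\int[mu]_(v in `]0%R, T]) part_rate b (w, v) <= (D * (C + 1) * K)%:E)%E.
Proof.
have [|v vT|i h] := @path_dominated (fun v => part_rate b (w, v)).
- exact: (measurable_section_time (f := part_rate b) w (measurable_part_rate b)).
- by rewrite gee0_abs ?part_rate_ge0// part_rate_le.
split => //; apply: le_trans h; rewrite le_eqVlt; apply/orP; left; apply/eqP.
by apply: eq_integral => v _; rewrite gee0_abs// part_rate_ge0.
Qed.

Lemma left_psi'_dominated : mu.-integrable `]0, T] (fun v => (left_psi' w v)%:E) /\
  (\int[mu]_(v in `]0%R, T]) `|(left_psi' w v)%:E| <= (D * (C + 1) * K)%:E)%E.
Proof.
apply: path_dominated => [|v vT]; first exact/measurable_EFinP.
by rewrite lee_fin left_psi'_le.
Qed.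

Lemma left_drift_integrable : mu.-integrable `]0, T] (left_drift w).
Proof.
have [iu _] := part_rate_dominated true; have [id' _] := part_rate_dominated false.
have [ip _] := left_psi'_dominated.
pose f := ((fun v => (left_psi' w v)%:E) \+
  ((fun v => part_rate true (w, v)) \- (fun v => part_rate false (w, v))))%E.
have i : mu.-integrable `]0, T] f by apply: integrableD => //; exact: integrableB.
have E v : v \in (`]0, T]%classic : set R) -> left_drift w v = f v.
  by rewrite inE /= in_itv/= => vT; rewrite left_driftE.
have /integrableP[mf fi] := i; apply/integrableP; split.
  by apply: eq_measurable_fun mf => v vT; rewrite E.
by under eq_integral => v vT do rewrite E//.
Qed.

Lemma left_drift_integral :
  (\int[mu]_(v in `]0%R, T]) left_drift w v = \int[mu]_(v in `]0%R, T]) (left_psi' w v)%:E +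
   (\int[mu]_(v in `]0%R, T]) part_rate true (w, v) - \int[mu]_(v in `]0%R, T]) part_rate false (w, v)))%E.
Proof.
have [iu _] := part_rate_dominated true; have [id' _] := part_rate_dominated false.
have [ip _] := left_psi'_dominated.
rewrite -(integralB _ iu id')// -(integralD _ ip (integrableB _ iu id'))//.
by apply: eq_integral => v; rewrite inE /= in_itv/= => vT; rewrite left_driftE.
Qed.

Lemma drift_integrable : mu.-integrable `[0, T] (drift pi phi phi' w).
Proof.
have ml : measurable_fun setT (left_drift w).
  exact: (measurable_section_time (f := fun x => left_drift x.1 x.2) w measurable_left_drift).
have E v : `[0, T]%classic v -> ~ jump_times w v -> drift pi phi phi' w v = left_drift w v.
  by rewrite /= in_itv/= => vT nv; exact: driftE.
apply/integrableP; split.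
  by apply: (measurable_off_countable (countable_jump_times w) _ _ E) => //; exact: measurable_funTS.
rewrite (integral_off_countable (C := jump_times w) (g := fun v => `|left_drift w v|%E)) => //.
- rewrite -integral_itv_obnd_cbnd; first by have /integrableP[] := left_drift_integrable.
  by apply: measurable_funTS; exact: measurableT_comp.
- exact: countable_jump_times.
- by apply: measurable_funTS; exact: measurableT_comp.
- by move=> v vT nv; rewrite E.
Qed.

End path.

Lemma part_rate_after b w t : T < t -> part_rate b (w, t) = 0%E.
Proof. by move=> Tt; apply: esum1 => j _; rewrite jump_part_after// mul0e. Qed.

Lemma integral_truncate (f : R -> \bar R) : (forall t, T < t -> f t = 0%E) ->
  (\int[mu]_(t in `]0%R, +oo[) f t = \int[mu]_(t in `]0%R, T]) f t)%E.
Proof.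
move=> f0; rewrite [LHS]integral_mkcond [RHS]integral_mkcond.
apply: eq_integral => t _; rewrite !patchE !mem_setE !in_itv/= andbT.
by case: (0 < t) => //=; case: leP => // /f0.
Qed.

(** * Expectations *)

Section expectation.
Variables (P : probability (Omega R S) R) (rho1 : R) (i0 : S).
Hypothesis comp : is_compensator P (jump_intensity pi).
Hypothesis rho1_ge0 : 0 <= rho1.
Hypothesis U_drift : forall t i a, graph mdp (t, i, a) ->
  (signed_sum (fun j => (U j)%:E * rate mdp (t, i, a) [set j]) <= (rho1 * U i)%:E)%E.
Hypothesis initial_ae : {ae P, forall w, initial w = i0}.

Let PT : (P : {measure set _ -> \bar R}) [set: Omega R S] = 1%E.
Proof. exact: (probability_setT P). Qed.

Lemma initial_weight : (\int[P]_w (oapp U 0 (mark w 0))%:E < +oo)%E.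
Proof.
rewrite (@ae_eq_integral _ _ _ P setT (cst (U i0)%:E)) => //.
- by rewrite integral_cst// PT mule1 ltry.
- by apply/measurable_EFinP; exact: (measurable_mark_fun S_countable S_discrete (oapp U 0) 0).
- by apply: filterS initial_ae => w /= ->.
Qed.

Definition regular_path w : Prop := explosion w = +oo%E /\ (occupation U T w < +oo)%E.

Lemma regular_path_ae : {ae P, forall w, regular_path w}.
Proof.
have h1 := explosion_ae S_countable S_discrete comp sqr_weight_ge0 rho1_ge0 U_drift initial_weight rate_const_ge0 qstar_le_sqr_weight.
have h2 : P.-integrable setT (occupation U T).
  apply/integrableP; split; first exact: (measurable_occupation S_countable S_discrete sqr_weight_ge0).
  under eq_integral => w _ do rewrite (gee0_abs (occupation_ge0 sqr_weight_ge0 T w)).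
  exact: (expected_occupation S_countable S_discrete comp sqr_weight_ge0 rho1_ge0 U_drift initial_weight (ltW T_gt0)).
apply: filterS2 h1 (integrable_ae measurableT h2) => w e o; split => //.
by rewrite ltey_eq (o I).
Qed.

(* The common bound of the time integrals; its expectation is finite. *)
Let B w := ((D * (C + 1))%:E * occupation U T w)%E.

Let B_ge0 w : (0 <= B w)%E.
Proof.
rewrite mule_ge0//; first by rewrite lee_fin mulr_ge0 ?drift_const_ge0// addr_ge0// rate_const_ge0.
exact: occupation_ge0 sqr_weight_ge0 _ _.
Qed.

Let mB : measurable_fun setT B.
Proof.
by apply: emeasurable_funM; [exact: measurable_cst|exact: (measurable_occupation S_countable S_discrete sqr_weight_ge0)].
Qed.

Let B_fin : (\int[P]_w B w < +oo)%E.
Proof.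
rewrite ge0_integralZl_EFin//.
- apply: lte_mul_pinfty => //; first by rewrite lee_fin mulr_ge0 ?drift_const_ge0// addr_ge0// rate_const_ge0.
  exact: (expected_occupation S_countable S_discrete comp sqr_weight_ge0 rho1_ge0 U_drift initial_weight (ltW T_gt0)).
- by move=> w _; exact: occupation_ge0 sqr_weight_ge0 _ _.
- exact: (measurable_occupation S_countable S_discrete sqr_weight_ge0).
- by rewrite mulr_ge0 ?drift_const_ge0// addr_ge0// rate_const_ge0.
Qed.

Let BE w : regular_path w -> B w = (D * (C + 1) * fine (occupation U T w))%:E.
Proof. by move=> [_ occ]; rewrite /B (occupationK occ). Qed.

Let expected_le (f : Omega R S -> \bar R) : measurable_fun setT f -> (forall w, 0 <= f w)%E ->
  (forall w, regular_path w -> (f w <= B w)%E) -> (\int[P]_w f w < +oo)%E.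
Proof.
move=> mf f0 fB; apply: le_lt_trans B_fin.
apply: ae_ge0_le_integral => //.
by apply: filterS regular_path_ae => w /fB.
Qed.

Let integrable_ge0 (f : Omega R S -> \bar R) : measurable_fun setT f -> (forall w, 0 <= f w)%E ->
  (\int[P]_w f w < +oo)%E -> P.-integrable setT f.
Proof.
move=> mf f0 ff; apply/integrableP; split => //.
by under eq_integral => w _ do rewrite (gee0_abs (f0 w)).
Qed.

(* G true and G false are the accumulated gain and loss rates, J true and J false
   the corresponding sums over the jumps. *)
Let G b w := (\int[mu]_(t in `]0%R, +oo[) part_rate b (w, t))%E.
Let J b := mpp_integral (jump_part b).
Let Psi w := (\int[mu]_(t in `]0%R, T]) (left_psi' w t)%:E)%E.

Let GE b w : G b w = (\int[mu]_(t in `]0%R, T]) part_rate b (w, t))%E.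
Proof. by apply: integral_truncate => t; exact: part_rate_after. Qed.

Let mG b : measurable_fun setT (G b).
Proof.
apply: (measurable_time_integral (f := part_rate b)) => //.
- exact: measurable_part_rate.
- exact: part_rate_ge0.
Qed.

Let G0 b w : (0 <= G b w)%E. Proof. by apply: integral_ge0 => t _; exact: part_rate_ge0. Qed.

Let G_fin b : (\int[P]_w G b w < +oo)%E.
Proof.
apply: (expected_le (mG b) (G0 b)) => w g; rewrite GE (BE g); have [e o] := g.
by have [] := part_rate_dominated e o b.
Qed.

(** Gains and losses are compensated separately, each being finite in expectation. *)
Lemma jump_part_formula b : (\int[P]_w J b w = \int[P]_w G b w)%E.
Proof.
apply: (compensator_formula S_countable S_discrete comp).
- exact: jump_part_ge0.
- exact: measurable_jump_part.
- by move=> k w t j; exact: jump_part_stop.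
- by move=> w t j; exact: jump_part_off.
Qed.

Let mpp_ge0 (W : Omega R S * R * S -> \bar R) w : (forall x, 0 <= W x)%E -> (0 <= mpp_integral W w)%E.
Proof.
move=> W0; apply: nneseries_ge0 => n _ _; rewrite mpp_termE; case: ifP => // _.
by case: (mark w n) => /=.
Qed.

Let measurable_signed_integral (f : Omega R S * R -> \bar R) : measurable_fun setT f ->
  measurable_fun setT (fun w => \int[mu]_(t in `]0%R, T]) f (w, t))%E.
Proof.
move=> mf; rewrite (_ : (fun w => _) = fun w =>
  (\int[mu]_(t in `]0%R, T]) f^\+ (w, t) - \int[mu]_(t in `]0%R, T]) f^\- (w, t))%E); last first.
  apply/funext => w; rewrite integralE; congr (_ - _)%E;
    by apply: eq_integral => v _; rewrite ?funeposE ?funenegE.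
apply: emeasurable_funB; apply: measurable_time_integral => //.
- exact: measurable_funepos.
- exact: measurable_funeneg.
Qed.

Let Psi_integrable : P.-integrable setT Psi.
Proof.
have mp : measurable_fun setT (fun x => (left_psi' x.1 x.2)%:E).
  by apply/measurable_EFinP; exact: measurable_left_psi'.
have mPsi : measurable_fun setT Psi by exact: (measurable_signed_integral mp).
apply/integrableP; split => //; apply: expected_le => [|//|w g].
  exact: measurableT_comp.
rewrite (BE g); have [e o] := g; have [ip] := left_psi'_dominated e o; apply: le_trans.
by apply: le_abse_integral => //; exact: measurable_int ip.
Qed.

Lemma drift_integralE w :
  (\int[mu]_(t in `[0%R, T]) drift pi phi phi' w t = \int[mu]_(t in `]0%R, T]) left_drift w t)%E.
Proof.
have ml : measurable_fun setT (left_drift w).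
  exact: (measurable_section_time (f := fun x => left_drift x.1 x.2) w measurable_left_drift).
rewrite (integral_off_countable (C := jump_times w) (g := left_drift w)) => //.
- by rewrite -integral_itv_obnd_cbnd//; exact: measurable_funTS.
- exact: countable_jump_times.
- exact: measurable_funTS.
- by move=> v; rewrite /= in_itv/= => vT nv; exact: driftE.
Qed.

Lemma measurable_drift_integral :
  measurable_fun setT (fun w => \int[mu]_(t in `[0%R, T]) drift pi phi phi' w t)%E.
Proof.
under eq_fun do rewrite drift_integralE.
exact: (measurable_signed_integral measurable_left_drift).
Qed.

Lemma measurable_xi j : measurable [set w : Omega R S | xi w T = Some j].
Proof.
rewrite (_ : [set _ | _] = \bigcup_k ([set w : Omega R S | (jump_time w k <= T%:E)%E] `&`
   [set w | (T%:E < jump_time w k.+1)%E] `&` [set w | mark w k = Some j])).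
  apply: bigcupT_measurable => k; apply: measurableI; last exact: measurable_mark_eq.
  apply: measurableI.
    have := emeasurable_fun_infty_c measurableT (@measurable_jump_time R dS S k) T%:E.
    by rewrite setTI.
  have := emeasurable_fun_o_infty measurableT (@measurable_jump_time R dS S k.+1) T%:E.
  by rewrite setTI.
apply/seteqP; split => w /=.
  move=> xj; have [|k kT] := xi_ex (w := w) (ltW T_gt0).
    by rewrite ltNge; apply/negP => /xi_explosion; rewrite xj.
  by exists k => //=; case/andP: (kT) => a b; rewrite -(xi_interval kT) xj.
by move=> [k _ [[a b] <-]]; apply: xi_interval; rewrite a.
Qed.

Lemma measurable_terminal_value : measurable_fun setT (terminal_value pi phi T).
Proof.
apply: (measurable_by_value S_countable (o := fun w => xi w T)) => [j|o].
  exact: measurable_xi.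
case: o => [j|]; last by exists (cst 0) => [|w H]; [exact: measurable_cst|rewrite /terminal_value H].
exists (fun w => lce w T * phi T j) => [|w H].
  apply: measurable_funM; last exact: measurable_cst.
  have mp : measurable_fun setT (fun w : Omega R S => (w, T)).
    by apply: measurable_fun_pair; [exact: measurable_id|exact: measurable_cst].
  exact: (measurableT_comp measurable_lce mp).
by rewrite /terminal_value H /= /psi cost_expE.
Qed.

Let iG b : P.-integrable setT (G b).
Proof. exact: (integrable_ge0 (mG b) (G0 b) (G_fin b)). Qed.

Let iJ b : P.-integrable setT (J b).
Proof.
apply: integrable_ge0; last by rewrite jump_part_formula.
  exact: (measurable_mpp S_countable S_discrete (jump_part_ge0 b) (measurable_jump_part b)).
by move=> w; exact: mpp_ge0 (jump_part_ge0 b).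
Qed.

Let drift_ae : {ae P, forall w,
  (\int[mu]_(t in `[0%R, T]) drift pi phi phi' w t = Psi w + (G true w - G false w))%E}.
Proof.
apply: filterS regular_path_ae => w [e o].
by rewrite drift_integralE (left_drift_integral e o) !GE.
Qed.

Let terminal_ae : {ae P, forall w,
  ((terminal_value pi phi T w)%:E = (phi 0 i0)%:E + (Psi w + (J true w - J false w)))%E}.
Proof.
apply: filterS2 regular_path_ae initial_ae => w [e o] iw.
have [fu fd ->] := path_identity e o; rewrite iw.
have [ip _] := left_psi'_dominated e o.
have fP : Psi w \is a fin_num by exact: integrable_fin_num ip.
by rewrite EFinB 2!EFinD !fineK// -!addeA.
Qed.

Let ae_integrable (f g : Omega R S -> \bar R) : measurable_fun setT f ->
  P.-integrable setT g -> {ae P, forall w, f w = g w} -> P.-integrable setT f.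
Proof.
move=> mf /integrableP[mg ig] fg; apply/integrableP; split => //.
rewrite (@ae_eq_integral _ _ _ P setT (fun w => `|g w|%E)) => //.
- exact: measurableT_comp.
- exact: measurableT_comp.
- by apply: filterS fg => w /= ->.
Qed.

Let i1 : P.-integrable setT (fun w => Psi w + (G true w - G false w))%E.
Proof. exact: (integrableD _ Psi_integrable (integrableB _ (iG true) (iG false))). Qed.

Let iphi : P.-integrable setT (cst (phi 0 i0)%:E : Omega R S -> \bar R).
Proof. exact: finite_measure_integrable_cst. Qed.

Let i3 : P.-integrable setT (fun w => Psi w + (J true w - J false w))%E.
Proof. exact: (integrableD _ Psi_integrable (integrableB _ (iJ true) (iJ false))). Qed.

Let i2 : P.-integrable setT (fun w => (phi 0 i0)%:E + (Psi w + (J true w - J false w)))%E.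
Proof. exact: (integrableD _ iphi i3). Qed.

Lemma drift_integral_integrable :
  P.-integrable setT (fun w => \int[mu]_(t in `[0%R, T]) drift pi phi phi' w t)%E.
Proof. exact: ae_integrable measurable_drift_integral i1 drift_ae. Qed.

Let mterm : measurable_fun setT (EFin \o terminal_value pi phi T).
Proof. by apply/measurable_EFinP; exact: measurable_terminal_value. Qed.

Lemma terminal_value_integrable : P.-integrable setT (EFin \o terminal_value pi phi T).
Proof. exact: ae_integrable mterm i2 terminal_ae. Qed.

(** Almost surely the drift integral is Psi + (G true - G false), and the terminal
    value is phi(0, i0) + Psi + (J true - J false). *)
Lemma dynkin_formula :
  (\int[P]_w \int[mu]_(t in `[0%R, T]) drift pi phi phi' w t =
   \int[P]_w (terminal_value pi phi T w)%:E - (phi 0%R i0)%:E)%E.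
Proof.
rewrite (@ae_eq_integral _ _ _ P setT (fun w => Psi w + (G true w - G false w))%E) => //; last first.
- by apply: filterS drift_ae => w.
- exact: measurable_int i1.
- exact: measurable_drift_integral.
rewrite [X in (_ = X - _)%E](@ae_eq_integral _ _ _ P setT
  (fun w => (phi 0%R i0)%:E + (Psi w + (J true w - J false w)))%E) => //; last first.
- by apply: filterS terminal_ae => w.
- exact: measurable_int i2.
rewrite (integralD _ iphi i3)// integral_cst// PT mule1 addeAC subee// add0e.
rewrite (integralD _ Psi_integrable (integrableB _ (iG true) (iG false)))//.
rewrite (integralD _ Psi_integrable (integrableB _ (iJ true) (iJ false)))//.
by rewrite (integralB _ (iG true) (iG false))// (integralB _ (iJ true) (iJ false))// !jump_part_formula.
Qed.

End expectation.
End drift.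

(** * Constants and initial state *)
Lemma weight_bounded_ex (R : realType) dS (S : measurableType dS) (T : R) (W : S -> R)
    (f : R -> S -> R) : (forall j, 1 <= W j) -> weight_bounded T W f ->
  exists2 C, 0 <= C & forall t j, 0 <= t <= T -> `|f t j| <= C * W j.
Proof.
move=> W1; rewrite /weight_bounded; set s := ereal_sup _ => sy.
have ub t j : 0 <= t <= T -> ((`|f t j| / W j)%:E <= s)%E.
  by move=> tT; apply: ereal_sup_ubound; exists (t, j) => //; split => //=; rewrite in_itv.
exists (`|fine s|) => // t j tT; have W0 : 0 < W j by rewrite (lt_le_trans ltr01).
have sf : s \is a fin_num.
  by rewrite fin_numElt sy andbT (lt_le_trans _ (ub t j tT))// ltNyr.
apply: (le_trans (y := fine s * W j)); last by rewrite ler_wpM2r ?ler_norm// ltW.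
by rewrite -(ler_pdivrMr _ _ W0) -lee_fin fineK// ub.
Qed.

Lemma initial_state_ae (R : realType) dS (S : measurableType dS) (S_discrete : forall B : set S, measurable B)
    (P : probability (Omega R S) R) (i : S) : P [set w | xi w 0 = Some i] = 1%E ->
  {ae P, forall w, initial w = i}.
Proof.
have E (w : Omega R S) : xi w 0 = Some (initial w).
  apply: (@xi_interval _ _ _ w 0); have := @jump_time_ltS _ _ _ w 0.
  by rewrite jump_time0 lexx => /(_ (ltry _)) ->.
have mi : measurable [set w : Omega R S | initial w = i].
  have := @measurable_initial R dS S measurableT [set i] (S_discrete _).
  by rewrite setTI.
rewrite (_ : [set w | _] = [set w : Omega R S | initial w = i]); last first.
  by apply/seteqP; split => w; rewrite /= E; [case|move=> ->].
move=> P1; exists (~` [set w : Omega R S | initial w = i]); split => //.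
- exact: measurableC.
- by rewrite probability_setC// P1 subee.
Qed.

Theorem theorem3p1 (R : realType)
    (dS : measure_display) (S : measurableType dS)
    (S_countable : countable [set: S])
    (S_discrete : forall B : set S, measurable B)
    (A : ptopologicalType) (A_borel : borel_space R A)
    (mdp : ctmdp R S A) (T : R) (T_gt0 : 0 < T)
    (V : S -> R) (rho M : R)
    (V_ge1 : forall i, 1 <= V i) (rho_gt0 : 0 < rho) (M_gt1 : 1 < M)
    (cond_Ia : forall t i a, graph mdp (t, i, a) ->
      (signed_sum (fun j => rate mdp (t, i, a) [set j] * (V j)%:E)
        <= (rho * V i)%:E)%E)
    (cond_Ib : forall i, (qstar mdp i <= (M * V i)%:E)%E)
    (cond_Ic_cost : forall t i a, graph mdp (t, i, a) ->
      expR (2 * (1 + T) * `|cost mdp (t, i, a)|) <= M * V i)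
    (cond_Ic_terminal : forall i,
      expR (2 * (1 + T) * `|terminal mdp i|) <= M * V i)
    (V1 : S -> R) (rho1 M1 : R)
    (V1_ge1 : forall i, 1 <= V1 i) (rho1_gt0 : 0 < rho1) (M1_gt0 : 0 < M1)
    (cond_IIa : forall t i a, graph mdp (t, i, a) ->
      (signed_sum (fun j => (V1 j ^+ 2)%:E * rate mdp (t, i, a) [set j])
        <= (rho1 * V1 i ^+ 2)%:E)%E)
    (cond_IIb : forall i, V i ^+ 2 <= M1 * V1 i)
    (i : S) (pi : policy mdp) (P : probability (Omega R S) R)
    (P_law : is_controlled_law pi i P)
    (phi phi' : R -> S -> R) (phi_C1 : C1 T V V1 phi)
    (phi'_density : is_time_density T phi phi')
    (phi'_bounded : weight_bounded T V1 phi') :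
  [/\ {ae P, forall w, explosion w = +oo%E /\
        forall j, abs_continuous T (psi pi phi w ^~ j) /\
                  is_density T (psi pi phi w ^~ j) (psi' pi phi phi' w ^~ j)},
      {ae P, forall w,
        lebesgue_measure.-integrable `[0, T] (drift pi phi phi' w)},
      P.-integrable [set: Omega R S] (fun w =>
        \int[lebesgue_measure]_(t in `[0%R, T]) drift pi phi phi' w t)%E,
      P.-integrable [set: Omega R S] (EFin \o terminal_value pi phi T)
    & (\int[P]_w \int[lebesgue_measure]_(t in `[0%R, T])
         drift pi phi phi' w t =
       \int[P]_w (terminal_value pi phi T w)%:E - (phi 0%R i)%:E)%E].
Proof.
have [P_initial comp] := P_law; have i_ae := initial_state_ae S_discrete P_initial.
have V_ge0 j : 0 <= V j by exact: le_trans (V_ge1 j).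
have [phi_bounded _ _] := phi_C1; have [_ dphi] := phi'_density.
have [C0 C0_ge0 phi_le] := weight_bounded_ex V_ge1 phi_bounded.
have [C1' C1_ge0 phi'_le] := weight_bounded_ex V1_ge1 phi'_bounded.
have Ia t j a : graph mdp (t, j, a) ->
    (signed_sum (fun l => (V l)%:E * rate mdp (t, j, a) [set l]) <= (rho * V j)%:E)%E.
  move=> g; rewrite (_ : (fun l => _) = fun l => rate mdp (t, j, a) [set l] * (V l)%:E)%E.
    exact: cond_Ia.
  by apply/funext => l; rewrite muleC.
have rho_ge0 := ltW rho_gt0; have rho1_ge0 := ltW rho1_gt0.
have g_ae := regular_path_ae S_countable S_discrete T_gt0 V_ge1 V1_ge1 M_gt1 M1_gt0 cond_Ib cond_IIb comp rho1_ge0 cond_IIa i_ae.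
split.
- apply: filterS g_ae => w [e o]; split => // j.
  have BU := MV_le_sqr_weight V_ge1 V1_ge1 M_gt1 M1_gt0 cond_IIb.
  split.
    exact: (psi_abs_continuous pi S_countable S_discrete T_gt0 (sqr_weight_ge0 V1) (MV_ge1 V_ge1 M_gt1) BU cond_Ic_cost e o (dphi j)).
  exact: (psi_density pi S_countable S_discrete T_gt0 (sqr_weight_ge0 V1) (MV_ge1 V_ge1 M_gt1) BU cond_Ic_cost e o (dphi j)).
- apply: filterS g_ae => w [e o].
  exact: (drift_integrable pi S_countable S_discrete T_gt0 V_ge1 V1_ge1 rho_ge0 M_gt1 M1_gt0 C0_ge0 C1_ge0 Ia cond_Ib cond_Ic_cost cond_IIb phi_le phi'_le dphi e o).
- exact: (drift_integral_integrable S_countable S_discrete T_gt0 V_ge1 V1_ge1 rho_ge0 M_gt1 M1_gt0 C0_ge0 C1_ge0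
    Ia cond_Ib cond_Ic_cost cond_IIb phi_le phi'_le dphi comp rho1_ge0 cond_IIa i_ae).
- exact: (terminal_value_integrable S_countable S_discrete T_gt0 V_ge1 V1_ge1 rho_ge0 M_gt1 M1_gt0 C0_ge0 C1_ge0
    Ia cond_Ib cond_Ic_cost cond_IIb phi_le phi'_le dphi comp rho1_ge0 cond_IIa i_ae).
- exact: (dynkin_formula S_countable S_discrete T_gt0 V_ge1 V1_ge1 rho_ge0 M_gt1 M1_gt0 C0_ge0 C1_ge0
    Ia cond_Ib cond_Ic_cost cond_IIb phi_le phi'_le dphi comp rho1_ge0 cond_IIa i_ae).
Qed.
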